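(* Let $G=\mathrm{PSL}_2(q)$, where $q$ is a power of an odd prime $p$. Let $$A=\left\{\,2<d\le\tfrac{q+1}{2} : d\mid\tfrac{q+1}{2}\,\right\},\qquad B=\left\{\,2<d\le\tfrac{q-1}{2} : d\mid\tfrac{q-1}{2}\,\right\}.$$ Then the following hold. (1) If $q\equiv3\pmod 4$, then $$\mathbb{Q}G\cong\mathbb{Q}\oplus\mathrm{M}_{\frac{q-1}{2}}(\mathbb{Q}(\sqrt{-q}))\oplus\bigoplus_{d\in A}\mathrm{M}_{q-1}(\mathbb{Q}(\zeta_d+\zeta_d^{-1}))\oplus\mathrm{M}_q(\mathbb{Q})\oplus\bigoplus_{d\in B}\mathrm{M}_{q+1}(\mathbb{Q}(\zeta_d+\zeta_d^{-1})).$$ (2) If $q\equiv1\pmod 4$, then: (a) if $q$ is not a square, $$\mathbb{Q}G\cong\mathbb{Q}\oplus\mathrm{M}_{\frac{q+1}{2}}(\mathbb{Q}(\sqrt{q}))\oplus\bigoplus_{d\in A}\mathrm{M}_{q-1}(\mathbb{Q}(\zeta_d+\zeta_d^{-1}))\oplus\mathrm{M}_q(\mathbb{Q})\oplus\bigoplus_{d\in B}\mathrm{M}_{q+1}(\mathbb{Q}(\zeta_d+\zeta_d^{-1}));$$ (b) if $q$ is a square, $$\mathbb{Q}G\cong\mathbb{Q}\oplus2\,\mathrm{M}_{\frac{q+1}{2}}(\mathbb{Q})\oplus\bigoplus_{d\in A}\mathrm{M}_{q-1}(\mathbb{Q}(\zeta_d+\zeta_d^{-1}))\oplus\mathrm{M}_q(\mathbb{Q})\oplus\bigoplus_{d\in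 B}\mathrm{M}_{q+1}(\mathbb{Q}(\zeta_d+\zeta_d^{-1})).$$
   Context: $\mathrm{SL}_2(q)$ is the group of $2\times2$ matrices of determinant $1$ over the finite field $\mathbb{F}_q$, and $\mathrm{PSL}_2(q)=\mathrm{SL}_2(q)/Z(\mathrm{SL}_2(q))$. For a positive integer $d$, $\zeta_d\in\mathbb{C}$ denotes a primitive $d$-th root of unity. $\mathrm{M}_n(D)$ is the full ring of $n\times n$ matrices over $D$, and $2\,\mathrm{M}_n(D)$ means $\mathrm{M}_n(D)\oplus\mathrm{M}_n(D)$. The sets $A,B$ consist of integers $d$. Isomorphisms are of $\mathbb{Q}$-algebras and give the Wedderburn decomposition of the rational group algebra $\mathbb{Q}G$. *)

(* Defs.v *)
From HB Require Import structures.
From mathcomp Require Import all_boot all_order all_fingroup all_algebra.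
From mathcomp Require Import all_solvable all_field.
From mathcomp Require Import boolp.

Set Implicit Arguments.
Unset Strict Implicit.
Unset Printing Implicit Defensive.

Import GRing.Theory Num.Theory.
Local Open Scope ring_scope.

Section ProjectiveSpecialLinear.

Variable F : finFieldType.

Definition SL2_set : {set {'GL_2[F]}} := [set u | \det (GLval u) == 1].

Fact SL2_group_set : group_set SL2_set.
Proof.
apply/group_setP; split=> [|u v]; rewrite !inE ?GL_1E ?det1 //.
by move=> /eqP du /eqP dv; rewrite GL_ME detM du dv mulr1.
Qed.

Definition SL2 : {group {'GL_2[F]}} := Group SL2_group_set.

Definition PSL2 : {group coset_of 'Z(SL2)%g} := (SL2 / 'Z(SL2))%G.

End ProjectiveSpecialLinear.

(* The product of {ffun gT -> R} inherited from its function structure is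
   pointwise; the alias carries the convolution product instead, f standing
   for the formal sum \sum_x (f x) x. *)
Definition group_alg (R : nzRingType) (gT : finGroupType) : Type :=
  {ffun gT -> R}.

Section GroupAlgebra.

Variable R : comNzRingType.
Variable gT : finGroupType.
Implicit Types f g h : group_alg R gT.

HB.instance Definition _ := GRing.Lmodule.copy (group_alg R gT) {ffun gT -> R^o}.

Definition group_alg_one : group_alg R gT := [ffun x => (x == 1%g)%:R].

Definition group_alg_mul f g : group_alg R gT :=
  [ffun x => \sum_y f y * g (y^-1 * x)%g].

Fact group_alg_mulA : associative group_alg_mul.
Proof.
move=> f g h; apply/ffunP=> x; rewrite !ffunE.
under eq_bigr => y _ do rewrite ffunE big_distrr /=.
under [RHS]eq_bigr => z _ do rewrite ffunE big_distrl /=.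
rewrite [RHS]exchange_big /=; apply: eq_bigr => y _.
rewrite [RHS](reindex_inj (mulgI y)) /=; apply: eq_bigr => z _.
by rewrite mulKg invMg mulgA mulrA.
Qed.

Fact group_alg_mul1 : left_id group_alg_one group_alg_mul.
Proof.
move=> f; apply/ffunP=> x; rewrite !ffunE (bigD1 1%g) //= ffunE eqxx mul1r.
rewrite invg1 mul1g big1 ?addr0 // => y /negPf ny.
by rewrite ffunE ny mul0r.
Qed.

Fact group_alg_mulr1 : right_id group_alg_one group_alg_mul.
Proof.
move=> f; apply/ffunP=> x; rewrite !ffunE (bigD1 x) //= ffunE mulVg eqxx mulr1.
rewrite big1 ?addr0 // => y ny.
rewrite ffunE -eq_mulVg1.
by rewrite (negPf ny) mulr0.
Qed.

Fact group_alg_mulDl : left_distributive group_alg_mul +%R.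
Proof.
move=> f g h; apply/ffunP=> x; rewrite !ffunE -big_split /=.
by apply: eq_bigr => y _; rewrite ffunE mulrDl.
Qed.

Fact group_alg_mulDr : right_distributive group_alg_mul +%R.
Proof.
move=> f g h; apply/ffunP=> x; rewrite !ffunE -big_split /=.
by apply: eq_bigr => y _; rewrite ffunE mulrDr.
Qed.

Fact group_alg_oner_neq0 : group_alg_one != 0.
Proof.
by apply/eqP=> /ffunP/(_ 1%g); rewrite !ffunE eqxx => /eqP; rewrite oner_eq0.
Qed.

HB.instance Definition _ := GRing.Zmodule_isNzRing.Build (group_alg R gT)
  group_alg_mulA group_alg_mul1 group_alg_mulr1
  group_alg_mulDl group_alg_mulDr group_alg_oner_neq0.

Fact group_alg_scaleAl (a : R) f g : a *: (f * g) = (a *: f) * g.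
Proof.
apply/ffunP=> x; rewrite !ffunE [LHS]big_distrr /=.
by apply: eq_bigr => y _; rewrite ffunE -[RHS]mulrA.
Qed.

HB.instance Definition _ :=
  GRing.Lmodule_isLalgebra.Build R (group_alg R gT) group_alg_scaleAl.

Fact group_alg_scaleAr (a : R) f g : a *: (f * g) = f * (a *: g).
Proof.
apply/ffunP=> x; rewrite !ffunE [LHS]big_distrr /=.
by apply: eq_bigr => y _; rewrite ffunE [RHS]mulrCA.
Qed.

HB.instance Definition _ :=
  GRing.Lalgebra_isAlgebra.Build R (group_alg R gT) group_alg_scaleAr.

End GroupAlgebra.

Section SimpleExtension.

Variable z : algC.

(* The least subfield of the algebraic complex numbers containing z. *)
Definition Qadj_pred : {pred algC} := fun x =>
  `[< forall S : {pred algC}, GRing.divring_closed S -> z \in S -> x \in S >].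

Fact Qadj_divring_closed : GRing.divring_closed Qadj_pred.
Proof.
split=> [|x y /asboolP Kx /asboolP Ky|x y /asboolP Kx /asboolP Ky].
- by apply/asboolP=> S [].
- by apply/asboolP=> S cS Sz; case: (cS) => _ + _; apply; [apply: Kx|apply: Ky].
- by apply/asboolP=> S cS Sz; case: (cS) => _ _; apply; [apply: Kx|apply: Ky].
Qed.

HB.instance Definition _ :=
  GRing.isDivringClosed.Build algC Qadj_pred Qadj_divring_closed.

Record Qadj : predArgType := QAdj { Qadj_val :> algC; _ : Qadj_val \in Qadj_pred }.

HB.instance Definition _ := [isSub for Qadj_val].
HB.instance Definition _ := [Choice of Qadj by <:].
HB.instance Definition _ := [SubChoice_isSubIntegralDomain of Qadj by <:].
HB.instance Definition _ := [SubIntegralDomain_isSubField of Qadj by <:].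

Fact Qadj_ratr a : ratr a \in Qadj_pred.
Proof. by rewrite rpred_div ?rpred_int. Qed.

Definition Qadj_scale (a : rat) (x : Qadj) : Qadj := QAdj (Qadj_ratr a) * x.

Fact Qadj_scaleA a b x : Qadj_scale a (Qadj_scale b x) = Qadj_scale (a * b) x.
Proof. by apply: val_inj; rewrite /= mulrA rmorphM. Qed.

Fact Qadj_scale1 : left_id 1 Qadj_scale.
Proof. by move=> x; apply: val_inj; rewrite /= rmorph1 mul1r. Qed.

Fact Qadj_scaleDr : right_distributive Qadj_scale +%R.
Proof. by move=> a x y; apply: val_inj; rewrite /= mulrDr. Qed.

Fact Qadj_scaleDl x : {morph Qadj_scale^~ x : a b / a + b}.
Proof. by move=> a b; apply: val_inj; rewrite /= rmorphD mulrDl. Qed.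

HB.instance Definition _ := GRing.Zmodule_isLmodule.Build rat Qadj
  Qadj_scaleA Qadj_scale1 Qadj_scaleDr Qadj_scaleDl.

Fact Qadj_scaleAl (a : rat) (x y : Qadj) : a *: (x * y) = (a *: x) * y.
Proof. exact: mulrA. Qed.

HB.instance Definition _ :=
  GRing.Lmodule_isLalgebra.Build rat Qadj Qadj_scaleAl.
HB.instance Definition _ := GRing.Lalgebra_isComAlgebra.Build rat Qadj.

End SimpleExtension.

Arguments Qadj z%_R.

(* 'M[A]_n is canonically a module over A only; the alias is the R-algebra of
   matrices over an R-algebra A, scaled entrywise. *)
Definition mx_alg (R : nzRingType) (n : nat) (A : algType R) : Type := 'M[A]_n.

Arguments mx_alg {R} n%_N A.

Section MatrixAlgebra.

Variables (R : nzRingType) (n : nat) (A : algType R).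
Implicit Types M N : mx_alg n A.

HB.instance Definition _ := GRing.PzRing.copy (mx_alg n A) 'M[A]_n.

Definition mx_alg_scale (a : R) M : mx_alg n A := map_mx ( *:%R a) M.

Fact mx_alg_scaleA a b M :
  mx_alg_scale a (mx_alg_scale b M) = mx_alg_scale (a * b) M.
Proof. by apply/matrixP=> i j; rewrite !mxE scalerA. Qed.

Fact mx_alg_scale1 : left_id 1 mx_alg_scale.
Proof. by move=> M; apply/matrixP=> i j; rewrite !mxE scale1r. Qed.

Fact mx_alg_scaleDr : right_distributive mx_alg_scale +%R.
Proof. by move=> a M N; apply/matrixP=> i j; rewrite !mxE scalerDr. Qed.

Fact mx_alg_scaleDl M : {morph mx_alg_scale^~ M : a b / a + b}.
Proof. by move=> a b; apply/matrixP=> i j; rewrite !mxE scalerDl. Qed.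

HB.instance Definition _ := GRing.Zmodule_isLmodule.Build R (mx_alg n A)
  mx_alg_scaleA mx_alg_scale1 mx_alg_scaleDr mx_alg_scaleDl.

End MatrixAlgebra.

(* The direct sum of a finite, possibly empty, family, with componentwise
   operations. The ring and module structures are kept separate because
   algType excludes the zero ring, which is the empty sum. *)
Definition dirsum (I : finType) (B : I -> Type) : Type :=
  {dffun forall i : I, B i}.

HB.instance Definition _ (I : finType) (B : I -> choiceType) :=
  Choice.copy (dirsum B) {dffun forall i : I, B i}.

Section DirSumZmodule.

Variables (I : finType) (B : I -> zmodType).
Implicit Types f g : dirsum B.

Definition dirsum_zero : dirsum B := [ffun i => 0].
Definition dirsum_opp f : dirsum B := [ffun i => - f i].
Definition dirsum_add f g : dirsum B := [ffun i => f i + g i].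

Fact dirsum_addA : associative dirsum_add.
Proof. by move=> f g h; apply/ffunP=> i; rewrite !ffunE addrA. Qed.

Fact dirsum_addC : commutative dirsum_add.
Proof. by move=> f g; apply/ffunP=> i; rewrite !ffunE addrC. Qed.

Fact dirsum_add0 : left_id dirsum_zero dirsum_add.
Proof. by move=> f; apply/ffunP=> i; rewrite !ffunE add0r. Qed.

Fact dirsum_addN : left_inverse dirsum_zero dirsum_opp dirsum_add.
Proof. by move=> f; apply/ffunP=> i; rewrite !ffunE addNr. Qed.

HB.instance Definition _ := GRing.isZmodule.Build (dirsum B)
  dirsum_addA dirsum_addC dirsum_add0 dirsum_addN.

End DirSumZmodule.

Section DirSumRing.

Variables (I : finType) (B : I -> pzRingType).
Implicit Types f g : dirsum B.

Definition dirsum_one : dirsum B := [ffun i => 1].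
Definition dirsum_mul f g : dirsum B := [ffun i => f i * g i].

Fact dirsum_mulA : associative dirsum_mul.
Proof. by move=> f g h; apply/ffunP=> i; rewrite !ffunE mulrA. Qed.

Fact dirsum_mul1 : left_id dirsum_one dirsum_mul.
Proof. by move=> f; apply/ffunP=> i; rewrite !ffunE mul1r. Qed.

Fact dirsum_mulr1 : right_id dirsum_one dirsum_mul.
Proof. by move=> f; apply/ffunP=> i; rewrite !ffunE mulr1. Qed.

Fact dirsum_mulDl : left_distributive dirsum_mul +%R.
Proof. by move=> f g h; apply/ffunP=> i; rewrite !ffunE mulrDl. Qed.

Fact dirsum_mulDr : right_distributive dirsum_mul +%R.
Proof. by move=> f g h; apply/ffunP=> i; rewrite !ffunE mulrDr. Qed.

HB.instance Definition _ := GRing.Zmodule_isPzRing.Build (dirsum B)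
  dirsum_mulA dirsum_mul1 dirsum_mulr1 dirsum_mulDl dirsum_mulDr.

End DirSumRing.

Section DirSumLmodule.

Variables (R : pzRingType) (I : finType) (B : I -> lmodType R).
Implicit Types f g : dirsum B.

Definition dirsum_scale (a : R) f : dirsum B := [ffun i => a *: f i].

Fact dirsum_scaleA a b f :
  dirsum_scale a (dirsum_scale b f) = dirsum_scale (a * b) f.
Proof. by apply/ffunP=> i; rewrite !ffunE scalerA. Qed.

Fact dirsum_scale1 : left_id 1 dirsum_scale.
Proof. by move=> f; apply/ffunP=> i; rewrite !ffunE scale1r. Qed.

Fact dirsum_scaleDr : right_distributive dirsum_scale +%R.
Proof. by move=> a f g; apply/ffunP=> i; rewrite !ffunE scalerDr. Qed.

Fact dirsum_scaleDl f : {morph dirsum_scale^~ f : a b / a + b}.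
Proof. by move=> a b; apply/ffunP=> i; rewrite !ffunE scalerDl. Qed.

HB.instance Definition _ := GRing.Zmodule_isLmodule.Build R (dirsum B)
  dirsum_scaleA dirsum_scale1 dirsum_scaleDr dirsum_scaleDl.

End DirSumLmodule.

Definition divisors_gt2 (m : nat) : {set 'I_m.+1} :=
  [set d : 'I_m.+1 | (2 < d <= m)%N && (d %| m)%N].

Notation "\oplus_ ( d 'in' S ) B" :=
  (dirsum (fun d : {d | d \in S} => B%type))
  (at level 41, d binder, B at level 41,
   format "\oplus_ ( d  'in'  S )  B") : type_scope.

Notation "A '~=alg' B" := (exists f : {lrmorphism A -> B}, bijective f)
  (at level 70, no associativity) : type_scope.

(* Main.v *)
(* The irreducible characters of SL_2(q) trivial on -1 are 1, the Steinberg
   character St, the principal series R(w) with w^((q-1)/2) = 1, the discrete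
   series pi(w) with w^((q+1)/2) = 1 (w^2 <> 1 in both cases), and the two halves
   of R(-1) or pi(-1). R(w) is induced from a linear character of the Borel
   subgroup, and pi(w) = R(1) - 2 + P(1) - P(w) where P(w) is induced from a linear
   character of the nonsplit torus. Their inner products are computed on these
   subgroups, and the list is complete because the character induced from
   the trivial character of the center is
     1 + q St + (q+1)/2 sum_(w <> 1) R(w) + (q-1)/2 sum_(w <> 1) pi(w).
   A Galois automorphism nu maps R(w) to R(nu w) and pi(w) to pi(nu w), and
   R(w) = R(w^-1), pi(w) = pi(w^-1), whence the fields Q(zeta_d + zeta_d^-1). The
   difference of the two half characters takes the value sqrt(+-q) on unipotent
   elements, whence the fields Q(sqrt(+-q)).

   Schur indices are 1 because each character is afforded over its character
   field: it suffices to find an idempotent A of trace 1 in its representation X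
   such that all traces of X(g) A lie in that field. For St and the half
   characters A projects onto a linear character of multiplicity 1. For R(w)
   and pi(w), with E+ and E- the projections onto the eigenlines of w and w^-1
   and Y = X(y) for y inverting the torus,
     A = (E+ + E- + a E- Y E+ + b E+ Y E-) / 2,
   where a b = q is solved by the Galois-conjugate Jacobi sums J(w), J(w^-1)
   for R(w), and a = b = 1 for pi(w).

   Given one representation over its character field from every Galois orbit,
   Fourier inversion shows that together they map the rational group algebra
   isomorphically onto the product of the corresponding matrix algebras. *)

Require Import Defs.
From HB Require Import structures.
From mathcomp Require Import all_boot all_order all_fingroup all_algebra.
From mathcomp Require Import all_solvable all_field all_character.
From mathcomp Require Import boolp ring zify.

Set Implicit Arguments.
Unset Strict Implicit.
Unset Printing Implicit Defensive.

Import Order.TTheory GRing.Theory Num.Theory.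
Local Open Scope ring_scope.

(** * Galois action on algebraic numbers *)

(** Write q = 2 n + 1 and m = n + 1. Modulo the center the two tori are cyclic of orders n and m,
    and -1 is an n-th root of unity for even n, an m-th root of unity for odd n; the parity of n
    decides q modulo 4. All fields lie in [algC], where x belongs to Q(z) as soon as every
    automorphism fixing z fixes x. Each rationality question thus becomes the effect of an
    automorphism on roots of unity. The obstacle is the Schur index of R(w) and pi(w): a single
    eigenline is defined over Q(w) only. The automorphism inverting w exchanges the two eigenlines,
    so A has to be symmetric under it, while A is idempotent when a b c = 1, where E+ Y E- Y E+ = c
    E+. Hence 1/c must be a norm from Q(w) to Q(w + w^-1). For pi(w), Y normalizes the torus and c =
    1. For R(w) the projections belong to the Borel subgroup, which Y does not normalize, and c =
    |T| / |B| = 1/q; the Jacobi sums exhibit q as a norm. That every element is conjugate into the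
    Borel subgroup or the nonsplit torus is not shown by eigenvalues: it is read off from the
    completeness formula. *)

(** The roots of the product of the minimal polynomials of z and x generate a number field that is
    Galois over Q(z). Its automorphisms over Q(z) extend to [algC], so x lies in their fixed field,
    which is Q(z). *)
Lemma Qadj_fixed (z x : algC) :
    (forall nu : {rmorphism algC -> algC}, nu z = z -> nu x = x) ->
  x \in Qadj_pred z.
Proof.
move=> fix_x.
have [pz [Dpz mon_pz _]] := minCpolyP z; have [px [Dpx mon_px _]] := minCpolyP x.
pose P := pz * px; pose QtoC := @ratr algC.
have mon_P : map_poly QtoC P \is monic by rewrite map_monic monicMl.
have [r Dr] := closed_field_poly_normal (map_poly QtoC P).
rewrite (monicP mon_P) scale1r in Dr.
have rootP y : root (map_poly QtoC P) y -> y \in r.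
  by rewrite Dr root_prod_XsubC.
have rz : z \in r by apply: rootP; rewrite rmorphM rootM /= -Dpz root_minCpoly.
have rx : x \in r.
  by apply: rootP; rewrite rmorphM rootM /= -Dpx root_minCpoly orbT.
have [Qn [QnC [rs Drs genQn]]] := num_field_exists r.
have [z1 _ Dz] : exists2 z1, z1 \in rs & z = QnC z1.
  by apply/mapP; rewrite Drs.
have [x1 _ Dx] : exists2 x1, x1 \in rs & x = QnC x1.
  by apply/mapP; rewrite Drs.
pose P1 : {poly Qn} := map_poly (in_alg Qn) P.
have P1E : P1 = \prod_(y <- rs) ('X - y%:P).
  apply: (map_poly_inj QnC); rewrite rmorph_prod /=.
  transitivity (map_poly QtoC P).
    rewrite -map_poly_comp; apply: eq_map_poly => a /=.
    by rewrite alg_num_field fmorph_rat.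
  rewrite Dr -Drs big_map; apply: eq_bigr => y _.
  by rewrite rmorphB /= map_polyX map_polyC.
have P1_over : P1 \is a polyOver 1%AS.
  by apply/polyOverP=> i; rewrite coef_map /= rpredZ ?mem1v.
have splitP : splittingFieldFor 1 P1 {:Qn} by exists rs; rewrite ?P1E ?eqpxx.
have Qn_ax : FieldExt_isSplittingField _ Qn by constructor; exists P1.
pose L : splittingFieldType rat := HB.pack_for (splittingFieldType rat) Qn Qn_ax.
have galK : @galois _ L <<1; (z1 : L)>>%AS {:L}%AS.
  apply/and3P; split; first exact: subvf.
    apply/separableP=> y _; apply: pcharf0_separable.
    by apply/pcharf0P=> n; rewrite -(fmorph_eq0 QnC) rmorph_nat pnatr_eq0.
  apply/splitting_normalField; first exact: subvf.
  exists P1; first exact: polyOverSv (sub1v _) _ P1_over.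
  exists rs; first by rewrite P1E eqpxx.
  apply/eqP; rewrite eqEsubv subvf /= -genQn.
  by apply/Fadjoin_seqP; split=> [|y ys]; [apply: subv_trans (subv_adjoin_seq _ _);
    exact: sub1v | exact: seqv_sub_adjoin].
have /galois_fixedField fixK := galK.
have x1K : x1 \in <<1; (z1 : L)>>%VS.
  rewrite -fixK; apply/fixedFieldP=> [|g Kg]; first exact: memvf.
  have [nu Dnu] := extend_algC_subfield_aut QnC (g : {rmorphism L -> L}).
  apply: (fmorph_inj QnC); rewrite /= Dnu -Dx; apply: fix_x.
  rewrite Dz -Dnu; congr (QnC _); apply: (fixed_gal _ Kg); first exact: subvf.
  exact: memv_adjoin.
have /Fadjoin_polyP[f f1 Df] := x1K.
(* x is now a polynomial in z with rational coefficients, hence lies in every subfield containing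
   z. *)
rewrite Dx Df -horner_map Dz horner_coef rpred_sum // => i _.
rewrite coef_map /=.
have /vlineP[a ->] : f`_i \in 1%VS by apply/polyOverP.
rewrite rmorphZ_num rmorph1 mulr1 rpredM ?Qadj_ratr // rpredX //.
by apply/asboolP=> S _.
Qed.

(** The equalizer of nu and mu is one of the subfields over which [Qadj_pred] quantifies. *)
Lemma Qadj_aut_eq (z : algC) (nu mu : {rmorphism algC -> algC}) :
  nu z = mu z -> {in Qadj_pred z, nu =1 mu}.
Proof.
move=> eq_z x /asboolP Kx; apply/eqP/(Kx [pred y | nu y == mu y]); last exact/eqP.
split=> [|a b|a b]; rewrite !inE ?rmorph1 //.
  by move=> /eqP ea /eqP eb; rewrite !rmorphB ea eb.
by move=> /eqP ea /eqP eb; rewrite !fmorph_div ea eb.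
Qed.

Lemma Crat_fixed (x : algC) :
  (forall nu : {rmorphism algC -> algC}, nu x = x) -> x \in Crat.
Proof.
move=> fix_x; have /asboolP : x \in Qadj_pred 0 by apply: Qadj_fixed.
have CQ := Crat_divring_closed; apply; first exact: CQ.
exact: rpred0.
Qed.

Lemma prim_root_aut_exists (d : nat) (z w : algC) :
    d.-primitive_root z -> d.-primitive_root w ->
  exists nu : {rmorphism algC -> algC}, nu z = w.
Proof.
move=> prim_z prim_w; have [k Dw] := prim_rootP prim_z (prim_expr_order prim_w).
have [|nu Dnu] := @Qn_aut_exists k d.
  by rewrite -(prim_root_exp_coprime _ prim_z) -Dw.
by exists nu; rewrite Dw; apply: Dnu; apply: prim_expr_order.
Qed.

(** * Wedderburn decomposition over the rationals *)

Lemma mxtrace_sum (R : pzSemiRingType) n (J : Type) (r : seq J) (P : pred J)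
    (F : J -> 'M[R]_n) :
  \tr (\sum_(j <- r | P j) F j) = \sum_(j <- r | P j) \tr (F j).
Proof. exact: raddf_sum. Qed.

Lemma mxtrace_mul_eq0 (R : comNzRingType) (n : nat) (D : 'M[R]_n) :
  (forall B : 'M_n, \tr (B *m D) = 0) -> D = 0.
Proof.
move=> trD0; apply/matrixP=> i j; rewrite !mxE -(trD0 (delta_mx j i)).
rewrite /mxtrace (bigD1 j) //= big1 ?addr0 => [|k /negPf nkj].
  rewrite mxE (bigD1 i) //= mxE !eqxx mul1r big1 ?addr0 // => l /negPf nli.
  by rewrite mxE nli andbF mul0r.
by rewrite mxE big1 // => l _; rewrite mxE nkj mul0r.
Qed.

Section IrrSpan.

Variables (gT : finGroupType) (G : {group gT}) (n : nat).
Variable rG : mx_representation algC G n.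
Hypothesis irr_rG : cfRepr rG \in irr G.

Lemma cfRepr_mx_irr : mx_irreducible rG.
Proof.
have /irr_reprP[[m rH] irr_rH eq_rGH] := irr_rG.
by apply: mx_rsim_irr irr_rH; apply: cfRepr_inj.
Qed.

(** Burnside's theorem: over the algebraically closed field [algC] irreducibility is absolute, so
    the enveloping algebra is full. *)
Lemma cfRepr_irr_span A : exists a : gT -> algC, A = \sum_(x in G) a x *: rG x.
Proof.
apply/envelop_mxP; rewrite submx_full //.
by case/andP: (groupC cfRepr_mx_irr).
Qed.

Lemma cfRepr_trace_eq0 (D : 'M_n) :
  {in G, forall x, \tr (rG x *m D) = 0} -> D = 0.
Proof.
move=> trD0; apply: mxtrace_mul_eq0 => B; have [a ->] := cfRepr_irr_span B.
rewrite mulmx_suml mxtrace_sum big1 // => x Gx.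
by rewrite -scalemxAl /= mxtraceZ trD0 // mulr0.
Qed.

End IrrSpan.

Section RationalWedderburn.

Variables (gT : finGroupType) (G : {group gT}) (I : finType) (n : I -> nat).
Variables (X : forall i, mx_representation algC G (n i)) (z : I -> algC).

Local Notation "''X_' i" := (cfRepr (X i)) (at level 8, i at level 2).

Hypothesis irr_X : forall i, 'X_i \in irr G.
Hypothesis X_Qadj : forall i g a b, g \in G -> X i g a b \in Qadj_pred (z i).
Hypothesis aut_z : forall i (nu mu : {rmorphism algC -> algC}),
  cfAut nu 'X_i = cfAut mu 'X_i -> nu (z i) = mu (z i).
Hypothesis irr_aut_X : forall k : Iirr G,
  exists i, exists nu : {rmorphism algC -> algC}, 'chi_k = cfAut nu 'X_i.
Hypothesis aut_X_inj : forall i j (nu mu : {rmorphism algC -> algC}),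
  cfAut nu 'X_i = cfAut mu 'X_j -> i = j.

(** Since x is rational, the relation for [X i] passes to all its Galois conjugates, hence to every
    irreducible character. Weighted by degrees these add up to the regular character, which isolates
    x at h. *)
Lemma rational_wedderburn_inj (x : gT -> rat) :
    (forall i, \sum_(g in G) ratr (x g) *: X i g = 0) ->
  {in G, forall g, x g = 0}.
Proof.
move=> x0 h Gh; apply: (fmorph_inj (@ratr algC)); rewrite rmorph0.
have chi0 k : \sum_(g in G) ratr (x g) * 'chi[G]_k (h^-1 * g)%g = 0.
  have [i [nu ->]] := irr_aut_X k.
  transitivity (nu (\tr (X i h^-1%g *m (\sum_(g in G) ratr (x g) *: X i g)))).
    rewrite mulmx_sumr mxtrace_sum rmorph_sum; apply: eq_bigr => g Gg /=.
    rewrite !cfunE groupM ?groupV // mulr1n -scalemxAr mxtraceZ rmorphM /=.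
    by rewrite fmorph_rat repr_mxM ?groupV.
  by rewrite x0 mulmx0 linear0 rmorph0.
suffices /eqP : #|G|%:R * ratr (x h) = 0 :> algC.
  by rewrite mulf_eq0 (negPf (neq0CG G)) /= => /eqP.
transitivity (\sum_(g in G) ratr (x g) * cfReg G (h^-1 * g)%g).
  rewrite (bigD1 h) //= mulVg cfRegE eqxx mulr1n mulrC big1 ?addr0 // => g.
  by case/andP=> _ ngh; rewrite cfRegE -eq_mulVg1 eq_sym (negPf ngh) mulr0.
rewrite cfReg_sum (eq_bigr (fun g => \sum_k 'chi[G]_k 1%g *
    (ratr (x g) * 'chi[G]_k (h^-1 * g)%g))) => [|g Gg].
  by rewrite exchange_big big1 // => k _; rewrite -mulr_sumr chi0 mulr0.
rewrite sum_cfunE mulr_sumr; apply: eq_bigr => k _.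
by rewrite cfunE mulrCA.
Qed.

(** Every irreducible representation is a conjugate of some [X i] by a chosen automorphism [nuk k],
    and its target is M i conjugated likewise. The Fourier inverse [x0] of these targets is rational
    because an automorphism only permutes its summands. *)
Lemma rational_wedderburn_surj (M : forall i, 'M[algC]_(n i)) :
    (forall i a b, M i a b \in Qadj_pred (z i)) ->
  exists x : gT -> rat, forall i, \sum_(g in G) ratr (x g) *: X i g = M i.
Proof.
move=> M_Qadj.
have /fin_all_exists[ik /fin_all_exists[nuk Dk]] := irr_aut_X.
pose Xk k := map_repr (nuk k) (X (ik k)).
pose Mk k := map_mx (nuk k) (M (ik k)).
have DXk k : cfRepr (Xk k) = 'chi_k by rewrite Dk cfRepr_map.
have irrXk k : cfRepr (Xk k) \in irr G by rewrite DXk mem_irr.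
pose tr_k k g := \tr (X (ik k) g^-1%g *m M (ik k)).
pose x0 g : algC := #|G|%:R^-1 * \sum_k 'chi[G]_k 1%g * nuk k (tr_k k g).
have x0_rat g : g \in G -> x0 g \in Crat.
  move=> Gg; apply: Crat_fixed => nu; rewrite rmorphM fmorphV rmorph_nat.
  congr (_ * _); rewrite rmorph_sum [RHS](reindex_inj (aut_Iirr_inj nu)) /=.
  apply: eq_bigr => k _; rewrite aut_IirrE cfunE rmorphM; congr (_ * _).
  set k' := aut_Iirr nu k; have Dk' : 'chi_k' = cfAut nu 'chi_k.
    by rewrite aut_IirrE.
  (* [nuk k'] and mu may differ, but they give the same conjugate character; by [aut_z] they agree
     on the field containing the trace. *)
  pose mu : {rmorphism algC -> algC} := nu \o nuk k.
  have Emu : cfAut (nuk k') 'X_(ik k') = cfAut mu 'X_(ik k).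
    rewrite -Dk Dk' Dk; apply/cfun_inP=> y Gy.
    by rewrite !cfunE Gy.
  have eq_ik := aut_X_inj Emu; rewrite /tr_k.
  move: (nuk k') Emu; rewrite eq_ik => la Emu.
  have eq_z := aut_z Emu.
  rewrite -[LHS]/(mu _); apply/esym/(Qadj_aut_eq eq_z).
  rewrite rpred_sum // => a _; rewrite mxE rpred_sum // => b _.
  by rewrite rpredM ?X_Qadj ?groupV.
have /fin_all_exists[xq Dx] (g : gT) : exists a, g \in G -> x0 g = ratr a.
  have [/x0_rat/CratP[a Da] | _] := boolP (g \in G); first by exists a.
  by exists 0.
have Xx k : \sum_(g in G) x0 g *: Xk k g = Mk k.
  apply/eqP; rewrite -subr_eq0; apply/eqP/(cfRepr_trace_eq0 (irrXk k)) => h Gh.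
  rewrite mulmxBr linearB /=; apply/eqP; rewrite subr_eq0; apply/eqP.
  (* Schur orthogonality against an arbitrary matrix: only the component l = k of [x0] is seen by
     [Xk k]. *)
  have ortho l : \sum_(g in G) \tr (Xk l g^-1%g *m Mk l) * 'chi_k (h * g)%g
      = (k == l)%:R * (#|G|%:R / 'chi_k 1%g * \tr (Xk k h *m Mk k)).
    have [a Da] := cfRepr_irr_span (irrXk l) (Mk l).
    transitivity (\sum_(y in G) a y *
        \sum_(g in G) 'chi_l (g^-1 * y)%g * 'chi_k (h * g)%g).
      under [RHS]eq_bigr do rewrite mulr_sumr.
      rewrite exchange_big /=; apply: eq_bigr => g Gg.
      rewrite {1}Da mulmx_sumr mxtrace_sum big_distrl; apply: eq_bigr => y Gy /=.
      rewrite -scalemxAr mxtraceZ -repr_mxM ?groupV // -mulrA -!DXk !cfunE.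
      by rewrite !groupM ?groupV // !mulr1n.
    have gen y : y \in G -> \sum_(g in G) 'chi_l (g^-1 * y)%g * 'chi_k (h * g)%g
        = (k == l)%:R * (#|G|%:R / 'chi_k 1%g * 'chi_k (h * y)%g).
      move=> Gy; have := generalized_orthogonality_relation (h * y) k l.
      move/(canRL (mulVKf (neq0CG G))) => gor.
      transitivity (\sum_(g in G) 'chi_k (g * (h * y))%g * 'chi_l g^-1%g).
        rewrite (reindex_inj (mulgI y)) /=.
        apply: eq_big => [g | g Gyg]; first by rewrite groupMl.
        have Gg : g \in G by rewrite -(groupMl _ Gy).
        rewrite invMg mulgKV mulrC -(cfunJ _ (g * (h * y)) Gg) conjgE.
        by rewrite !mulgA mulVg mul1g.
      by rewrite gor mulrCA; congr (_ * _); rewrite mulrA mulrAC.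
    rewrite (eq_bigr (fun y => (k == l)%:R * (#|G|%:R / 'chi_k 1%g *
        (a y * 'chi_k (h * y)%g)))) => [|y Gy]; last first.
      by rewrite gen // mulrCA; congr (_ * _); rewrite mulrCA.
    rewrite -!mulr_sumr; have [eq_kl | _] := eqVneq k l; last by rewrite !mul0r.
    congr (_ * (_ * _)); rewrite eq_kl Da mulmx_sumr mxtrace_sum.
    apply: eq_bigr => y Gy; rewrite -scalemxAr mxtraceZ -repr_mxM // -!DXk.
    by rewrite cfunE groupM // mulr1n.
  rewrite mulmx_sumr mxtrace_sum /=.
  transitivity (\sum_(g in G) #|G|%:R^-1 * (\sum_l 'chi[G]_l 1%g *
      (\tr (Xk l g^-1%g *m Mk l) * 'chi_k (h * g)%g))).
    apply: eq_bigr => g Gg; rewrite -scalemxAr mxtraceZ -repr_mxM // /x0.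
    rewrite -mulrA; congr (_ * _); rewrite big_distrl; apply: eq_bigr => l _ /=.
    rewrite -mulrA; congr (_ * (_ * _)).
      by rewrite -trace_map_mx map_mxM.
    by rewrite -DXk cfunE groupM.
  rewrite -mulr_sumr exchange_big /=.
  rewrite (bigD1 k) //= -mulr_sumr ortho eqxx mul1r [X in _ + X]big1 => [|l nlk].
    by rewrite addr0; field; rewrite neq0CG irr1_neq0.
  by rewrite -mulr_sumr ortho eq_sym (negPf nlk) mul0r mulr0.
exists xq => i; have /irrP[k Dik] := irr_X i.
(* The representative chosen for the orbit of 'X_i can only be i. The automorphism chosen with it
   need not be the identity, but it occurs on both sides of the equation for k and is injective on
   matrices. *)
have Di : ik k = i.
  apply/esym/(@aut_X_inj _ _ idfun (nuk k)); rewrite -Dk Dik.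
  by apply/cfun_inP=> y Gy; rewrite !cfunE.
move: (Xx k); rewrite /Xk /Mk; move: (nuk k) => nu; rewrite Di => XxM.
apply: (map_mx_inj (f := nu)); rewrite -XxM raddf_sum; apply: eq_bigr => g Gg.
by rewrite /= map_mxZ /= Dx // fmorph_rat.
Qed.

End RationalWedderburn.

(** * Realization over the character field *)

(** In the rank factorization A = u v the factors have one-sided inverses, which cancel from u v u v
    = u v; the trace is then the rank. *)
Lemma idempotent_mx_factor (K : fieldType) (n : nat) (A : 'M[K]_n) :
    A *m A = A ->
  exists r, exists u : 'M[K]_(n, r), exists v : 'M[K]_(r, n),
    [/\ A = u *m v, v *m u = 1%:M & \tr A = r%:R].
Proof.
move=> AA; exists (\rank A), (col_base A), (row_base A).
have vu : row_base A *m col_base A = 1%:M.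
  have [u'] := row_fullP (col_base_full A).
  have [v'] := row_freeP (row_base_free A).
  move: (col_base A) (row_base A) (mulmx_base A) => u v Duv vv' u'u.
  have : u' *m (u *m v *m (u *m v)) *m v' = u' *m (u *m v) *m v'.
    by rewrite Duv AA.
  by rewrite !mulmxA u'u mul1mx -!mulmxA vv' mulmx1.
by split; rewrite // -{1}(mulmx_base A) // mxtrace_mulC vu mxtrace1.
Qed.

Section Realization.

Variables (gT : finGroupType) (G : {group gT}) (n : nat).
Variable rG : mx_representation algC G n.
Hypothesis irr_rG : cfRepr rG \in irr G.
Variables (z : algC) (A : 'M[algC]_n).
Hypotheses (AA : A *m A = A) (trA : \tr A = 1).
Hypothesis trGA : {in G, forall g, \tr (rG g *m A) \in Qadj_pred z}.

(* If A = u v with v u = 1, the matrix coefficients v (rG g) u = tr (rG g A)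
   lie in Q(z), so rG is defined over Q(z) in a basis of vectors v (rG g). *)
Lemma cfRepr_realization :
  exists2 rH : mx_representation algC G n,
    cfRepr rH = cfRepr rG & {in G, forall g a b, rH g a b \in Qadj_pred z}.
Proof.
have [r [u [v [Duv vu tr_r]]]] := idempotent_mx_factor AA.
have r1 : r = 1 by apply/eqP; rewrite -(eqr_nat algC) -tr_r trA.
rewrite {r tr_r}r1 in u v Duv vu.
(* By irreducibility the rows v (rG g) span the whole space; a maximal free subfamily Y of them is
   the new basis. *)
pose W := \matrix_(i < #|G|) (v *m rG (enum_val i)).
have fullW : row_full W.
  rewrite -sub1mx; apply/row_subP=> i; rewrite -[row i _]mul1mx -vu -mulmxA.
  have [a ->] := cfRepr_irr_span irr_rG (u *m row i 1%:M).
  rewrite mulmx_sumr summx_sub // => x Gx; rewrite -scalemxAr scalemx_sub //.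
  by rewrite (eq_row_sub (enum_rank_in Gx x)) // rowK enum_rankK_in.
pose Y := rowsub (fullrankfun fullW) W.
have uY : Y \in unitmx by apply: fullrowsub_unit.
(* Dually, the columns (rG g) u span, so a matrix killing all of them is zero. *)
have colspan m (D : 'M_(m, n)) : {in G, forall g, D *m rG g *m u = 0} -> D = 0.
  move=> D0; apply/matrixP=> i j; rewrite [RHS]mxE.
  suffices /colP/(_ i) : col j D = 0 by rewrite !mxE.
  rewrite -[col j D]mulmx1 -vu colE.
  have [a Da] := cfRepr_irr_span irr_rG (delta_mx j 0 *m v).
  rewrite -!mulmxA [delta_mx j 0 *m _]mulmxA Da mulmx_suml mulmx_sumr.
  by rewrite big1 // => x Gx; rewrite -scalemxAl -scalemxAr mulmxA D0 ?scaler0.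
exists (rconj_repr rG uY).
  apply: cfRepr_sim; exists Y => //; first by rewrite row_free_unit.
  by move=> x Gx; rewrite /= -mulmxA mulVmx ?mulmx1.
(* The new entries are not computed: they are shown to be fixed by every automorphism nu that fixes
   z. *)
move=> g Gg a b; apply: Qadj_fixed => nu nuz.
have nuQ x : x \in Qadj_pred z -> nu x = x.
  exact: (@Qadj_aut_eq z nu idfun nuz x).
have YGu h : h \in G -> map_mx nu (Y *m rG h *m u) = Y *m rG h *m u.
  move=> Gh; apply/matrixP=> i j; rewrite mxE; apply: nuQ.
  have -> : (Y *m rG h *m u) i j
      = \tr (rG (enum_val (fullrankfun fullW i) * h)%g *m A).
    rewrite repr_mxM ?enum_valP // Duv mulmxA mxtrace_mulC.
    rewrite /mxtrace big_ord1 !mulmxA; transitivity (row i (Y *m rG h *m u) 0 0).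
      by rewrite [RHS]mxE (ord1 j).
    by rewrite !row_mul; congr ((_ *m _ *m _) 0 0); rewrite row_rowsub rowK.
  by apply: trGA; rewrite groupM ?enum_valP.
apply/eqP; rewrite -subr_eq0; apply/eqP.
suffices /matrixP/(_ a b) : map_mx nu (rconj_repr rG uY g) - rconj_repr rG uY g = 0.
  by rewrite !mxE.
apply: (can_inj (mulmxK uY)); rewrite mul0mx; apply: colspan => h Gh.
(* The vectors Y (rG h) u are fixed by nu, since their entries are traces of [rG _ *m A]. The new
   matrix of g maps such vectors to such vectors, so it and its image under nu agree on a spanning
   set. *)
have RY : rconj_repr rG uY g *m (Y *m rG h *m u) = Y *m rG (g * h)%g *m u.
  by rewrite rconj_mxE repr_mxM // !mulmxA mulmxKV.
have := congr1 (map_mx nu) RY; rewrite map_mxM !YGu ?groupM // -RY => E.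
by rewrite -[_ *m Y *m _]mulmxA -mulmxA mulmxBl E subrr.
Qed.

End Realization.

Section TwoIdempotents.

Variables (K : fieldType) (n : nat) (E1 E2 Y : 'M[K]_n) (a b c : K).
Hypotheses (nz2 : 2%:R != 0 :> K) (abc : a * b * c = 1).
Hypotheses (E11 : E1 *m E1 = E1) (E22 : E2 *m E2 = E2).
Hypotheses (E12 : E1 *m E2 = 0) (E21 : E2 *m E1 = 0).
Hypotheses (tr1 : \tr E1 = 1) (tr2 : \tr E2 = 1).
Hypothesis cycle1 : E1 *m Y *m E2 *m Y *m E1 = c *: E1.
Hypothesis cycle2 : E2 *m Y *m E1 *m Y *m E2 = c *: E2.

Definition swap_idempotent : 'M[K]_n :=
  2%:R^-1 *: (E1 + E2 + a *: (E2 *m Y *m E1) + b *: (E1 *m Y *m E2)).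

(** With P = E2 Y E1 and Q = E1 Y E2 one has P Q = c E2 and Q P = c E1, while P and Q square to
    zero. So the bracket squares to (1 + a b c) (E1 + E2) + 2 a P + 2 b Q, twice itself. *)
Lemma swap_idempotentE : swap_idempotent *m swap_idempotent = swap_idempotent.
Proof.
rewrite /swap_idempotent; set P := E2 *m Y *m E1; set Q := E1 *m Y *m E2.
have E1P : E1 *m P = 0 by rewrite /P !mulmxA E12 !mul0mx.
have E2Q : E2 *m Q = 0 by rewrite /Q !mulmxA E21 !mul0mx.
have E1Q : E1 *m Q = Q by rewrite /Q !mulmxA E11.
have E2P : E2 *m P = P by rewrite /P !mulmxA E22.
have PE1 : P *m E1 = P by rewrite /P -!mulmxA E11.
have QE2 : Q *m E2 = Q by rewrite /Q -!mulmxA E22.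
have PE2 : P *m E2 = 0 by rewrite /P -!mulmxA E12 !mulmx0.
have QE1 : Q *m E1 = 0 by rewrite /Q -!mulmxA E21 !mulmx0.
have PP : P *m P = 0 by rewrite {2}/P !mulmxA PE2 !mul0mx.
have QQ : Q *m Q = 0 by rewrite {2}/Q !mulmxA QE1 !mul0mx.
have PQ : P *m Q = c *: E2 by rewrite /Q !mulmxA PE1 /P cycle2.
have QP : Q *m P = c *: E1 by rewrite /P !mulmxA QE2 /Q cycle1.
rewrite -scalemxAl -scalemxAr !mulmxDl !mulmxDr -!scalemxAl -!scalemxAr.
rewrite E11 E22 E12 E21 E1P E1Q E2P E2Q PE1 PE2 QE1 QE2 PP QQ PQ QP.
by apply/matrixP=> i j; rewrite !mxE; field: abc.
Qed.

Lemma swap_idempotent_trace : \tr swap_idempotent = 1.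
Proof.
rewrite /swap_idempotent !(mxtraceZ, mxtraceD) tr1 tr2.
rewrite [\tr (E2 *m Y *m E1)]mxtrace_mulC [\tr (E1 *m Y *m E2)]mxtrace_mulC.
rewrite !mulmxA E12 E21 !mul0mx mxtrace0; by field.
Qed.

Lemma swap_idempotent_mul_trace M :
  \tr (M *m swap_idempotent) = 2%:R^-1 * (\tr (M *m E1) + \tr (M *m E2)
     + a * \tr (M *m (E2 *m Y *m E1)) + b * \tr (M *m (E1 *m Y *m E2))).
Proof.
by rewrite -scalemxAr !mulmxDr -!scalemxAr !(mxtraceZ, mxtraceD).
Qed.

End TwoIdempotents.

(** * Projections onto linear characters of a subgroup *)

Section LinearIdempotent.

Variables (gT : finGroupType) (G H : {group gT}) (n : nat).
Variable rG : mx_representation algC G n.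
Hypothesis sHG : H \subset G.

(** For a linear character f of H this is the projection onto the subspace on which H acts through
    f. *)
Definition lin_idempotent (f : gT -> algC) : 'M[algC]_n :=
  #|H|%:R^-1 *: \sum_(h in H) f h^-1%g *: rG h.

Lemma lin_idempotent_trace f g : g \in G ->
  \tr (rG g *m lin_idempotent f)
    = #|H|%:R^-1 * \sum_(h in H) f h^-1%g * cfRepr rG (g * h)%g.
Proof.
move=> Gg; rewrite -scalemxAr mxtraceZ mulmx_sumr mxtrace_sum; congr (_ * _).
apply: eq_bigr => h Hh; have Gh := subsetP sHG h Hh.
by rewrite -scalemxAr mxtraceZ cfunE groupM // mulr1n repr_mxM.
Qed.

Variable f : gT -> algC.
Hypothesis fM : {in H &, {morph f : x y / (x * y)%g >-> x * y}}.
Hypothesis f1 : f 1%g = 1.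

Let fV h : h \in H -> f h * f h^-1%g = 1.
Proof. by move=> Hh; rewrite -fM ?groupV // mulgV. Qed.

Lemma lin_idempotentMr h : h \in H ->
  lin_idempotent f *m rG h = f h *: lin_idempotent f.
Proof.
move=> Hh; have Gh := subsetP sHG h Hh.
rewrite /lin_idempotent -scalemxAl scalerA mulrC -scalerA; congr (_ *: _).
rewrite scaler_sumr mulmx_suml [RHS](reindex_inj (mulIg h)) /=.
apply: eq_big => [x | x Hx]; first by rewrite groupMr.
rewrite -scalemxAl -repr_mxM ?(subsetP sHG) // scalerA; congr (_ *: _).
by rewrite invMg fM ?groupV // mulrA fV // mul1r.
Qed.

Lemma lin_idempotentMl h : h \in H ->
  rG h *m lin_idempotent f = f h *: lin_idempotent f.
Proof.
move=> Hh; have Gh := subsetP sHG h Hh.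
rewrite /lin_idempotent -scalemxAr scalerA mulrC -scalerA; congr (_ *: _).
rewrite scaler_sumr mulmx_sumr [RHS](reindex_inj (mulgI h)) /=.
apply: eq_big => [x | x Hx]; first by rewrite groupMl.
rewrite -scalemxAr -repr_mxM ?(subsetP sHG) // scalerA; congr (_ *: _).
by rewrite invMg fM ?groupV // mulrCA fV // mulr1.
Qed.

Lemma lin_idempotentE : lin_idempotent f *m lin_idempotent f = lin_idempotent f.
Proof.
rewrite {1}/lin_idempotent -scalemxAl mulmx_suml.
under eq_bigr => h Hh.
  rewrite -scalemxAl lin_idempotentMl // scalerA mulrC fV // scale1r; over.
by rewrite sumr_const -scaler_nat scalerA mulVf ?scale1r ?neq0CG.
Qed.

Lemma lin_idempotent_ortho (A : 'M_n) (h : gT) (c : algC) :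
    h \in H -> rG h *m A = c *: A -> f h != c -> lin_idempotent f *m A = 0.
Proof.
move=> Hh hA nfc; move: (lin_idempotent f) (lin_idempotentMr Hh) => E Eh.
apply/eqP.
have : (f h - c) *: (E *m A) = 0.
  by rewrite scalerBl scalemxAl -Eh -mulmxA hA -scalemxAr subrr.
by move/eqP; rewrite scaler_eq0 subr_eq0 (negPf nfc).
Qed.

End LinearIdempotent.

Lemma conjC_unity_root (n : nat) (w : algC) : (0 < n)%N -> w ^+ n = 1 -> w^* = w^-1.
Proof.
move=> n_gt0 wn; have /eqP : `|w| ^+ n = 1 by rewrite -normrX wn normr1.
rewrite pexpr_eq1 // => /eqP w1.
by rewrite invC_norm w1 expr1n invr1 mul1r.
Qed.

Section LinearCfun.

Variables (gT : finGroupType) (H : {group gT}).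

(* The junk value 0 is taken when f is not a class function on H. *)
Definition lin_cfun (f : gT -> algC) : 'CF(H) :=
  insubd (0 : 'CF(H)) [ffun x => if x \in H then f x else 0].

Variable f : gT -> algC.
Hypothesis fM : {in H &, {morph f : x y / (x * y)%g >-> x * y}}.
Hypothesis f1 : f 1%g = 1.

Let fJ x y : x \in H -> y \in H -> f (x ^ y)%g = f x.
Proof.
move=> Hx Hy; rewrite conjgE !fM ?groupM ?groupV // mulrCA -fM ?groupV //.
by rewrite mulVg f1 mulr1.
Qed.

Lemma lin_cfunE x : lin_cfun f x = if x \in H then f x else 0.
Proof.
rewrite -[LHS]/(val (lin_cfun f) x) val_insubd.
case: ifP => [_ | /negP[]]; first by rewrite ffunE.
rewrite genGid; apply: intro_class_fun => [a b Ha Hb | a /negPf-> //].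
by rewrite groupJr // Ha fJ.
Qed.

Lemma lin_cfun_lin_char : lin_cfun f \is a linear_char.
Proof.
have reprf : mx_repr H (fun x => (f x)%:M : 'M[algC]_1).
  by split=> [|x y Hx Hy]; rewrite ?f1 // fM // scalar_mxM.
suff -> : lin_cfun f = cfRepr (MxRepresentation reprf).
  by rewrite qualifE /= cfRepr_char cfRepr1 /= eqxx.
by apply/cfun_inP=> x Hx; rewrite lin_cfunE cfunE Hx mxtrace_scalar.
Qed.

Lemma lin_sum_eq0 h : h \in H -> f h != 1 -> \sum_(x in H) f x = 0.
Proof.
move=> Hh nfh; set s := \sum_(x in H) _.
have eqs : f h * s = s.
  rewrite mulr_sumr [RHS](reindex_inj (mulgI h)) /=.
  by apply: eq_big => [x | x Hx]; rewrite ?groupMl // fM.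
apply/eqP; move/eqP: eqs; rewrite -subr_eq0 -[X in _ - X]mul1r -mulrBl.
by rewrite mulf_eq0 subr_eq0 (negPf nfh).
Qed.

End LinearCfun.


(** Fourier inversion on H modulo A: the sum of the [chi i] at y x^-1 is k times the indicator of
    the coset A x, so orthogonality to each [chi i] kills the sum of f over that coset. *)
Lemma fourier_coset (gT : finGroupType) (H : {group gT}) (A : {set gT}) k
    (chi : nat -> gT -> algC) (f : gT -> algC) x : (0 < k)%N -> A \subset H ->
    (forall i, {in H &, {morph chi i : x y / (x * y)%g >-> x * y}}) ->
    (forall y, y \in H -> \sum_(i < k) chi i y = k%:R *+ (y \in A)) ->
    (forall i, \sum_(y in H) f y * chi i y = 0) -> x \in H ->
  \sum_(y in A) f (y * x)%g = 0.
Proof.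
move=> k_gt0 sAH chiM chi_orth f0 Hx.
have : \sum_(i < k) (\sum_(y in H) f y * chi i y) * chi i x^-1%g = 0.
  by rewrite big1 // => i _; rewrite f0 mul0r.
under eq_bigr => i _ do rewrite mulr_suml.
rewrite exchange_big /= (reindex_inj (mulIg x)) /=.
rewrite (eq_bigl (mem H)) => [|y]; last by rewrite groupMr.
rewrite (eq_bigr (fun y => f (y * x)%g * k%:R *+ (y \in A))) => [|y Hy].
  rewrite (big_setID A) /= (setIidPr sAH) [X in _ + X]big1 ?addr0 => [|y /setDP[_
    /negPf->]].
    rewrite (eq_bigr (fun y => f (y * x)%g * k%:R)) => [|y ->]; last by rewrite mulr1n.
    by rewrite -mulr_suml => /eqP; rewrite mulf_eq0 pnatr_eq0 eqn0Ngt k_gt0 orbF => /eqP.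
  by rewrite mulr0n.
rewrite -mulrnAr -chi_orth // mulr_sumr; apply: eq_bigr => i _.
by rewrite -mulrA -chiM ?groupM ?groupV // mulgK.
Qed.

(** * Criteria for realizability over the character field *)

Section Realizable.

Variables (gT : finGroupType) (G H : {group gT}).
Hypothesis sHG : H \subset G.

Definition realizable (chi : 'CF(G)) (z : algC) :=
  exists n, exists2 rG : mx_representation algC G n,
    cfRepr rG = chi & {in G, forall g a b, rG g a b \in Qadj_pred z}.

Variables (chi : 'CF(G)) (z : algC).
Hypothesis irr_chi : chi \in irr G.
Hypothesis chi_aut : forall nu : {rmorphism algC -> algC}, nu z = z -> cfAut nu chi = chi.

Lemma realizable_idempotent n (rG : mx_representation algC G n) (A : 'M_n) :
    cfRepr rG = chi -> A *m A = A -> \tr A = 1 ->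
    (forall nu : {rmorphism algC -> algC}, nu z = z ->
      {in G, forall g, nu (\tr (rG g *m A)) = \tr (rG g *m A)}) ->
  realizable chi z.
Proof.
move=> Dchi AA trA nuA; have irr_rG : cfRepr rG \in irr G by rewrite Dchi.
have [|rH] := @cfRepr_realization _ _ _ rG irr_rG z A AA trA.
  by move=> g Gg; apply: Qadj_fixed => nu nuz; apply: nuA.
by rewrite Dchi => Drh Qrh; exists n, rH.
Qed.

Section OneLinear.

Variable f : gT -> algC.
Hypothesis fM : {in H &, {morph f : x y / (x * y)%g >-> x * y}}.
Hypothesis f1 : f 1%g = 1.

(** The last hypothesis says that f has multiplicity one in the restriction of chi to H, so that the
    projection onto f has trace 1. *)
Lemma realizable_lin :
    (forall nu : {rmorphism algC -> algC}, nu z = z -> forall h, nu (f h) = f h) ->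
    #|H|%:R^-1 * \sum_(h in H) f h^-1%g * chi h = 1 ->
  realizable chi z.
Proof.
move=> f_aut tr1; have /irr_reprP[[n rG] _ /esym Dchi] := irr_chi; rewrite /= in Dchi.
apply: (realizable_idempotent Dchi (lin_idempotentE rG sHG fM f1)).
  rewrite -[lin_idempotent _ _ _]mul1mx -(repr_mx1 rG) lin_idempotent_trace //.
  by rewrite -[RHS]tr1 Dchi; congr (_ * _); apply: eq_bigr => h _; rewrite mul1g.
move=> nu nuz g Gg; rewrite lin_idempotent_trace // rmorphM fmorphV rmorph_nat.
congr (_ * _); rewrite rmorph_sum; apply: eq_bigr => h _.
rewrite rmorphM f_aut //; congr (_ * _); rewrite Dchi -[in RHS](chi_aut nuz).
by rewrite cfunE.
Qed.

End OneLinear.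

Section TwoLinear.

Variables (f1 f2 : gT -> algC) (y : gT) (a b c : algC).
Hypothesis f1M : {in H &, {morph f1 : x y / (x * y)%g >-> x * y}}.
Hypothesis f2M : {in H &, {morph f2 : x y / (x * y)%g >-> x * y}}.
Hypotheses (f1_1 : f1 1%g = 1) (f2_1 : f2 1%g = 1).
Hypotheses (f12 : exists2 h, h \in H & f1 h != f2 h) (Gy : y \in G).
Hypothesis abc : a * b * c = 1.

(** The matrices of rG need not be compatible with an automorphism. Expanding both projections
    expresses the trace by values of the character, on which automorphisms are known to act. *)
Lemma lin_idempotent_trace2 n (rG : mx_representation algC G n) e e' g : g \in G ->
  \tr (rG g *m (lin_idempotent H rG e *m rG y *m lin_idempotent H rG e'))
    = #|H|%:R^-1 * (#|H|%:R^-1 * \sum_(h in H) \sum_(k in H)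
        e h^-1%g * (e' k^-1%g * cfRepr rG (g * h * y * k)%g)).
Proof.
move=> Gg; rewrite /lin_idempotent.
set S1 := \sum_(h in H) e _ *: _; set S2 := \sum_(h in H) e' _ *: _.
rewrite -!scalemxAl -!scalemxAr !mxtraceZ; congr (_ * (_ * _)).
rewrite /S1 mulmx_suml mulmx_suml mulmx_sumr mxtrace_sum; apply: eq_bigr => h Hh.
rewrite /S2 !mulmx_sumr mxtrace_sum; apply: eq_bigr => k Hk.
have [Gh Gk] := (subsetP sHG h Hh, subsetP sHG k Hk).
rewrite cfunE !groupM // mulr1n !repr_mxM ?groupM //.
move: (rG g) (rG h) (rG y) (rG k) => Mg Mh My Mk.
by rewrite -!(scalemxAl, scalemxAr) !mxtraceZ !mulmxA mulrCA.
Qed.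

(** An automorphism fixing z fixes f1, f2, a, b or exchanges f1 with f2 and a with b. In the second
    case it permutes the four terms of the trace of [swap_idempotent], so the trace is fixed in
    both. *)
Lemma realizable_swap :
    (forall n (rG : mx_representation algC G n), cfRepr rG = chi ->
      let E1 := lin_idempotent H rG f1 in let E2 := lin_idempotent H rG f2 in
      E1 *m rG y *m E2 *m rG y *m E1 = c *: E1 /\
      E2 *m rG y *m E1 *m rG y *m E2 = c *: E2) ->
    (forall nu : {rmorphism algC -> algC}, nu z = z ->
      [/\ forall h, nu (f1 h) = f1 h, forall h, nu (f2 h) = f2 h, nu a = a & nu b = b]
      \/ [/\ forall h, nu (f1 h) = f2 h, forall h, nu (f2 h) = f1 h, nu a = b & nu b =
        a]) ->
    #|H|%:R^-1 * \sum_(h in H) f1 h^-1%g * chi h = 1 ->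
    #|H|%:R^-1 * \sum_(h in H) f2 h^-1%g * chi h = 1 ->
  realizable chi z.
Proof.
move=> cycle f_aut tr1 tr2.
have /irr_reprP[[n rG] _ /esym Dchi] := irr_chi; rewrite /= in Dchi.
have [cyc1 cyc2] := cycle n rG Dchi.
pose E1 := lin_idempotent H rG f1; pose E2 := lin_idempotent H rG f2.
have [h0 Hh0 nf] := f12.
have E12 : E1 *m E2 = 0.
  by apply: (lin_idempotent_ortho sHG f1M f1_1 Hh0 _ nf); apply: lin_idempotentMl.
have E21 : E2 *m E1 = 0.
  by apply: (lin_idempotent_ortho sHG f2M f2_1 Hh0 _);
    [apply: lin_idempotentMl | rewrite eq_sym].
have trE e : #|H|%:R^-1 * \sum_(h in H) e h^-1%g * chi h = \tr (lin_idempotent H rG e).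
  rewrite -[lin_idempotent _ _ _]mul1mx -(repr_mx1 rG) lin_idempotent_trace //.
  by rewrite Dchi; congr (_ * _); apply: eq_bigr => h _; rewrite mul1g.
rewrite trE in tr1; rewrite trE in tr2.
apply: (realizable_idempotent (A := swap_idempotent E1 E2 (rG y) a b) Dchi).
- apply: (swap_idempotentE _ abc) => //; rewrite ?pnatr_eq0 //; exact: lin_idempotentE.
- by apply: swap_idempotent_trace; rewrite ?pnatr_eq0.
move=> nu nuz g Gg; have chiE x : nu (chi x) = chi x.
  by rewrite -[in RHS](chi_aut nuz) cfunE.
have tr_aut e e' : (forall h, nu (e h) = e' h) ->
    nu (\tr (rG g *m lin_idempotent H rG e)) = \tr (rG g *m lin_idempotent H rG e').
  move=> ee'; rewrite !lin_idempotent_trace // rmorphM fmorphV rmorph_nat.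
  congr (_ * _); rewrite rmorph_sum; apply: eq_bigr => h _.
  by rewrite rmorphM ee' Dchi chiE.
have tr2_aut e e' d d' : (forall h, nu (e h) = e' h) -> (forall h, nu (d h) = d' h) ->
    nu (\tr (rG g *m (lin_idempotent H rG e *m rG y *m lin_idempotent H rG d)))
    = \tr (rG g *m (lin_idempotent H rG e' *m rG y *m lin_idempotent H rG d')).
  move=> ee' dd'; rewrite !lin_idempotent_trace2 // !rmorphM fmorphV rmorph_nat.
  congr (_ * (_ * _)); rewrite rmorph_sum; apply: eq_bigr => h _.
  rewrite rmorph_sum; apply: eq_bigr => k _.
  by rewrite !rmorphM ee' dd' Dchi chiE.
rewrite swap_idempotent_mul_trace.
rewrite rmorphM fmorphV rmorph_nat !rmorphD !rmorphM; congr (_ * _).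
case: (f_aut nu nuz) => [[nf1 nf2 -> ->] | [nf1 nf2 -> ->]].
  by rewrite (tr_aut _ _ nf1) (tr_aut _ _ nf2) (tr2_aut _ _ _ _ nf1 nf2) (tr2_aut _ _ _
    _ nf2 nf1).
rewrite (tr_aut _ _ nf1) (tr_aut _ _ nf2) (tr2_aut _ _ _ _ nf1 nf2) (tr2_aut _ _ _ _
  nf2 nf1).
by rewrite -!addrA addrCA; congr (_ + (_ + _)); rewrite addrC.
Qed.

End TwoLinear.

End Realizable.

Lemma vchar_norm2_signs (gT : finGroupType) (G : {group gT}) (phi : 'CF(G)) :
    phi \in 'Z[irr G]%g -> '[phi] = 2%:R ->
  exists b c : bool, exists i j, i != j /\ phi = (-1) ^+ b *: 'chi_i + (-1) ^+ c *: 'chi_j.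
Proof.
move=> Zphi /(zchar_small_norm Zphi)[] // [[|chi [|xi [|?]]] //= S2].
case=> /andP[/and3P[Nchi Nxi _] /= ochi] /allP/and3P[Zchi Zxi _].
rewrite big_cons big_seq1 => def_phi.
have [b [i def_chi]] := vchar_norm1P Zchi (eqP Nchi).
have [c [j def_xi]] := vchar_norm1P Zxi (eqP Nxi).
exists b, c, i, j; split; last by rewrite def_phi def_chi def_xi.
apply: contraTneq ochi; rewrite !andbT def_chi def_xi => ->.
rewrite cfdotZl cfdotZr rmorph_sign cfnorm_irr mulr1 -signr_addb.
by rewrite signr_eq0.
Qed.

Lemma irr_central_involution (gT : finGroupType) (G : {group gT}) (i : Iirr G) x :
  x \in 'Z(G)%g -> (x * x)%g = 1%g -> 'chi_i x = 'chi_i 1%g \/ 'chi_i x = - 'chi_i 1%g.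
Proof.
move=> Zx xx; have sZZ : 'Z(G)%g \subset 'Z('chi_i)%CF.
  by rewrite -cap_cfcenter_irr (bigcap_inf i).
have Zcx : x \in 'Z('chi_i)%CF := subsetP sZZ x Zx.
have [lam lin_lam /cfunP/(_ x)] := cfcenter_Res 'chi_i.
rewrite cfResE ?cfcenter_sub // cfunE => ->.
have : lam x ^+ 2 = 1 by rewrite expr2 -lin_charM // xx lin_char1.
by move/eqP; rewrite sqrf_eq1 => /orP[] /eqP ->; rewrite ?mulr1 ?mulrN1; [left | right].
Qed.

(** * The group algebra of a quotient *)

Lemma realizable_degree (gT : finGroupType) (G : {group gT}) (chi : 'CF(G)) z d :
    realizable chi z -> chi 1%g = d%:R ->
  exists2 rG : mx_representation algC G d,
    cfRepr rG = chi & {in G, forall g a b, rG g a b \in Qadj_pred z}.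
Proof.
move=> [n [rG <- rG_z]]; rewrite cfRepr1 => /eqP; rewrite eqr_nat => /eqP <-.
by exists rG.
Qed.

(* The representations [X i] identify the rational group algebra of [G] with the
   product of the matrix algebras of degree [d i] over the fields [Q(z i)]. *)
Definition wedderburn_family (gT : finGroupType) (G : {group gT}) (I : finType)
    (z : I -> algC) (d : I -> nat) : Prop :=
  exists X : forall i, mx_representation algC G (d i),
    [/\ forall i g a b, g \in G -> X i g a b \in Qadj_pred (z i),
        forall x : gT -> rat,
          (forall i, \sum_(g in G) ratr (x g) *: X i g = 0) ->
          {in G, forall g, x g = 0}
      & forall M : forall i, 'M[algC]_(d i),
          (forall i a b, M i a b \in Qadj_pred (z i)) ->
          exists x : gT -> rat,
            forall i, \sum_(g in G) ratr (x g) *: X i g = M i].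

Section QuotientWedderburn.

Variables (gT : finGroupType) (S Z : {group gT}) (I : finType).
Variables (chi : I -> 'CF(S)) (z : I -> algC) (d : I -> nat).
Hypothesis nsZS : (Z <| S)%g.
Hypothesis irr_chi : forall i, chi i \in irr S.
Hypothesis ker_chi : forall i, Z \subset cfker (chi i).
Hypothesis real_chi : forall i, realizable (chi i) (z i).
Hypothesis deg_chi : forall i, chi i 1%g = (d i)%:R.
Hypothesis aut_z : forall i (nu mu : {rmorphism algC -> algC}),
  cfAut nu (chi i) = cfAut mu (chi i) -> nu (z i) = mu (z i).
Hypothesis irr_aut : forall psi, psi \in irr S -> Z \subset cfker psi ->
  exists i, exists nu : {rmorphism algC -> algC}, psi = cfAut nu (chi i).
Hypothesis aut_inj : forall i j (nu mu : {rmorphism algC -> algC}),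
  cfAut nu (chi i) = cfAut mu (chi j) -> i = j.

Lemma rational_wedderburn_quotient : wedderburn_family (S / Z)%G z d.
Proof.
have nZS : S \subset 'N(Z)%g by case/andP: nsZS.
have /fin_all_exists[X XP] (i : I) : exists rG : mx_representation algC (S / Z) (d i),
    cfRepr rG = (chi i / Z)%CF /\ {in (S / Z)%g, forall g a b, rG g a b \in Qadj_pred
      (z i)}.
  have [rG Dchi rG_z] := realizable_degree (real_chi i) (deg_chi i).
  have kerZ : Z \subset rker rG by rewrite -cfker_repr Dchi.
  exists (quo_repr kerZ nZS); split.
    apply/cfun_inP=> _ /morphimP[x Nx Sx ->].
    by rewrite cfQuoE // -Dchi !cfunE Sx mem_morphim // (quo_repr_coset kerZ nZS Sx).
  by move=> _ /morphimP[x Nx Sx ->] a b; rewrite (quo_repr_coset kerZ nZS Sx) rG_z.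
have DX i : cfRepr (X i) = (chi i / Z)%CF by case: (XP i).
have autX i (nu : {rmorphism algC -> algC}) :
    (cfAut nu (cfRepr (X i)) %% Z)%CF = cfAut nu (chi i).
  by rewrite DX cfAutQuo cfQuoK // cfker_aut.
have aut_eq i j (nu mu : {rmorphism algC -> algC}) :
    cfAut nu (cfRepr (X i)) = cfAut mu (cfRepr (X j)) -> cfAut nu (chi i) = cfAut mu
      (chi j).
  by rewrite -!autX => ->.
have irrX i : cfRepr (X i) \in irr (S / Z) by rewrite DX cfQuo_irr.
have irrX_aut (k : Iirr (S / Z)) :
    exists i, exists nu : {rmorphism algC -> algC}, 'chi_k = cfAut nu (cfRepr (X i)).
  have irr_k : ('chi_k %% Z)%CF \in irr S by rewrite cfMod_irr ?mem_irr.
  have [i [nu E]] := irr_aut irr_k (cfker_mod _ nsZS); exists i, nu.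
  by rewrite -['chi_k](cfModK nsZS) E -autX cfModK.
have X_z i g a b : g \in (S / Z)%g -> X i g a b \in Qadj_pred (z i).
  by case: (XP i) => _ Xz Gg; apply: Xz.
exists X; split=> //.
  by apply: (rational_wedderburn_inj irrX_aut).
apply: (rational_wedderburn_surj irrX X_z _ irrX_aut).
  by move=> i nu mu /aut_eq/aut_z.
by move=> i j nu mu /aut_eq/aut_inj.
Qed.

End QuotientWedderburn.

(** * From a Wedderburn family to an isomorphism of algebras *)

Section GroupAlgebraIso.

Variables (gT : finGroupType) (G : {group gT}) (I : finType).
Variables (z : I -> algC) (d : I -> nat).
Hypothesis wG : wedderburn_family G z d.

Local Notation QG := (group_alg rat [subg G]).

Let sum_subg (V : nmodType) (F : gT -> V) :
  \sum_(g in G) F g = \sum_(s : [subg G]) F (sgval s).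
Proof.
rewrite (reindex (@sgval gT G)) /=.
  by apply: eq_bigl => s; rewrite subgP.
exists (subg G) => [s _ | g Gg]; first exact: sgvalK.
exact: subgK.
Qed.

Definition group_alg_mx (X : forall i, mx_representation algC G (d i)) i (a : QG) :
  'M[algC]_(d i) := \sum_s ratr (a s) *: X i (sgval s).

Section Image.

Variable X : forall i, mx_representation algC G (d i).
Hypothesis X_z : forall i g a b, g \in G -> X i g a b \in Qadj_pred (z i).
Hypothesis X_inj : forall x : gT -> rat,
  (forall i, \sum_(g in G) ratr (x g) *: X i g = 0) -> {in G, forall g, x g = 0}.

Lemma group_alg_mxD i a b : group_alg_mx X i (a + b) = group_alg_mx X i a +
  group_alg_mx X i b.
Proof.
by rewrite -big_split; apply: eq_bigr => s _; rewrite ffunE rmorphD scalerDl.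
Qed.

Lemma group_alg_mxZ i c a : group_alg_mx X i (c *: a) = ratr c *: group_alg_mx X i a.
Proof.
by rewrite scaler_sumr; apply: eq_bigr => s _; rewrite ffunE rmorphM scalerA.
Qed.

Lemma group_alg_mx1 i : group_alg_mx X i 1 = 1%:M.
Proof.
rewrite /group_alg_mx (bigD1 1%g) //= ffunE eqxx rmorph1 scale1r (repr_mx1 (X i)).
by rewrite big1 ?addr0 // => s /negPf ns1; rewrite ffunE ns1 rmorph0 scale0r.
Qed.

Lemma group_alg_mxM i a b : group_alg_mx X i (a * b) = group_alg_mx X i a *m
  group_alg_mx X i b.
Proof.
rewrite /group_alg_mx mulmx_suml.
transitivity (\sum_s \sum_t (ratr (a t) * ratr (b (t^-1 * s)%g)) *: X i (sgval s)).
  apply: eq_bigr => s _; rewrite ffunE rmorph_sum -scaler_suml /=; congr (_ *: _).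
  by apply: eq_bigr => t _; rewrite rmorphM.
rewrite exchange_big; apply: eq_bigr => t _ /=; rewrite (reindex_inj (mulgI t)) /=.
rewrite mulmx_sumr; apply: eq_bigr => s _.
by rewrite mulKg repr_mxM ?subgP // -scalemxAl -scalemxAr scalerA.
Qed.

Lemma group_alg_mx_Qadj i a k l : group_alg_mx X i a k l \in Qadj_pred (z i).
Proof.
rewrite summxE rpred_sum // => s _; rewrite mxE rpredM ?Qadj_ratr //.
by rewrite X_z ?subgP.
Qed.

Lemma group_alg_mx_inj a b : (forall i, group_alg_mx X i a = group_alg_mx X i b) -> a = b.
Proof.
move=> eqW; apply/eqP; rewrite -subr_eq0; apply/eqP/ffunP=> s; rewrite [RHS]ffunE.
have := @X_inj (fun g => (a - b) (subg G g)) _ (sgval s) (subgP s); rewrite sgvalK; apply.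
move=> i; rewrite sum_subg (_ : \sum_s _ = group_alg_mx X i (a - b)); last first.
  by apply: eq_bigr => t _; rewrite sgvalK.
by rewrite -[a - b]/(a + - b) -scaleN1r group_alg_mxD group_alg_mxZ rmorphN1 scaleN1r
  eqW subrr.
Qed.

End Image.

Variables (B : Type) (add mul : B -> B -> B) (one : B) (scale : rat -> B -> B).
Variable J : forall i, B -> 'M[algC]_(d i).
Hypothesis J_z : forall i b k l, J i b k l \in Qadj_pred (z i).
Hypothesis J_inj : forall b c, (forall i, J i b = J i c) -> b = c.
Hypothesis J_surj : forall M : forall i, 'M[algC]_(d i),
  (forall i k l, M i k l \in Qadj_pred (z i)) -> exists b, forall i, J i b = M i.
Hypothesis J_add : forall i b c, J i (add b c) = J i b + J i c.
Hypothesis J_mul : forall i b c, J i (mul b c) = J i b *m J i c.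
Hypothesis J_one : forall i, J i one = 1%:M.
Hypothesis J_scale : forall i r b, J i (scale r b) = ratr r *: J i b.

(** The map f is determined by [J i (f a) = group_alg_mx X i a]: surjectivity of the J gives a
    value, joint injectivity makes f compatible with the operations. The target carries bare
    operations, so direct sums that may be empty need no separate treatment. *)
Lemma group_alg_iso : exists f : QG -> B,
  [/\ bijective f, forall a b, f (a + b) = add (f a) (f b),
      forall a b, f (a * b) = mul (f a) (f b), f 1 = one
    & forall r a, f (r *: a) = scale r (f a)].
Proof.
case: wG => X [X_z X_inj X_surj].
have /boolp.choice[f Jf] a : exists b, forall i, J i b = group_alg_mx X i a.
  by apply: J_surj => i k l; apply: group_alg_mx_Qadj.
have /boolp.choice[g Wg] b : exists a, forall i, group_alg_mx X i a = J i b.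
  have [x Dx] := X_surj _ (fun i => @J_z i b).
  exists [ffun s => x (sgval s)] => i; rewrite -Dx sum_subg.
  by apply: eq_bigr => s _; rewrite ffunE.
exists f; split.
- exists g => [a | b]; first by apply: (group_alg_mx_inj X_inj) => i; rewrite Wg Jf.
  by apply: J_inj => i; rewrite Jf Wg.
- by move=> a b; apply: J_inj => i; rewrite J_add !Jf group_alg_mxD.
- by move=> a b; apply: J_inj => i; rewrite J_mul !Jf group_alg_mxM.
- by apply: J_inj => i; rewrite J_one Jf group_alg_mx1.
by move=> r a; apply: J_inj => i; rewrite J_scale !Jf group_alg_mxZ.
Qed.

End GroupAlgebraIso.

(** * Characters of a group with the subgroup structure of SL_2 *)

Lemma sum_mulrb_sub (V : nmodType) (T : finType) (H A : {set T}) (c : V) :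
  A \subset H -> \sum_(x in H) c *+ (x \in A) = c *+ #|A|.
Proof.
move=> sAH; rewrite (big_setID A) /= (setIidPr sAH).
rewrite (eq_bigr (fun=> c)) => [|x ->]; last by rewrite mulr1n.
rewrite sumr_const big1 ?addr0 // => x /setDP[_ /negPf->].
by rewrite mulr0n.
Qed.

(** Here h is the degree of the half characters, compared with the degrees q - 1, q, q + 1 of the
    other families. The degree 1 is left out because h = 1 when q = 3. *)
Lemma half_deg_neq n (h := if odd n then n else n.+1) : (0 < n)%N ->
  [&& h != 2 * n, h != (2 * n).+1 & h != (2 * n).+2]%N.
Proof. by rewrite /h; case: ifP; case: n {h} => [|[|n]] // _ _; lia. Qed.

(* [S], [B], [T], [C] stand for SL_2(q), its Borel subgroup, its split and nonsplit
   tori, [z] for -1, [B1] for the elements of [B] with diagonal +-1, and [wl], [v]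
   for elements inverting [T] and [C]. For w^n = 1, resp. w^m = 1, [lamf w], resp.
   [thf w], is the linear character of [B], resp. [C], trivial on -1 with
   parameter w; the linear characters are indexed by roots of unity so that the
   Galois group acts on the indices. *)
Section AbstractSL2.

Variables (gT : finGroupType) (S B C : {group gT}) (z : gT) (n : nat).
Variables (lamf thf : algC -> gT -> algC) (B1 : {set gT}).

Implicit Types (w : algC) (x y : gT).
Local Notation m := n.+1.
Local Notation Z := [set 1%g; z].
Local Notation q := ((2 * n).+1%:R : algC).

Hypothesis n_gt0 : (0 < n)%N.
Hypotheses (sBS : B \subset S) (sCS : C \subset S).
Hypotheses (cenS : 'Z(S)%g = Z) (z_neq1 : z != 1%g) (zz : (z * z)%g = 1%g).
Hypotheses (sZB1 : Z \subset B1) (sB1B : B1 \subset B) (sZC : Z \subset C).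
Variable T : {group gT}.
Hypotheses (sTB : T \subset B) (card_T : #|T| = (2 * n)%N).
Hypothesis card_B : #|B| = (2 * n * (2 * n).+1)%N.
Hypothesis card_C : #|C| = (2 * m)%N.
Hypothesis card_S : #|S| = ((2 * n).+1 * (2 * n * (2 * m)))%N.

Hypothesis lamfM : forall w, w ^+ n = 1 ->
  {in B &, {morph lamf w : x y / (x * y)%g >-> x * y}}.
Hypothesis lamf1 : forall w, w ^+ n = 1 -> lamf w 1%g = 1.
Hypothesis lamf_mul : forall w w' x, lamf (w * w') x = lamf w x * lamf w' x.
Hypothesis lamf_aut : forall (mu : {rmorphism algC -> algC}) w x,
  mu (lamf w x) = lamf (mu w) x.
Hypothesis lamf_one : forall x, lamf 1 x = 1.
Hypothesis lamf_B1 : forall w x, w ^+ n = 1 -> x \in B1 -> lamf w x = 1.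
Hypothesis lamf_gen : exists2 t, t \in T & forall w, w ^+ n = 1 -> lamf w t = w.
Hypothesis lamf_orth : forall w x, n.-primitive_root w -> x \in B ->
  \sum_(i < n) lamf (w ^+ i) x = n%:R *+ (x \in B1).

Hypothesis thfM : forall w, w ^+ m = 1 ->
  {in C &, {morph thf w : x y / (x * y)%g >-> x * y}}.
Hypothesis thf1 : forall w, w ^+ m = 1 -> thf w 1%g = 1.
Hypothesis thf_mul : forall w w' x, thf (w * w') x = thf w x * thf w' x.
Hypothesis thf_aut : forall (mu : {rmorphism algC -> algC}) w x,
  mu (thf w x) = thf (mu w) x.
Hypothesis thf_one : forall x, thf 1 x = 1.
Hypothesis thf_Z : forall w x, w ^+ m = 1 -> x \in Z -> thf w x = 1.
Hypothesis thf_gen : exists2 t, t \in C & forall w, w ^+ m = 1 -> thf w t = w.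
Hypothesis thf_orth : forall w x, m.-primitive_root w -> x \in C ->
  \sum_(i < m) thf (w ^+ i) x = m%:R *+ (x \in Z).

Local Notation R w := ('Ind[S] (lin_cfun B (lamf w))).
Local Notation P w := ('Ind[S] (lin_cfun C (thf w))).

Variables (wl v : gT).
Hypotheses (wl_in : wl \in S) (wl_notin : wl \notin B) (wlwl : (wl * wl)%g = z).
Hypothesis T_wl : forall t, t \in T -> (t ^ wl)%g = t^-1%g.
Hypothesis B_conj_T : forall x, x \in B -> x \notin B1 ->
  exists2 u, u \in B & (x ^ u)%g \in T.
Hypothesis T_conj_B : forall t y, t \in T -> t \notin B1 -> y \in S -> y \notin B ->
  (t ^ y)%g \in B -> y \in (wl *: B)%g.
Hypothesis B1_conj_B : forall x y, x \in B1 -> x \notin Z -> y \in S ->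
  (x ^ y)%g \in B -> y \in B.
Hypothesis wlBwl : forall b, b \in B -> (wl * b * wl)%g \in B -> b \in T.
Hypothesis bruhat_dec : forall x, x \in S -> x \notin B ->
  exists2 b, b \in B & exists2 b', b' \in B & x = (b * wl * b')%g.
Hypothesis abelC : abelian C.
Hypotheses (v_in : v \in S) (vv : (v * v)%g = z).
Hypothesis C_v : forall c, c \in C -> (c ^ v)%g = c^-1%g.
Hypothesis C_conj : forall c y, c \in C -> c \notin Z -> y \in S ->
  (c ^ y)%g \in C -> (c ^ y)%g = c \/ (c ^ y)%g = c^-1%g.
Hypothesis C_cent : forall c y, c \in C -> c \notin Z -> y \in S ->
  (c ^ y)%g = c -> y \in C.
Hypothesis C_invol : forall c, c \in C -> c^-1%g = c -> c \in Z.
Hypothesis C_conj_B : forall c y, c \in C -> y \in S -> (c ^ y)%g \in B -> c \in Z.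

Let expr1m : 1 ^+ m = 1 :> algC. Proof. exact: expr1n. Qed.
Let expr1n' : 1 ^+ n = 1 :> algC. Proof. exact: expr1n. Qed.

Let sZB : Z \subset B. Proof. exact: subset_trans sZB1 sB1B. Qed.

Let card_Z : #|Z| = 2%N. Proof. by rewrite cards2 eq_sym z_neq1. Qed.

Let lamf_conj w x : w ^+ n = 1 -> (lamf w x)^* = lamf w^-1 x.
Proof. by move=> wn; rewrite -(conjC_unity_root n_gt0 wn); apply: lamf_aut. Qed.

Let thf_conj w x : w ^+ m = 1 -> (thf w x)^* = thf w^-1 x.
Proof. by move=> wm; rewrite -(conjC_unity_root (ltn0Sn n) wm); apply: thf_aut. Qed.

Let lamf_sum w : w ^+ n = 1 -> \sum_(x in B) lamf w x = (#|B|%:R : algC) *+ (w == 1).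
Proof.
move=> wn; have [-> | nw1] := eqVneq w 1.
  by rewrite (eq_bigr (fun=> 1)) ?sumr_const // => x _; apply: lamf_one.
have [t Tt tE] := lamf_gen.
by apply: (lin_sum_eq0 (lamfM wn) (subsetP sTB t Tt)); rewrite tE.
Qed.

Let thf_sum w : w ^+ m = 1 -> \sum_(x in C) thf w x = (#|C|%:R : algC) *+ (w == 1).
Proof.
move=> wm; have [-> | nw1] := eqVneq w 1.
  by rewrite (eq_bigr (fun=> 1)) ?sumr_const // => x _; apply: thf_one.
have [t Ct tE] := thf_gen.
by apply: (lin_sum_eq0 (thfM wm) Ct); rewrite tE.
Qed.

(** Double counting of [lamf_orth] over B: among the n characters only the trivial one has a nonzero
    sum. *)
Lemma card_B1 : #|B1| = (2 * (2 * n).+1)%N.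
Proof.
have [w prim_w] := C_prim_root_exists n_gt0.
apply/eqP; rewrite -(eqn_pmul2l n_gt0) -(eqr_nat algC) natrM.
have -> : (n%:R * #|B1|%:R : algC) = \sum_(x in B) \sum_(i < n) lamf (w ^+ i) x.
  by rewrite (eq_bigr _ (fun x Bx => lamf_orth prim_w Bx)) sum_mulrb_sub // mulr_natr.
rewrite exchange_big (bigD1 (Ordinal n_gt0)) //= [X in _ + X]big1 => [|i ni0].
  by rewrite addr0 expr0 lamf_sum // eqxx card_B mulr1n; apply/eqP; congr _%:R; ring.
rewrite lamf_sum; first by rewrite -(prim_order_dvd prim_w) gtnNdvd // lt0n.
by rewrite exprAC (prim_expr_order prim_w) expr1n.
Qed.

Lemma lam_dot (f : 'CF(S)) w : w ^+ n = 1 ->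
  '[f, R w] = #|B|%:R^-1 * \sum_(x in B) f x * lamf w^-1 x.
Proof.
move=> wn; rewrite -cfdot_Res_l cfdotE; congr (_ * _); apply: eq_bigr => x Bx.
by rewrite cfResE // lin_cfunE ?Bx ?lamf_conj //; [apply: lamfM | apply: lamf1].
Qed.

Lemma theta_dot (f : 'CF(S)) w : w ^+ m = 1 ->
  '[f, P w] = #|C|%:R^-1 * \sum_(x in C) f x * thf w^-1 x.
Proof.
move=> wm; rewrite -cfdot_Res_l cfdotE; congr (_ * _); apply: eq_bigr => x Cx.
by rewrite cfResE // lin_cfunE ?Cx ?thf_conj //; [apply: thfM | apply: thf1].
Qed.

Let lamE w x : w ^+ n = 1 ->
  lin_cfun B (lamf w) x = if x \in B then lamf w x else 0.
Proof. by move=> wn; apply: lin_cfunE; [apply: lamfM | apply: lamf1]. Qed.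

Let thetaE w x : w ^+ m = 1 ->
  lin_cfun C (thf w) x = if x \in C then thf w x else 0.
Proof. by move=> wm; apply: lin_cfunE; [apply: thfM | apply: thf1]. Qed.

Let rootV k w : w ^+ k = 1 -> w^-1 ^+ k = 1.
Proof. by move=> wk; rewrite exprVn wk invr1. Qed.

Let lamfV w x : w ^+ n = 1 -> x \in B -> lamf w x^-1%g = lamf w^-1 x.
Proof.
move=> wn Bx; have := lamfM wn Bx (groupVr Bx); rewrite mulgV lamf1 //.
move/esym/mulr1_eq <-; apply: mulr1_eq; rewrite -lamf_mul divff ?lamf_one //.
by apply: contra_eq_neq wn => ->; rewrite expr0n eqn0Ngt n_gt0 eq_sym oner_neq0.
Qed.

Let thfV w x : w ^+ m = 1 -> x \in C -> thf w x^-1%g = thf w^-1 x.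
Proof.
move=> wm Cx; have := thfM wm Cx (groupVr Cx); rewrite mulgV thf1 //.
move/esym/mulr1_eq <-; apply: mulr1_eq; rewrite -thf_mul divff ?thf_one //.
by apply: contra_eq_neq wm => ->; rewrite expr0n eq_sym oner_neq0.
Qed.

Let lamfJ w x y : w ^+ n = 1 -> x \in B -> y \in B -> lamf w (x ^ y)%g = lamf w x.
Proof.
move=> wn Bx By; rewrite conjgE !lamfM ?groupM ?groupV // mulrCA.
by rewrite -lamfM ?groupV // mulVg lamf1 ?mulr1.
Qed.

Let Z_conj x y : x \in Z -> y \in S -> (x ^ y)%g = x.
Proof. by rewrite -cenS => /centerP[_ cx] Sy; apply/conjg_fixP/commgP/cx. Qed.

Let lamf_Z w x : w ^+ n = 1 -> x \in Z -> lamf w x = 1.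
Proof. by move=> wn Zx; rewrite lamf_B1 ?(subsetP sZB1). Qed.

(** * Values of the induced characters on [B] and [C] *)

Lemma R_Z w x : w ^+ n = 1 -> x \in Z -> R w x = q + 1.
Proof.
move=> wn Zx; rewrite cfIndE //.
rewrite (eq_bigr (fun=> 1)) => [|y Sy]; last first.
  by rewrite Z_conj // lamE // (subsetP sZB) // lamf_Z.
rewrite sumr_const card_S card_B; apply: canLR (mulKf _) _.
  by rewrite pnatr_eq0 muln_eq0 negb_or muln_eq0 /= -lt0n n_gt0.
by rewrite !(natrM, =^~ natr1); ring.
Qed.

Let sum_lam_borel w x : w ^+ n = 1 -> x \in B ->
  \sum_(y in B) lin_cfun B (lamf w) (x ^ y)%g = #|B|%:R * lamf w x.
Proof.
move=> wn Bx; rewrite mulr_natl -sumr_const; apply: eq_bigr => y By.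
by rewrite lamE // groupJ // lamfJ.
Qed.

Lemma R_B1 w x : w ^+ n = 1 -> x \in B1 -> x \notin Z -> R w x = 1.
Proof.
move=> wn B1x nZx; have Bx := subsetP sB1B x B1x; rewrite cfIndE //.
rewrite (big_setID B) /= (setIidPr sBS) sum_lam_borel // lamf_B1 // mulr1.
rewrite big1 ?addr0 ?mulVf ?neq0CG // => y /setDP[Sy nBy].
by rewrite lamE // ifN //; apply: contra nBy; apply: B1_conj_B.
Qed.

(** Membership in [B1] is detected by the sum of the [lamf], which are class functions on B. *)
Let B1J x y : x \in B -> y \in B -> ((x ^ y)%g \in B1) = (x \in B1).
Proof.
move=> Bx By; have [w prim_w] := C_prim_root_exists n_gt0.
have := lamf_orth prim_w Bx; rewrite (eq_bigr (fun i : 'I_n => lamf (w ^+ i) (x ^ y)%g)).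
  rewrite lamf_orth ?groupJ // => /eqP; do 2!case: (_ \in B1) => //.
    by rewrite mulr1n mulr0n pnatr_eq0 eqn0Ngt n_gt0.
  by rewrite mulr1n mulr0n eq_sym pnatr_eq0 eqn0Ngt n_gt0.
by move=> i _; rewrite lamfJ // exprAC (prim_expr_order prim_w) expr1n.
Qed.

(** After conjugating x into T, the elements of S that carry it into B form exactly the two cosets B
    and wl B; wl inverts T, which yields the parameter w^-1. *)
Lemma R_split w x : w ^+ n = 1 -> x \in B -> x \notin B1 ->
  R w x = lamf w x + lamf w^-1 x.
Proof.
move=> wn Bx nB1x; have [u Bu Tt] := B_conj_T Bx nB1x.
have Su := subsetP sBS u Bu; set t := (x ^ u)%g in Tt.
have Bt : t \in B := subsetP sTB t Tt.
have nB1t : t \notin B1 by rewrite B1J.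
rewrite -(cfunJ _ x Su) -/t cfIndE //.
have lt w' : w' ^+ n = 1 -> lamf w' t = lamf w' x by move=> ?; apply: lamfJ.
rewrite (big_setID B) /= (setIidPr sBS) sum_lam_borel // lt //.
have sWS : (wl *: B)%g \subset S :\: B.
  apply/subsetP=> y /lcosetP[b Bb ->]; rewrite inE groupMr //.
  by rewrite groupM // ?(subsetP sBS) // wl_notin.
rewrite [X in _ + X](big_setID (wl *: B)%g) /= (setIidPr sWS).
rewrite [X in _ + (_ + X)]big1 ?addr0; last first.
  move=> y /setDP[/setDP[Sy nBy] nWy]; rewrite lamE // ifN //.
  by apply: contra nWy; apply: T_conj_B.
rewrite [X in _ + X](eq_bigr (fun=> lamf w^-1 x)) => [|y /lcosetP[b Bb ->]].
  by rewrite sumr_const card_lcoset -[lamf w^-1 x *+ _]mulr_natl -mulrDr mulKf ?neq0CG.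
rewrite conjgM T_wl // lamE // groupJ ?groupV //.
by rewrite lamfJ ?groupV // lamfV // lt ?rootV.
Qed.

(** The three cases in one formula, whose terms are linear characters and indicators and can be
    summed separately over B. *)
Lemma R_B w x : w ^+ n = 1 -> x \in B ->
  R w x = lamf w x + lamf w^-1 x + q *+ (x \in Z) - 1 *+ (x \in B1).
Proof.
move=> wn Bx; have [B1x | nB1x] := boolP (x \in B1); last first.
  have -> : x \in Z = false by apply: contraNF nB1x; apply/subsetP.
  by rewrite R_split // !mulr0n addr0 subr0.
rewrite !lamf_B1 ?rootV //; have [Zx | nZx] := boolP (x \in Z).
  by rewrite R_Z // !mulr1n; ring.
by rewrite R_B1 // mulr0n mulr1n; ring.
Qed.

Lemma P_Z w x : w ^+ m = 1 -> x \in Z -> P w x = q * (q - 1).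
Proof.
move=> wm Zx; rewrite cfIndE //.
rewrite (eq_bigr (fun=> 1)) => [|y Sy]; last first.
  by rewrite Z_conj // thetaE // (subsetP sZC) // thf_Z.
rewrite sumr_const card_S card_C; apply: canLR (mulKf _) _.
  by rewrite pnatr_eq0.
by rewrite !(natrM, =^~ natr1); ring.
Qed.

Lemma P_B w x : w ^+ m = 1 -> x \in B -> P w x = (q * (q - 1)) *+ (x \in Z).
Proof.
move=> wm Bx; have [Zx | nZx] := boolP (x \in Z); first by rewrite P_Z.
rewrite mulr0n cfIndE // big1 ?mulr0 // => y Sy.
rewrite thetaE // ifN //; apply: contra nZx => Cxy.
have Zxy : (x ^ y)%g \in Z by apply: (C_conj_B Cxy (groupVr Sy)); rewrite conjgK.
by rewrite -[x](conjgK y) Z_conj ?groupV.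
Qed.

(** Off the center only C and the coset C v carry x into C, the first fixing and the second
    inverting it. The indicator term corrects the value on Z. *)
Lemma P_C w x : w ^+ m = 1 -> x \in C ->
  P w x = thf w x + thf w^-1 x + (q * (q - 1) - 2%:R) *+ (x \in Z).
Proof.
move=> wm Cx; have [Zx | nZx] := boolP (x \in Z).
  by rewrite P_Z // !thf_Z ?rootV // mulr1n; ring.
rewrite mulr0n addr0 cfIndE //.
have fixC y : y \in C -> (x ^ y)%g = x.
  by move=> Cy; apply/conjg_fixP/commgP; apply: (centsP abelC).
have Wv y : y \in (C :* v)%g -> (x ^ y)%g = x^-1%g.
  by case/rcosetP=> c Cc ->; rewrite conjgM fixC // C_v.
have sWS : (C :* v)%g \subset S :\: C.
  apply/subsetP=> y Wy; rewrite inE; apply/andP; split.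
    apply: contra nZx => Cy; apply: C_invol => //.
    by rewrite -(Wv y Wy) fixC.
  by case/rcosetP: Wy => c Cc ->; rewrite groupM // (subsetP sCS).
rewrite (big_setID C) /= (setIidPr sCS) (eq_bigr (fun=> thf w x)); last first.
  by move=> y Cy; rewrite fixC // thetaE // Cx.
rewrite sumr_const [X in _ + X](big_setID (C :* v)%g) /= (setIidPr sWS).
rewrite [X in _ + (_ + X)]big1 ?addr0; last first.
  move=> y /setDP[/setDP[Sy nCy] nWy]; rewrite thetaE // ifN //.
  apply/negP=> Cxy; case/negP: nWy; have [E | E] := C_conj Cx nZx Sy Cxy.
    by case/negP: nCy; apply: C_cent E.
  have Cyv : (y * v)%g \in C.
    by apply: (C_cent Cx nZx (groupM Sy v_in)); rewrite conjgM E C_v ?groupV // invgK.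
  have vzv : (v * z * v)%g = 1%g by rewrite -zz -{2 3}vv -vv !mulgA.
  (* Since v^2 = z has order 2, z v is the inverse of v. *)
  have -> : y = (y * v * z * v)%g by rewrite -!mulgA [X in (_ * X)%g]mulgA vzv mulg1.
  by rewrite mem_rcoset mulgK groupM // (subsetP sZC) // set22.
rewrite (eq_bigr (fun=> thf w^-1 x)); last first.
  by move=> y Wy; rewrite Wv // thetaE // groupV Cx thfV.
by rewrite sumr_const card_rcoset -[thf w x *+ _]mulr_natl -[thf w^-1 x *+ _]mulr_natl
  -mulrDr mulKf // neq0CG.
Qed.

Let eq_mulV w w' : w ^+ n = 1 \/ w ^+ m = 1 -> (w' * w^-1 == 1) = (w' == w).
Proof.
move=> wk; have nzw : w != 0.
  by case: wk => wk; apply: contra_eq_neq wk => ->;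
    rewrite expr0n ?eqn0Ngt ?n_gt0 eq_sym oner_neq0.
by apply/eqP/eqP=> [/divr1_eq | ->]; rewrite ?divff.
Qed.

Let lamf_sum_dot w w' : w ^+ n = 1 -> w' ^+ n = 1 ->
  \sum_(x in B) lamf w x * lamf w'^-1 x = (#|B|%:R : algC) *+ (w == w').
Proof.
move=> wn w'n; under eq_bigr do rewrite -lamf_mul.
by rewrite lamf_sum ?eq_mulV //; [left | rewrite exprMn wn rootV ?mulr1].
Qed.

Let thf_sum_dot w w' : w ^+ m = 1 -> w' ^+ m = 1 ->
  \sum_(x in C) thf w x * thf w'^-1 x = (#|C|%:R : algC) *+ (w == w').
Proof.
move=> wm w'm; under eq_bigr do rewrite -thf_mul.
by rewrite thf_sum ?eq_mulV //; [right | rewrite exprMn wm rootV ?mulr1].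
Qed.

Let sum_on_Z (A : {set gT}) c (f : gT -> algC) : Z \subset A ->
    (forall x, x \in Z -> f x = 1) ->
  \sum_(x in A) c *+ (x \in Z) * f x = c *+ 2.
Proof.
move=> sZA f1; rewrite -card_Z -(sum_mulrb_sub c sZA); apply: eq_bigr => x _.
by have [/f1-> | _] := boolP (x \in Z); rewrite ?mulr1 // mulr0n mul0r.
Qed.

Let sum_on_B1 c (f : gT -> algC) : (forall x, x \in B1 -> f x = 1) ->
  \sum_(x in B) c *+ (x \in B1) * f x = c *+ (2 * (2 * n).+1).
Proof.
move=> f1; rewrite -card_B1 -(sum_mulrb_sub c sB1B); apply: eq_bigr => x _.
by have [/f1-> | _] := boolP (x \in B1); rewrite ?mulr1 // mulr0n mul0r.
Qed.

(** * Inner products and irreducibility *)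

Lemma R_dot_R w w' : w ^+ n = 1 -> w' ^+ n = 1 ->
  '[R w, R w'] = (w == w')%:R + (w^-1 == w')%:R.
Proof.
move=> wn w'n; rewrite lam_dot //; apply: canLR (mulKf (neq0CG B)) _.
rewrite (eq_bigr (fun x => lamf w x * lamf w'^-1 x + lamf w^-1 x * lamf w'^-1 x
   + q *+ (x \in Z) * lamf w'^-1 x - 1 *+ (x \in B1) * lamf w'^-1 x)); last first.
  by move=> x Bx; rewrite R_B // !mulrDl mulNr.
have fZ x : x \in Z -> lamf w'^-1 x = 1 by move=> Zx; rewrite lamf_Z ?rootV.
have fB1 x : x \in B1 -> lamf w'^-1 x = 1 by move=> B1x; rewrite lamf_B1 ?rootV.
rewrite sumrB !big_split /= !lamf_sum_dot ?rootV //.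
rewrite (sum_on_Z _ sZB fZ) (sum_on_B1 _ fB1).
(* The central term, q on two elements, cancels against the term 1 on the 2 q elements of [B1]. *)
have -> : q *+ 2 = 1 *+ (2 * (2 * n).+1) by rewrite -mulrnA mulnC.
by rewrite addrK mulrDr !mulr_natr.
Qed.

Lemma P_dot_R w w' : w ^+ m = 1 -> w' ^+ n = 1 -> '[P w, R w'] = 2%:R.
Proof.
move=> wm w'n; rewrite lam_dot //; apply: canLR (mulKf (neq0CG B)) _.
rewrite (eq_bigr (fun x => (q * (q - 1)) *+ (x \in Z) * lamf w'^-1 x)) => [|x Bx].
  rewrite sum_on_Z // => [|x Zx]; last by rewrite lamf_Z ?rootV.
  by rewrite card_B !(natrM, =^~ natr1); ring.
by rewrite P_B.
Qed.

Lemma P_dot_P w w' : w ^+ m = 1 -> w' ^+ m = 1 ->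
  '[P w, P w'] = (w == w')%:R + (w^-1 == w')%:R + 2%:R * (q - 2%:R).
Proof.
move=> wm w'm; rewrite theta_dot //; apply: canLR (mulKf (neq0CG C)) _.
rewrite (eq_bigr (fun x => thf w x * thf w'^-1 x + thf w^-1 x * thf w'^-1 x
   + (q * (q - 1) - 2%:R) *+ (x \in Z) * thf w'^-1 x)); last first.
  by move=> x Bx; rewrite P_C // !mulrDl.
rewrite !big_split /= !thf_sum_dot ?rootV // sum_on_Z //; last first.
  by move=> x Zx; rewrite thf_Z ?rootV.
rewrite !mulrDr !mulr_natr; congr (_ + _).
by rewrite card_C !(natrM, =^~ natr1); ring.
Qed.

Let cfun1_dot_R w : w ^+ n = 1 -> '[1, R w] = (w == 1)%:R.
Proof.
move=> wn; rewrite lam_dot //; apply: canLR (mulKf (neq0CG B)) _.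
rewrite (eq_bigr (lamf w^-1)) => [|x Bx].
  by rewrite lamf_sum ?rootV // invr_eq1 mulr_natr.
by rewrite cfun1E (subsetP sBS) // mul1r.
Qed.

Let cfun1_dot_P w : w ^+ m = 1 -> '[1, P w] = (w == 1)%:R.
Proof.
move=> wm; rewrite theta_dot //; apply: canLR (mulKf (neq0CG C)) _.
rewrite (eq_bigr (thf w^-1)) => [|x Bx].
  by rewrite thf_sum ?rootV // invr_eq1 mulr_natr.
by rewrite cfun1E (subsetP sCS) // mul1r.
Qed.

(* [R w] is a principal series character; [pi_cf w] is a virtual expression of the
   discrete series character attached to [w]. *)
Definition St_cf : 'CF(S) := R 1 - 1.
Definition pi_cf w : 'CF(S) := R 1 - 2%:R *: 1 + P 1 - P w.

Lemma R_char w : w ^+ n = 1 -> R w \is a character.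
Proof.
move=> wn; rewrite cfInd_char // lin_charW // lin_cfun_lin_char //;
  [exact: lamfM | exact: lamf1].
Qed.

Lemma P_char w : w ^+ m = 1 -> P w \is a character.
Proof.
move=> wm; rewrite cfInd_char // lin_charW // lin_cfun_lin_char //;
  [exact: thfM | exact: thf1].
Qed.

Let R_dot_P w w' : w ^+ n = 1 -> w' ^+ m = 1 -> '[R w, P w'] = 2%:R.
Proof. by move=> wn w'm; rewrite cfdotC P_dot_R // rmorph_nat. Qed.

Let R_dot_1 w : w ^+ n = 1 -> '[R w, 1] = (w == 1)%:R.
Proof. by move=> wn; rewrite cfdotC cfun1_dot_R // rmorph_nat. Qed.

Let P_dot_1 w : w ^+ m = 1 -> '[P w, 1] = (w == 1)%:R.
Proof. by move=> wm; rewrite cfdotC cfun1_dot_P // rmorph_nat. Qed.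

Lemma pi_dot_R w w' : w ^+ m = 1 -> w' ^+ n = 1 -> '[pi_cf w, R w'] = 0.
Proof.
move=> wm w'n; rewrite cfdotBl cfdotDl cfdotBl cfdotZl.
rewrite R_dot_R // !P_dot_R // cfun1_dot_R // invr1 [w' == 1]eq_sym;
  do 3?case: (_ == _); rewrite ?mulr0n ?mulr1n; ring.
Qed.

Lemma pi_dot_1 w : w ^+ m = 1 -> w != 1 -> '[pi_cf w, 1] = 0.
Proof.
move=> wm nw1; rewrite cfdotBl cfdotDl cfdotBl cfdotZl.
rewrite R_dot_1 // !P_dot_1 // cfnorm1 eqxx (negPf nw1) mulr0n mulr1n; ring.
Qed.

Lemma pi_dot_P w w' : w ^+ m = 1 -> w' ^+ m = 1 ->
  '[pi_cf w, P w'] = 2%:R - (w == w')%:R - (w^-1 == w')%:R.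
Proof.
move=> wm w'm; rewrite cfdotBl cfdotDl cfdotBl cfdotZl.
rewrite R_dot_P // !P_dot_P // cfun1_dot_P // invr1 [w' == 1]eq_sym;
  do 3?case: (_ == _); rewrite ?mulr0n ?mulr1n; ring.
Qed.

Lemma pi_dot_pi w w' : w ^+ m = 1 -> w != 1 -> w' ^+ m = 1 ->
  '[pi_cf w, pi_cf w'] = (w == w')%:R + (w^-1 == w')%:R.
Proof.
move=> wm nw1 w'm; rewrite {2}/pi_cf cfdotBr cfdotDr cfdotBr cfdotZr.
rewrite pi_dot_R // !pi_dot_P // pi_dot_1 // invr_eq1 (negPf nw1); do 2!case: (_ == _);
  rewrite ?mulr0n ?mulr1n; ring.
Qed.

Lemma St_dot_R w : w ^+ n = 1 -> '[St_cf, R w] = (w == 1)%:R.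
Proof.
move=> wn; rewrite cfdotBl R_dot_R // cfun1_dot_R // invr1 [w == 1]eq_sym;
  case: (_ == _); rewrite ?mulr0n ?mulr1n; ring.
Qed.

Lemma St_dot_1 : '[St_cf, 1] = 0.
Proof. by rewrite cfdotBl R_dot_1 // cfnorm1 eqxx subrr. Qed.

Lemma pi_dot_St w : w ^+ m = 1 -> w != 1 -> '[pi_cf w, St_cf] = 0.
Proof. by move=> wm nw1; rewrite cfdotBr pi_dot_R // pi_dot_1 // subrr. Qed.

Lemma St_norm : '[St_cf] = 1.
Proof. by rewrite {2}/St_cf cfdotBr St_dot_R // St_dot_1 eqxx subr0. Qed.

Let R_one w : w ^+ n = 1 -> R w 1%g = q + 1.
Proof. by move=> wn; rewrite R_Z // set21. Qed.

Let P_one w : w ^+ m = 1 -> P w 1%g = q * (q - 1).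
Proof. by move=> wm; rewrite P_Z // set21. Qed.

Lemma St_one : St_cf 1%g = q.
Proof. by rewrite !cfunE R_one // cfun1E group1 addrK. Qed.

Lemma pi_one w : w ^+ m = 1 -> pi_cf w 1%g = q - 1.
Proof.
by move=> wm; rewrite !cfunE R_one // !P_one // cfun1E group1 mulr1n; ring.
Qed.

Lemma R_irr w : w ^+ n = 1 -> w ^+ 2 != 1 -> R w \in irr S.
Proof.
move=> wn nw2; rewrite irrEchar R_char // R_dot_R // eqxx.
suff /negPf-> : w^-1 != w by rewrite mulr1n mulr0n addr0 ?eqxx.
apply: contra nw2 => /eqP E; rewrite expr2 -{1}E mulVf //.
by apply: contra_eq_neq wn => ->; rewrite expr0n eqn0Ngt n_gt0 eq_sym oner_neq0.
Qed.

(** Norm 1 makes a virtual character irreducible up to sign, and the degree fixes the sign. *)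
Let pos_vchar_irr (f : 'CF(S)) :
  f \in 'Z[irr S]%g -> '[f] = 1 -> 0 <= f 1%g -> f \in irr S.
Proof.
move=> Zf f1 f_ge0; have [[] [i Df]] := vchar_norm1P Zf f1; last first.
  by rewrite Df expr0 scale1r mem_irr.
by move: f_ge0; rewrite Df expr1 scaleN1r cfunE oppr_ge0 (lt_geF (irr1_gt0 i)).
Qed.

Lemma pi_vchar w : w ^+ m = 1 -> pi_cf w \in 'Z[irr S]%g.
Proof.
move=> wm; rewrite !(rpredB, rpredD) ?rpredZ_nat ?char_vchar //.
- exact: R_char.
- exact: cfun1_char.
- exact: P_char.
exact: P_char.
Qed.

Lemma St_irr : St_cf \in irr S.
Proof.
apply: pos_vchar_irr; [| exact: St_norm | by rewrite St_one ler0n].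
by rewrite rpredB ?char_vchar ?R_char ?cfun1_char.
Qed.

Lemma pi_irr w : w ^+ m = 1 -> w ^+ 2 != 1 -> pi_cf w \in irr S.
Proof.
move=> wm nw2; have nw1 : w != 1 by apply: contraNneq nw2 => ->; rewrite expr1n.
apply: pos_vchar_irr; [exact: pi_vchar | | by rewrite pi_one // subr_ge0 ler1n].
rewrite pi_dot_pi // eqxx; suff /negPf-> : w^-1 != w by rewrite mulr1n mulr0n addr0 ?eqxx.
apply: contra nw2 => /eqP E; rewrite expr2 -{1}E mulVf //.
by apply: contra_eq_neq wm => ->; rewrite expr0n eq_sym oner_neq0.
Qed.

Let sum_prim_root k zeta w : k.-primitive_root zeta -> w ^+ k = 1 -> w != 1 ->
  \sum_(j < k | j != 0%N :> nat) (w == zeta ^+ j)%:R = 1 :> algC.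
Proof.
move=> prim_z wk nw1; have [i Dw] := prim_rootP prim_z wk.
have ni0 : i != 0%N :> nat by apply: contraNneq nw1 => i0; rewrite Dw i0 expr0.
rewrite (bigD1 i) //= Dw eqxx big1 ?addr0 // => j /andP[_ nji].
rewrite (eq_prim_root_expr prim_z) !modn_small // eq_sym.
by rewrite -[_ == _]/(j == i) (negPf nji).
Qed.

(** * The character induced from the center and completeness *)

Definition ZS_cf : 'CF(S) := 'Ind[S] (1 : 'CF('Z(S))).

Let inZ x : (x \in 'Z(S)%G) = (x \in Z).
Proof. by rewrite -cenS. Qed.

Let card_ZS : #|'Z(S)%G| = 2%N.
Proof. by rewrite -card_Z -cenS. Qed.

Let dot_ZS (f : 'CF(S)) : '[f, ZS_cf] = (f 1%g + f z) / 2%:R.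
Proof.
rewrite -cfdot_Res_l cfdotE card_ZS mulrC (eq_bigl _ _ inZ); congr (_ * _).
rewrite big_setU1 ?big_set1 ?inE 1?eq_sym //=.
have Z1 : (1%g : gT) \in 'Z(S)%G by rewrite inZ set21.
have Zz : z \in 'Z(S)%G by rewrite inZ set22.
by rewrite !cfResE ?center_sub // !cfun1E Z1 Zz !rmorph1 !mulr1.
Qed.

Lemma ZS_Z x : x \in Z -> ZS_cf x = q * (2 * n * m)%:R.
Proof.
move=> Zx; rewrite cfIndE ?center_sub //.
rewrite (eq_bigr (fun=> 1)) => [|y Sy]; last by rewrite Z_conj // cfun1E inZ Zx.
rewrite sumr_const card_ZS card_S; apply: canLR (mulKf _) _; first by rewrite pnatr_eq0.
by rewrite !natrM; ring.
Qed.

Variables (zn zm : algC).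
Hypotheses (prim_n : n.-primitive_root zn) (prim_m : m.-primitive_root zm).

Let zn_n i : zn ^+ i ^+ n = 1.
Proof. by rewrite exprAC (prim_expr_order prim_n) expr1n. Qed.

Let zm_m i : zm ^+ i ^+ m = 1.
Proof. by rewrite exprAC (prim_expr_order prim_m) expr1n. Qed.

(** Each [R w] with w^2 <> 1 occurs twice, for w and w^-1, so its coefficient below is m, half of
    its degree 2 m. A term at w = -1 occurs once, and splits into two characters of degree m. The
    same holds for [sumPi] with n in place of m. *)
Let sumR : 'CF(S) := \sum_(i < n | i != 0%N :> nat) R (zn ^+ i).
Let sumPi : 'CF(S) := \sum_(i < m | i != 0%N :> nat) pi_cf (zm ^+ i).

Let zn_neq1 (i : 'I_n) : i != 0%N :> nat -> zn ^+ i != 1.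
Proof.
move=> ni0; rewrite -(prim_order_dvd prim_n); apply: contra ni0 => n_i.
by case: (posnP i) => // i_gt0; have := dvdn_leq i_gt0 n_i; rewrite leqNgt ltn_ord.
Qed.

Let zm_neq1 (i : 'I_m) : i != 0%N :> nat -> zm ^+ i != 1.
Proof.
move=> ni0; rewrite -(prim_order_dvd prim_m); apply: contra ni0 => m_i.
by case: (posnP i) => // i_gt0; have := dvdn_leq i_gt0 m_i; rewrite leqNgt ltn_ord.
Qed.

Let dot_sumR w : w ^+ n = 1 -> w != 1 -> '[R w, sumR] = 2%:R.
Proof.
move=> wn nw1; rewrite cfdot_sumr (eq_bigr (fun j : 'I_n => (w == zn ^+ j)%:R + (w^-1
  == zn ^+ j)%:R)) => [|j _]; last exact: R_dot_R.
by rewrite big_split /= !(sum_prim_root prim_n) ?rootV ?invr_eq1 //; ring.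
Qed.

Let dot_sumPi w : w ^+ m = 1 -> w != 1 -> '[pi_cf w, sumPi] = 2%:R.
Proof.
move=> wm nw1; rewrite cfdot_sumr (eq_bigr (fun j : 'I_m => (w == zm ^+ j)%:R + (w^-1
  == zm ^+ j)%:R)) => [|j _]; last exact: pi_dot_pi.
by rewrite big_split /= !(sum_prim_root prim_m) ?rootV ?invr_eq1 //; ring.
Qed.

Let sum_neq0 k (c : algC) : (0 < k)%N ->
  \sum_(i < k | i != 0%N :> nat) c = c * (k%:R - 1).
Proof.
case: k => // k _; rewrite big_mkcond big_ord_recl /= add0r.
by rewrite sumr_const card_ord -natr1 addrK mulr_natr.
Qed.

Let dot_sumR_f (f : 'CF(S)) : (forall w, w ^+ n = 1 -> w != 1 -> '[f, R w] = 0) ->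
  '[f, sumR] = 0.
Proof. by move=> f0; rewrite cfdot_sumr big1 // => i ni0; rewrite f0 ?zn_neq1. Qed.

Let dot_sumPi_f (f : 'CF(S)) : (forall w, w ^+ m = 1 -> w != 1 -> '[f, pi_cf w] = 0) ->
  '[f, sumPi] = 0.
Proof. by move=> f0; rewrite cfdot_sumr big1 // => i ni0; rewrite f0 ?zm_neq1. Qed.

Let sumR_Z x : x \in Z -> sumR x = (q + 1) * (n%:R - 1).
Proof.
by move=> Zx; rewrite sum_cfunE -sum_neq0 //; apply: eq_bigr => i _; rewrite R_Z.
Qed.

Let cf1_Z x : x \in Z -> (1 : 'CF(S)) x = 1.
Proof. by move=> Zx; rewrite cfun1E (subsetP (center_sub S)) // inZ. Qed.

Lemma St_Z x : x \in Z -> St_cf x = q.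
Proof. by move=> Zx; rewrite !cfunE R_Z // cf1_Z // addrK. Qed.

Lemma pi_Z w x : w ^+ m = 1 -> x \in Z -> pi_cf w x = q - 1.
Proof.
by move=> wm Zx; rewrite !cfunE R_Z // !P_Z // cf1_Z //; ring.
Qed.

Let sumPi_Z x : x \in Z -> sumPi x = (q - 1) * (m%:R - 1).
Proof.
by move=> Zx; rewrite sum_cfunE -sum_neq0 //; apply: eq_bigr => i _; rewrite pi_Z.
Qed.

(* Both sides have the same norm and the same inner product, |S| / 2. *)
Lemma ZS_decomposition :
  ZS_cf = 1 + q *: St_cf + m%:R *: sumR + n%:R *: sumPi.
Proof.
set D := (X in _ = X); pose N : algC := q * (2 * n * m)%:R.
have DN (f : 'CF(S)) a : f 1%g = a -> f z = a -> '[f, ZS_cf] = a.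
  by move=> f1 fz; rewrite dot_ZS f1 fz; field.
have Z1 : 1%g \in Z by rewrite set21.
have Zz : z \in Z by rewrite set22.
have ZZ : '[ZS_cf, ZS_cf] = N by apply: DN; rewrite ZS_Z.
have DZ : '[D, ZS_cf] = N.
  apply: DN; rewrite !cfunE !(sumR_Z, sumPi_Z) // R_Z // cf1_Z // /N;
  by rewrite !(natrM, =^~ natr1, mulr1n); ring.
have ZD : '[ZS_cf, D] = N.
  by rewrite cfdotC DZ /N rmorphM /= !rmorph_nat.
have D1 : '[D, 1] = 1.
  rewrite cfdotC !cfdotDr !cfdotZr cfnorm1 dot_sumR_f => [|w wn nw1]; last first.
    by rewrite cfun1_dot_R // (negPf nw1).
  rewrite dot_sumPi_f => [|w wm nw1]; last by rewrite cfdotC pi_dot_1 ?rmorph0.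
  by rewrite cfdotC St_dot_1 rmorph0 !mulr0 !addr0 rmorph1.
have DSt : '[D, St_cf] = q.
  rewrite cfdotC !cfdotDr !cfdotZr St_norm dot_sumR_f => [|w wn nw1]; last first.
    by rewrite St_dot_R // (negPf nw1).
  rewrite dot_sumPi_f => [|w wm nw1]; last by rewrite cfdotC pi_dot_St ?rmorph0.
  by rewrite St_dot_1 !mulr0 !addr0 add0r mulr1 conjCK.
have DR : '[D, sumR] = m%:R * (2%:R * (n%:R - 1)).
  rewrite !cfdotDl !cfdotZl dot_sumR_f => [|w wn nw1]; last first.
    by rewrite cfun1_dot_R // (negPf nw1).
  rewrite dot_sumR_f => [|w wn nw1]; last by rewrite St_dot_R // (negPf nw1).
  rewrite [X in n%:R * X]cfdot_suml [X in n%:R * X]big1 => [|i _]; last first.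
    by rewrite dot_sumR_f // => w wn nw1; rewrite pi_dot_R.
  rewrite [X in m%:R * X]cfdot_suml (eq_bigr (fun=> 2%:R)) => [|i ni0].
    by rewrite sum_neq0 //; ring.
  by rewrite dot_sumR ?zn_neq1.
have DPi : '[D, sumPi] = n%:R * (2%:R * (m%:R - 1)).
  rewrite !cfdotDl !cfdotZl dot_sumPi_f => [|w wm nw1]; last first.
    by rewrite cfdotC pi_dot_1 ?rmorph0.
  rewrite dot_sumPi_f => [|w wm nw1]; last by rewrite cfdotC pi_dot_St ?rmorph0.
  rewrite [X in m%:R * X]cfdot_suml [X in m%:R * X]big1 => [|i _]; last first.
    by rewrite dot_sumPi_f // => w wm nw1; rewrite cfdotC pi_dot_R ?rmorph0.
  rewrite [X in n%:R * X]cfdot_suml (eq_bigr (fun=> 2%:R)) => [|i ni0].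
    by rewrite sum_neq0 //; ring.
  by rewrite dot_sumPi ?zm_neq1.
have DD : '[D, D] = N.
  rewrite {2}/D !cfdotDr !cfdotZr !rmorph_nat D1 DSt DR DPi /N.
  by rewrite !(natrM, =^~ natr1); ring.
apply/eqP; rewrite -subr_eq0 -cfnorm_eq0 cfdotBl !cfdotBr ZZ DZ ZD DD.
by rewrite !subrr.
Qed.

Lemma irr_dot_neq0 (phi psi : 'CF(S)) :
  phi \in irr S -> psi \in irr S -> '[phi, psi] != 0 -> phi = psi.
Proof.
case/irrP=> i -> /irrP[j ->]; rewrite cfdot_irr.
by have [-> | _] := eqVneq i j; rewrite ?eqxx.
Qed.

Lemma dot_ZS_decomposition (f : 'CF(S)) :
  '[f, ZS_cf] = '[f, 1] + q * '[f, St_cf]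
     + m%:R * (\sum_(i < n | i != 0%N :> nat) '[f, R (zn ^+ i)])
     + n%:R * (\sum_(i < m | i != 0%N :> nat) '[f, pi_cf (zm ^+ i)]).
Proof.
by rewrite ZS_decomposition ![in LHS]cfdotDr !cfdotZr !rmorph_nat /sumR /sumPi !cfdot_sumr.
Qed.

(** The inner product of chi with [ZS_cf] is its degree, so some term of the decomposition has
    nonzero inner product with chi. The last two cases stop there because the terms at w = -1 are
    reducible. *)
Lemma irr_cases (chi : 'CF(S)) : chi \in irr S -> Z \subset cfker chi ->
  [\/ chi = 1, chi = St_cf,
      exists w, [/\ w ^+ n = 1, w != 1 & '[chi, R w] != 0]
    | exists w, [/\ w ^+ m = 1, w != 1 & '[chi, pi_cf w] != 0]].
Proof.
move=> irr_chi kerZ; have : '[chi, ZS_cf] != 0.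
  rewrite dot_ZS cfker1 ?(subsetP kerZ) ?set22 //.
  rewrite (_ : (_ + _) / _ = chi 1%g); last by field.
  by case/irrP: irr_chi => k ->; apply: irr1_neq0.
have [chi1 | n1] := eqVneq '[chi, 1] 0; last first.
  by move=> _; constructor 1; apply: (irr_dot_neq0 irr_chi _ n1); rewrite -irr0 mem_irr.
have [chiSt | nSt] := eqVneq '[chi, St_cf] 0; last first.
  by move=> _; constructor 2; apply: irr_dot_neq0 => //; apply: St_irr.
have [/existsP[i /andP[ni0 nR]] | noR] :=
    boolP [exists i : 'I_n, (i != 0%N :> nat) && ('[chi, R (zn ^+ i)] != 0)].
  by move=> _; constructor 3; exists (zn ^+ i); rewrite zn_neq1.
have [/existsP[i /andP[ni0 nP]] | noP] :=
    boolP [exists i : 'I_m, (i != 0%N :> nat) && ('[chi, pi_cf (zm ^+ i)] != 0)].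
  by move=> _; constructor 4; exists (zm ^+ i); rewrite zm_neq1.
rewrite dot_ZS_decomposition chi1 chiSt !big1 ?mulr0 ?addr0 ?eqxx // => i ni0.
  by apply/eqP/negPn; apply: contra noP => nP; apply/existsP; exists i; rewrite ni0.
by apply/eqP/negPn; apply: contra noR => nR; apply/existsP; exists i; rewrite ni0.
Qed.

(* On an element x with no conjugate in [B] or [C], ZS_decomposition would read
   0 = - 2 n m. *)
Lemma conj_cover x : x \in S ->
  exists2 y, y \in S & (x ^ y)%g \in B \/ (x ^ y)%g \in C.
Proof.
move=> Sx; apply: contrapT => no_conj.
have nB y : y \in S -> (x ^ y)%g \notin B.
  by move=> Sy; apply/negP=> Bxy; apply: no_conj; exists y => //; left.
have nC y : y \in S -> (x ^ y)%g \notin C.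
  by move=> Sy; apply/negP=> Cxy; apply: no_conj; exists y => //; right.
have R0 w : w ^+ n = 1 -> R w x = 0.
  move=> wn; rewrite cfIndE // big1 ?mulr0 // => y Sy.
  by rewrite cfun0 ?nB.
have P0 w : w ^+ m = 1 -> P w x = 0.
  move=> wm; rewrite cfIndE // big1 ?mulr0 // => y Sy.
  by rewrite cfun0 ?nC.
have Z0 : ZS_cf x = 0.
  rewrite cfIndE ?center_sub // big1 ?mulr0 // => y Sy.
  by rewrite cfun0 // inZ; apply: contra (nB y Sy); apply/subsetP.
have x1 : (1 : 'CF(S)) x = 1 by rewrite cfun1E Sx.
have St0 : St_cf x = -1 by rewrite !cfunE R0 // x1 sub0r.
have pi0 w : w ^+ m = 1 -> pi_cf w x = - 2%:R.
  by move=> wm; rewrite !cfunE R0 // !P0 // x1; ring.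
have := congr1 (fun f : 'CF(S) => f x) ZS_decomposition; rewrite /= Z0.
have cfD (f g : 'CF(S)) : (f + g) x = f x + g x by rewrite cfunE.
have cfZ a (f : 'CF(S)) : (a *: f) x = a * f x by rewrite cfunE.
rewrite 3!cfD 3!cfZ x1 St0.
have -> : sumR x = 0 by rewrite sum_cfunE big1 // => i _; rewrite R0.
have -> : sumPi x = - 2%:R * (m%:R - 1).
  by rewrite sum_cfunE -sum_neq0 //; apply: eq_bigr => i _; rewrite pi0.
move/eqP; apply/negP; rewrite eq_sym.
have -> : 1 + q * -1 + m%:R * 0 + n%:R * (- 2%:R * (m%:R - 1)) = - (2 * n * m)%:R :> algC.
  by rewrite !(natrM, =^~ natr1); ring.
by rewrite oppr_eq0 pnatr_eq0 !muln_eq0 /= orbF eqn0Ngt n_gt0.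
Qed.

(** * Galois action and equality of parameters *)

Lemma R_aut (mu : {rmorphism algC -> algC}) w : w ^+ n = 1 ->
  cfAut mu (R w) = R (mu w).
Proof.
move=> wn; have mwn : mu w ^+ n = 1 by rewrite -rmorphXn wn rmorph1.
rewrite cfAutInd; congr ('Ind _); apply/cfunP=> x.
by rewrite cfunE !lamE //; case: ifP; rewrite ?rmorph0 ?lamf_aut.
Qed.

Lemma P_aut (mu : {rmorphism algC -> algC}) w : w ^+ m = 1 ->
  cfAut mu (P w) = P (mu w).
Proof.
move=> wn; have mwn : mu w ^+ m = 1 by rewrite -rmorphXn wn rmorph1.
rewrite cfAutInd; congr ('Ind _); apply/cfunP=> x.
by rewrite cfunE !thetaE //; case: ifP; rewrite ?rmorph0 ?thf_aut.
Qed.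

Lemma pi_aut (mu : {rmorphism algC -> algC}) w : w ^+ m = 1 ->
  cfAut mu (pi_cf w) = pi_cf (mu w).
Proof.
move=> wn; rewrite /pi_cf !(rmorphB, rmorphD) /= cfAutZ_nat.
by rewrite R_aut // !P_aut // !rmorph1.
Qed.

Lemma St_aut (mu : {rmorphism algC -> algC}) : cfAut mu St_cf = St_cf.
Proof. by rewrite /St_cf rmorphB /= R_aut // !rmorph1. Qed.

Lemma R_inj w w' : w ^+ n = 1 -> w' ^+ n = 1 -> R w = R w' -> w' = w \/ w' = w^-1.
Proof.
move=> wn w'n E; have := R_dot_R wn w'n; rewrite -E R_dot_R // eqxx.
have [-> | _] := eqVneq w w'; first by left.
have [-> | _] := eqVneq w^-1 w'; first by right.
rewrite !mulr0n addr0; case: (_ == w) => /eqP; rewrite ?mulr1n ?mulr0n -?mulr2n ?addr0.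
  by rewrite pnatr_eq0.
by rewrite oner_eq0.
Qed.

Lemma pi_inj w w' : w ^+ m = 1 -> w != 1 -> w' ^+ m = 1 ->
  pi_cf w = pi_cf w' -> w' = w \/ w' = w^-1.
Proof.
move=> wm nw1 w'm E; have := pi_dot_pi wm nw1 w'm; rewrite -E pi_dot_pi // eqxx.
have [-> | _] := eqVneq w w'; first by left.
have [-> | _] := eqVneq w^-1 w'; first by right.
rewrite !mulr0n addr0; case: (_ == w) => /eqP; rewrite ?mulr1n ?mulr0n -?mulr2n ?addr0.
  by rewrite pnatr_eq0.
by rewrite oner_eq0.
Qed.

Let root_neq0 k w : (0 < k)%N -> w ^+ k = 1 -> w != 0.
Proof.
move=> k_gt0 wk; apply: contra_eq_neq wk => ->.
by rewrite expr0n eqn0Ngt k_gt0 eq_sym oner_neq0.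
Qed.

Lemma sum_inv_eq (u w : algC) : u != 0 -> w != 0 -> u + u^-1 = w + w^-1 ->
  u = w \/ u = w^-1.
Proof.
move=> nzu nzw E; have : (u - w) * (u - w^-1) = 0.
  transitivity (u * ((u + u^-1) - (w + w^-1))); last by rewrite E subrr mulr0.
  by field; rewrite nzu nzw.
by move/eqP; rewrite mulf_eq0 !subr_eq0 => /orP[] /eqP; [left | right].
Qed.

Let neq_inv w : w != 0 -> w ^+ 2 != 1 -> w != w^-1.
Proof. by move=> nzw; apply: contraNneq => E; rewrite expr2 {2}E mulfV. Qed.

Let eq_of_dot (f g : 'CF(S)) :
  '[f, f] - '[f, g] - ('[g, f] - '[g, g]) = 0 -> f = g.
Proof.
by move=> E; apply/eqP; rewrite -subr_eq0 -cfnorm_eq0 cfdotBl !cfdotBr E.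
Qed.

(** The inner products already computed give the difference of the two characters norm zero. *)
Lemma R_invr w : w ^+ n = 1 -> R w^-1 = R w.
Proof.
move=> wn; apply: eq_of_dot; rewrite !R_dot_R ?rootV // !invrK !eqxx [w == _]eq_sym.
by case: (w^-1 == w); rewrite ?mulr1n ?mulr0n; ring.
Qed.

Lemma pi_invr w : w ^+ m = 1 -> w != 1 -> pi_cf w^-1 = pi_cf w.
Proof.
move=> wm nw1; apply: eq_of_dot;
  rewrite !pi_dot_pi ?rootV ?invr_eq1 // !invrK !eqxx [w == _]eq_sym.
by case: (w^-1 == w); rewrite ?mulr1n ?mulr0n; ring.
Qed.

Let aut_sum_inv (mu : {rmorphism algC -> algC}) k w : (0 < k)%N -> w ^+ k = 1 ->
  mu (w + w^-1) = w + w^-1 -> mu w = w \/ mu w = w^-1.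
Proof.
move=> k_gt0 wk; rewrite rmorphD fmorphV; apply: sum_inv_eq.
  by rewrite fmorph_eq0 (root_neq0 k_gt0 wk).
exact: root_neq0 wk.
Qed.

Lemma lam_trace (f : 'CF(S)) w : w ^+ n = 1 ->
  #|B|%:R^-1 * \sum_(h in B) lamf w h^-1%g * f h = '[f, R w].
Proof.
move=> wn; rewrite lam_dot //; congr (_ * _); apply: eq_bigr => h Bh.
by rewrite lamfV // mulrC.
Qed.

Lemma theta_trace (f : 'CF(S)) w : w ^+ m = 1 ->
  #|C|%:R^-1 * \sum_(h in C) thf w h^-1%g * f h = '[f, P w].
Proof.
move=> wm; rewrite theta_dot //; congr (_ * _); apply: eq_bigr => h Ch.
by rewrite thfV // mulrC.
Qed.

(** * Products of projections and inverting elements *)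

Section Cycles.

Variables (k : nat) (rG : mx_representation algC S k).

Let EB w := lin_idempotent B rG (lamf w).
Let EC w := lin_idempotent C rG (thf w).

Let EB_Mr w b : w ^+ n = 1 -> b \in B -> EB w *m rG b = lamf w b *: EB w.
Proof. by move=> wn; apply: lin_idempotentMr => //; [apply: lamfM | apply: lamf1]. Qed.

Let EB_Ml w b : w ^+ n = 1 -> b \in B -> rG b *m EB w = lamf w b *: EB w.
Proof. by move=> wn; apply: lin_idempotentMl => //; [apply: lamfM | apply: lamf1]. Qed.

(** Moving a generator t of T across [rG wl] inverts it. The projection absorbs t as w on the left
    and as w^-1 on the right, and these scalars differ. *)
Let EB_wl w : w ^+ n = 1 -> w ^+ 2 != 1 -> EB w *m rG wl *m EB w = 0.
Proof.
move=> wn nw2; have [t Tt tE] := lamf_gen; have Bt := subsetP sTB t Tt.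
have St := subsetP sBS t Bt.
have nw : w != w^-1 by apply: neq_inv => //; apply: root_neq0 wn.
have Mr b := @EB_Mr w b wn; have Ml b := @EB_Ml w b wn.
move: (EB w) Mr Ml => E Mr Ml.
have EE : E *m rG t *m rG wl *m E = E *m rG wl *m rG t^-1%g *m E.
  have -> // : E *m rG t *m rG wl = E *m rG wl *m rG t^-1%g.
  by rewrite -!mulmxA -!repr_mxM ?groupV // -(T_wl Tt) -conjgC.
have e1 : w *: (E *m rG wl *m E) = E *m rG t *m rG wl *m E.
  by rewrite (Mr t Bt) tE // -!scalemxAl.
have e2 : w^-1 *: (E *m rG wl *m E) = E *m rG wl *m rG t^-1%g *m E.
  by rewrite -[RHS]mulmxA (Ml _ (groupVr Bt)) lamfV // tE ?rootV // -scalemxAr.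
have /eqP : (w - w^-1) *: (E *m rG wl *m E) = 0 by rewrite scalerBl e1 e2 EE subrr.
by rewrite scaler_eq0 subr_eq0 (negPf nw) => /eqP.
Qed.

Let EB_notB w x : w ^+ n = 1 -> w ^+ 2 != 1 -> x \in S -> x \notin B ->
  EB w *m rG x *m EB w = 0.
Proof.
move=> wn nw2 Sx nBx; have [b Bb [b' Bb' ->]] := bruhat_dec Sx nBx.
have [Sb Sb'] := (subsetP sBS b Bb, subsetP sBS b' Bb').
have Mr := EB_Mr wn Bb; have Ml := EB_Ml wn Bb'; have Ewl := EB_wl wn nw2.
move: (EB w) Mr Ml Ewl => E Mr Ml Ewl.
rewrite !repr_mxM ?groupM // !mulmxA Mr -mulmxA Ml.
by rewrite -!scalemxAl -scalemxAr Ewl !scaler0.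
Qed.

(** Expanding the middle projection over b in B, the term of b vanishes unless wl b wl lies in B,
    that is unless b is in T. The surviving terms are equal, and |T| / |B| = 1/q. *)
Lemma borel_cycle w : w ^+ n = 1 -> w ^+ 2 != 1 ->
  EB w *m rG wl *m EB w^-1 *m rG wl *m EB w = q^-1 *: EB w.
Proof.
move=> wn nw2; have summand b : b \in B ->
    EB w *m rG wl *m rG b *m rG wl *m EB w
      = (if b \in T then lamf w b^-1%g else 0) *: EB w.
  move=> Bb; have Sb := subsetP sBS b Bb.
  have -> : EB w *m rG wl *m rG b *m rG wl *m EB w = EB w *m rG (wl * b * wl)%g *m EB w.
    by rewrite !repr_mxM ?groupM // !mulmxA.
  case: ifP => [Tb | nTb]; last first.
    rewrite (EB_notB wn nw2) ?scale0r //; first by rewrite !groupM.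
    by apply/negP=> /(wlBwl Bb); rewrite nTb.
  have -> : (wl * b * wl = z * b^-1)%g.
    by rewrite -(T_wl Tb) -wlwl conjgE !mulgA mulgK.
  have Bz : z \in B by rewrite (subsetP sZB) ?set22.
  rewrite EB_Mr ?groupM ?groupV // -scalemxAl /EB lin_idempotentE //.
  - by rewrite lamfM ?groupV // lamf_Z ?set22 // mul1r.
  - exact: lamfM.
  exact: lamf1.
have -> : EB w^-1 = #|B|%:R^-1 *: \sum_(b in B) lamf w^-1 b^-1%g *: rG b by [].
move: (EB w) summand => E summand.
rewrite -!scalemxAr -!scalemxAl mulmx_sumr !mulmx_suml scaler_sumr.
rewrite (eq_bigr (fun b => (#|B|%:R^-1 *+ (b \in T)) *: E)) => [|b Bb]; last first.
  rewrite -!scalemxAr -!scalemxAl summand // !scalerA; congr (_ *: _).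
  case: ifP => _; last by rewrite mulr0.
  rewrite -?mulrA -lamf_mul mulVf ?lamf_one ?mulr1 ?mulr1n //.
  exact: root_neq0 n_gt0 wn.
rewrite -scaler_suml; congr (_ *: _).
rewrite sum_mulrb_sub // card_T card_B -[LHS]mulr_natr natrM invfM mulrAC mulVf ?mul1r //.
by rewrite natrM mulf_neq0 ?pnatr_eq0 -?lt0n ?n_gt0.
Qed.

(** Since v inverts C, [EC w] passes through [rG v] as [EC w^-1]; the two copies of v combine to z,
    on which the character is trivial. *)
Lemma nsplit_cycle w : w ^+ m = 1 ->
  EC w *m rG v *m EC w^-1 *m rG v *m EC w = 1 *: EC w.
Proof.
move=> wm; have wVm := rootV wm.
have EC_v u : u ^+ m = 1 -> EC u *m rG v = rG v *m EC u^-1.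
  move=> um; rewrite /EC /lin_idempotent -scalemxAr -scalemxAl; congr (_ *: _).
  rewrite mulmx_suml mulmx_sumr [RHS](reindex_inj invg_inj) /=.
  apply: eq_big => [c | c Cc]; first by rewrite groupV.
  have Sc := subsetP sCS c Cc.
  rewrite -scalemxAl -scalemxAr -!repr_mxM ?groupV // invgK thfV //.
  by congr (_ *: rG _); rewrite -(C_v Cc) -conjgC.
have ECE u : u ^+ m = 1 -> EC u *m EC u = EC u.
  by move=> um; apply: lin_idempotentE => //; [apply: thfM | apply: thf1].
rewrite EC_v // -[rG v *m EC w^-1 *m EC w^-1]mulmxA ECE //.
rewrite -[rG v *m EC w^-1 *m rG v]mulmxA EC_v // invrK -!mulmxA ECE // mulmxA.
rewrite -repr_mxM // vv scale1r.
have Cz : z \in C by rewrite (subsetP sZC) ?set22.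
rewrite /EC lin_idempotentMl //; [| exact: thfM | exact: thf1].
by rewrite thf_Z ?set22 // scale1r.
Qed.

End Cycles.

Variable Jac : algC -> algC.
Hypothesis Jac_mul : forall w, w ^+ n = 1 -> w ^+ 2 != 1 -> Jac w * Jac w^-1 = q.
Hypothesis Jac_aut : forall (mu : {rmorphism algC -> algC}) w, mu (Jac w) = Jac (mu w).

Lemma R_realizable w : w ^+ n = 1 -> w ^+ 2 != 1 -> realizable (R w) (w + w^-1).
Proof.
move=> wn nw2; have wVn := rootV wn.
have nzw : w != 0 := root_neq0 n_gt0 wn.
have nwV2 : w^-1 ^+ 2 != 1 by rewrite exprVn invr_eq1.
have R_fix (nu : {rmorphism algC -> algC}) : nu (w + w^-1) = w + w^-1 ->
    cfAut nu (R w) = R w.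
  move=> nuw; rewrite R_aut //.
  by case: (aut_sum_inv n_gt0 wn nuw) => -> //; apply: R_invr wn.
have trR : '[R w, R w] = 1 by apply: irrWnorm; apply: R_irr.
apply: (@realizable_swap _ _ B sBS _ _ (R_irr wn nw2) R_fix (lamf w) (lamf w^-1) wl
          (Jac w) (Jac w^-1) q^-1) => //.
- exact: lamfM.
- exact: lamfM.
- exact: lamf1.
- exact: lamf1.
- have [t Tt tE] := lamf_gen; exists t; first exact: subsetP sTB t Tt.
  by rewrite !tE // neq_inv.
- by rewrite Jac_mul // mulfV // pnatr_eq0.
- move=> k rG _ /=; split; first exact: borel_cycle.
  by have := borel_cycle rG wVn nwV2; rewrite invrK.
- move=> nu nuw; have [nw | nw] := aut_sum_inv n_gt0 wn nuw; [left | right].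
    by split=> *; rewrite ?lamf_aut ?Jac_aut ?fmorphV ?nw.
  by split=> *; rewrite ?lamf_aut ?Jac_aut ?fmorphV ?nw ?invrK.
- by rewrite lam_trace.
by rewrite lam_trace // R_invr.
Qed.

Lemma pi_realizable w : w ^+ m = 1 -> w ^+ 2 != 1 -> realizable (pi_cf w) (w + w^-1).
Proof.
move=> wm nw2; have wVm := rootV wm; have m_gt0 : (0 < m)%N by [].
have nw1 : w != 1 by apply: contraNneq nw2 => ->; rewrite expr1n.
have nzw : w != 0 := root_neq0 m_gt0 wm.
have nw := neq_inv nzw nw2.
have pi_fix (nu : {rmorphism algC -> algC}) : nu (w + w^-1) = w + w^-1 ->
    cfAut nu (pi_cf w) = pi_cf w.
  move=> nuw; rewrite pi_aut //.
  by case: (aut_sum_inv m_gt0 wm nuw) => -> //; apply: pi_invr wm nw1.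
apply: (@realizable_swap _ _ C sCS _ _ (pi_irr wm nw2) pi_fix (thf w) (thf w^-1) v
          1 1 1) => //.
- exact: thfM.
- exact: thfM.
- exact: thf1.
- exact: thf1.
- have [t Ct tE] := thf_gen; exists t => //.
  by rewrite !tE.
- by rewrite !mulr1.
- move=> k rG _ /=; split; first exact: nsplit_cycle.
  by have := nsplit_cycle rG wVm; rewrite invrK.
- move=> nu nuw; have [nuw' | nuw'] := aut_sum_inv m_gt0 wm nuw; [left | right].
    by split=> *; rewrite ?thf_aut ?rmorph1 ?fmorphV ?nuw'.
  by split=> *; rewrite ?thf_aut ?rmorph1 ?fmorphV ?nuw' ?invrK.
- by rewrite theta_trace // pi_dot_P // eqxx [_ == w]eq_sym (negPf nw) mulr1n mulr0n; ring.
by rewrite theta_trace // pi_dot_P // eqxx (negPf nw) mulr1n mulr0n; ring.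
Qed.

Lemma St_realizable : realizable St_cf 0.
Proof.
apply: (@realizable_lin _ _ B sBS _ _ St_irr _ (lamf 1)).
- by move=> nu _; apply: St_aut.
- exact: lamfM.
- exact: lamf1.
- by move=> nu _ h; rewrite lamf_one rmorph1.
by rewrite lam_trace // St_dot_R // eqxx.
Qed.

(* The remaining characters are the two halves of R (-1) for even n and of
   pi (-1) for odd n: both have norm 2. Their difference vanishes off the conjugates
   of [X1] and [X2], the two classes of unipotent elements up to sign, and takes
   opposite values +-sqrt (+-q) there. *)
Section HalfCharacters.

Hypothesis TB1 : T :&: B1 \subset Z.
Variables (X1 X2 : {set gT}) (u1 u2 : gT).
Hypotheses (X12 : B1 :\: Z = X1 :|: X2) (dX12 : [disjoint X1 & X2]) (cX12 : #|X1| = #|X2|).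
Hypotheses (X1u : u1 \in X1) (X2u : u2 \in X2).
Hypothesis X1J : forall x, x \in X1 ->
  exists2 y, y \in S & x = (u1 ^ y)%g \/ x = (u1 ^ y * z)%g.
Hypothesis X2J : forall x, x \in X2 ->
  exists2 y, y \in S & x = (u2 ^ y)%g \/ x = (u2 ^ y * z)%g.
Hypothesis u1V : u1^-1%g \in if odd n then X2 else X1.

(** -1 is an m-th root of unity for odd n and an n-th root of unity for even n, so just one of the
    two families contains this parameter. *)
Definition half_cf : 'CF(S) := if odd n then pi_cf (-1) else R (-1).
Definition half_deg : nat := if odd n then n else m.
Local Notation hf := half_cf.

Let N1n : odd n = false -> (-1) ^+ n = 1 :> algC.
Proof. by move=> e; rewrite -signr_odd e. Qed.

Let N1m : odd n -> (-1) ^+ m = 1 :> algC.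
Proof. by move=> o; rewrite -signr_odd /= o. Qed.

Let N1_neq1 : -1 != 1 :> algC.
Proof. by rewrite lt_eqF // (lt_trans (ltrN10 _) ltr01). Qed.

Let invN1 : (-1)^-1 = -1 :> algC. Proof. by rewrite invrN invr1. Qed.

Lemma half_vchar : hf \in 'Z[irr S]%g.
Proof.
rewrite /half_cf; case: ifP => [o | e]; first by apply: pi_vchar; apply: N1m.
by apply: char_vchar; apply: R_char; apply: N1n.
Qed.

Lemma half_norm : '[hf] = 2%:R.
Proof.
rewrite /half_cf; case: ifP => [o | e].
  by rewrite pi_dot_pi ?N1m // invN1 eqxx mulr1n; ring.
by rewrite R_dot_R ?N1n // invN1 eqxx mulr1n; ring.
Qed.

Lemma half_dot_1 : '[hf, 1] = 0.
Proof.
rewrite /half_cf; case: ifP => [o | e]; first by rewrite pi_dot_1 ?N1m.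
by rewrite R_dot_1 ?N1n // (negPf N1_neq1).
Qed.

Lemma half_dot_St : '[hf, St_cf] = 0.
Proof.
rewrite /half_cf; case: ifP => [o | e]; first by rewrite pi_dot_St ?N1m.
by rewrite cfdotC St_dot_R ?N1n // (negPf N1_neq1) rmorph0.
Qed.

Let neq_N1 w : w ^+ 2 != 1 -> (w == -1) = false.
Proof. by move=> nw2; apply: contraNF nw2 => /eqP->; rewrite sqrrN expr1n. Qed.

Lemma half_dot_R w : w ^+ n = 1 -> w ^+ 2 != 1 -> '[hf, R w] = 0.
Proof.
move=> wn nw2; rewrite /half_cf; case: ifP => [o | e]; first by rewrite pi_dot_R ?N1m.
by rewrite R_dot_R ?N1n // invN1 eq_sym neq_N1 // addr0.
Qed.

Lemma half_dot_pi w : w ^+ m = 1 -> w ^+ 2 != 1 -> '[hf, pi_cf w] = 0.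
Proof.
move=> wm nw2; rewrite /half_cf; case: ifP => [o | e].
  by rewrite pi_dot_pi ?N1m // invN1 eq_sym neq_N1 // addr0.
by rewrite cfdotC pi_dot_R ?N1n // rmorph0.
Qed.

Lemma half_aut (mu : {rmorphism algC -> algC}) : cfAut mu hf = hf.
Proof.
rewrite /half_cf; case: ifP => [o | e]; first by rewrite pi_aut ?N1m // rmorphN1.
by rewrite R_aut ?N1n // rmorphN1.
Qed.

Let root_pm1 w : w ^+ 2 = 1 -> w != 1 -> w = -1.
Proof. by move=> /eqP; rewrite sqrf_eq1 => /orP[/eqP-> | /eqP->] //; rewrite eqxx. Qed.

Lemma half_R w : w ^+ n = 1 -> w ^+ 2 = 1 -> w != 1 -> hf = R w.
Proof.
move=> wn w2 nw1; have wN := root_pm1 w2 nw1; rewrite /half_cf wN ifF //.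
by apply: contraNF N1_neq1 => o; have := wn; rewrite wN -signr_odd o expr1 => ->.
Qed.

Lemma half_pi w : w ^+ m = 1 -> w ^+ 2 = 1 -> w != 1 -> hf = pi_cf w.
Proof.
move=> wm w2 nw1; have wN := root_pm1 w2 nw1; rewrite /half_cf wN ifT //.
by apply: contraNT N1_neq1 => e; have := wm; rewrite wN -signr_odd /= e expr1 => ->.
Qed.

(** In the decomposition of [ZS_cf] only the term at w = -1 survives. Its coefficient is n in the
    discrete series (odd n), m in the principal series (even n). *)
Lemma dot_ZS_half (f : 'CF(S)) : '[f, 1] = 0 -> '[f, St_cf] = 0 ->
    (forall w, w ^+ n = 1 -> w ^+ 2 != 1 -> '[f, R w] = 0) ->
    (forall w, w ^+ m = 1 -> w ^+ 2 != 1 -> '[f, pi_cf w] = 0) ->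
  '[f, ZS_cf] = half_deg%:R * '[f, hf].
Proof.
move=> f1 fSt fR fpi; rewrite dot_ZS_decomposition f1 fSt mulr0 !add0r.
have sR (i : 'I_n) : i != 0%N :> nat ->
    '[f, R (zn ^+ i)] = (- 1 == zn ^+ i)%:R * '[f, hf].
  move=> ni0; have nz1 := zn_neq1 ni0; have [zi2 | nzi2] := eqVneq ((zn ^+ i) ^+ 2) 1.
    by rewrite (half_R (zn_n i) zi2 nz1) [X in X == _](esym (root_pm1 zi2 nz1)) eqxx mul1r.
  by rewrite fR // eq_sym neq_N1 // mul0r.
have sP (i : 'I_m) : i != 0%N :> nat ->
    '[f, pi_cf (zm ^+ i)] = (- 1 == zm ^+ i)%:R * '[f, hf].
  move=> ni0; have nz1 := zm_neq1 ni0; have [zi2 | nzi2] := eqVneq ((zm ^+ i) ^+ 2) 1.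
    by rewrite (half_pi (zm_m i) zi2 nz1) [X in X == _](esym (root_pm1 zi2 nz1)) eqxx mul1r.
  by rewrite fpi // eq_sym neq_N1 // mul0r.
rewrite (eq_bigr _ sR) (eq_bigr _ sP) -!mulr_suml /half_deg.
have [o | e] := ifPn.
  rewrite (sum_prim_root prim_m) ?N1m // big1 => [|i ni0]; first by ring.
  apply/eqP; rewrite pnatr_eq0 eqb0; apply: contra N1_neq1 => /eqP E.
  by have := zn_n i; rewrite -E -signr_odd o expr1 => ->.
rewrite (sum_prim_root prim_n) ?N1n ?(negPf e) // [X in n%:R * (X * _)]big1 => [|i ni0].
  by ring.
apply/eqP; rewrite pnatr_eq0 eqb0; apply: contra N1_neq1 => /eqP E.
by have := zm_m i; rewrite -E -signr_odd /= e expr1 => ->.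
Qed.

(** Norm 2 gives [hf] as a signed sum of two irreducible characters. For each of them, (chi(1) +
    chi(z)) / 2 = half_deg * '[chi, hf] is nonzero. This excludes that z acts as -1, and positivity
    of the degree then makes the sign positive. *)
Lemma half_split : exists i j : Iirr S,
  [/\ i != j, hf = 'chi_i + 'chi_j,
      forall k : Iirr S, k = i \/ k = j -> 'chi_k 1%g = half_deg%:R
    & forall k : Iirr S, k = i \/ k = j -> 'chi_k z = 'chi_k 1%g].
Proof.
have [b [c [i [j [nij Dhf]]]]] := vchar_norm2_signs half_vchar half_norm.
have dotS (k : Iirr S) : '[hf, 'chi_k] = (-1) ^+ b *+ (i == k) + (-1) ^+ c *+ (j == k).
  by rewrite Dhf cfdotDl !cfdotZl !cfdot_irr !mulr_natr.
have hf_k (k : Iirr S) : k = i \/ k = j -> '[hf, 'chi_k] != 0.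
  by rewrite dotS; case=> ->; rewrite eqxx ?(negPf nij) ?[j == i]eq_sym ?(negPf nij)
     mulr1n mulr0n ?addr0 ?add0r signr_eq0.
have ortho (k : Iirr S) (f : 'CF(S)) : k = i \/ k = j ->
    f \in irr S -> '[hf, f] = 0 -> '['chi_k, f] = 0.
  move=> kij irr_f hf0; have [// | nz] := eqVneq '['chi_k, f] 0.
  by have := hf_k k kij; rewrite (irr_dot_neq0 (mem_irr k) irr_f nz) hf0 eqxx.
have dotZ (k : Iirr S) : k = i \/ k = j ->
    '['chi_k, ZS_cf] = half_deg%:R * '['chi_k, hf].
  move=> kij; apply: dot_ZS_half.
  - by apply: ortho; rewrite // -?irr0 ?mem_irr // irr0 half_dot_1.
  - by apply: ortho; rewrite // ?St_irr // half_dot_St.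
  - by move=> w wn w2; apply: ortho; rewrite // ?R_irr // half_dot_R.
  by move=> w wn w2; apply: ortho; rewrite // ?pi_irr // half_dot_pi.
have half_deg_neq0 : half_deg%:R != 0 :> algC.
  by rewrite pnatr_eq0 /half_deg; case: ifP; rewrite -?lt0n.
have chi_z (k : Iirr S) : k = i \/ k = j -> 'chi_k z = 'chi_k 1%g.
  move=> kij; have Zz : z \in 'Z(S)%g by rewrite cenS set22.
  have [// | E] := irr_central_involution k Zz zz.
  have := dotZ k kij; rewrite dot_ZS E addrN mul0r => /esym/eqP.
  by rewrite mulf_eq0 (negPf half_deg_neq0) cfdotC fmorph_eq0 (negPf (hf_k k kij)).
have deg (k : Iirr S) : k = i \/ k = j -> 'chi_k 1%g = half_deg%:R * '['chi_k, hf].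
  move=> kij; rewrite -dotZ // dot_ZS chi_z //; by field.
have sign1 (k : Iirr S) (d : bool) : k = i \/ k = j -> '[hf, 'chi_k] = (-1) ^+ d -> d =
  false.
  move=> kij E; have := irr1_gt0 k; rewrite deg // cfdotC E rmorph_sign.
  by case: (d) => //; rewrite expr1 mulrN1 oppr_gt0 ltrn0.
have b0 : b = false.
  apply: (sign1 i); first by left.
  by rewrite dotS eqxx [j == i]eq_sym (negPf nij) mulr1n mulr0n addr0.
have c0 : c = false.
  apply: (sign1 j); first by right.
  by rewrite dotS eqxx (negPf nij) mulr1n mulr0n add0r.
exists i, j; split=> //; first by rewrite Dhf b0 c0 !expr0 !scale1r.
move=> k kij; rewrite deg // cfdotC dotS b0 c0 expr0.
case: kij => ->; rewrite eqxx ?[j == i]eq_sym (negPf nij) mulr1n mulr0n ?addr0 ?add0r;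
  by rewrite rmorph1 mulr1.
Qed.

(** * The difference of the two half characters *)

Section Difference.

Variables i j : Iirr S.
Hypotheses (nij : i != j) (Dhf : hf = 'chi_i + 'chi_j).
Hypothesis deg_ij : forall k : Iirr S, k = i \/ k = j -> 'chi_k 1%g = half_deg%:R.
Hypothesis ker_ij : forall k : Iirr S, k = i \/ k = j -> 'chi_k z = 'chi_k 1%g.

Let d : 'CF(S) := 'chi_i - 'chi_j.

Let ki : i = i \/ i = j. Proof. by left. Qed.
Let kj : j = i \/ j = j. Proof. by right. Qed.

Let dMz x : d (x * z)%g = d x.
Proof.
have kerz k : k = i \/ k = j -> z \in cfker 'chi_k.
  move=> kij; rewrite cfkerEchar ?irr_char // inE ker_ij // eqxx andbT.
  by rewrite (subsetP (subset_trans sZC sCS)) // set22.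
by rewrite !cfunE !cfkerMr ?kerz.
Qed.

Let d1 : d 1%g = 0.
Proof. by rewrite !cfunE !deg_ij // subrr. Qed.

Let d_Z x : x \in Z -> d x = 0.
Proof. by case/set2P=> ->; rewrite ?d1 // -[z]mul1g dMz d1. Qed.

Let d_irr (f : 'CF(S)) : f \in irr S -> '[hf, f] = 0 -> '[d, f] = 0.
Proof.
case/irrP=> k ->; rewrite Dhf cfdotDl cfdotBl !cfdot_irr.
have [<- | _] := eqVneq i k.
  by rewrite eq_sym (negPf nij) addr0 => /eqP; rewrite oner_eq0.
by rewrite add0r sub0r => ->; rewrite oppr0.
Qed.

Let d_hf : '[d, hf] = 0.
Proof.
rewrite Dhf cfdotBl !cfdotDr !cfdot_irr !eqxx [j == i]eq_sym (negPf nij) mulr0n.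
by rewrite addr0 add0r subrr.
Qed.

Let d_norm : '[d] = 2%:R.
Proof.
rewrite cfdotBl !cfdotBr !cfdot_irr !eqxx [j == i]eq_sym (negPf nij) mulr0n mulr1n; ring.
Qed.

Let d_1 : '[d, 1] = 0.
Proof. by apply: d_irr; rewrite -?irr0 ?mem_irr // irr0 half_dot_1. Qed.

Let d_St : '[d, St_cf] = 0.
Proof. by apply: d_irr; [apply: St_irr | apply: half_dot_St]. Qed.

Let d_R w : w ^+ n = 1 -> '[d, R w] = 0.
Proof.
move=> wn; have [-> | nw1] := eqVneq w 1.
  have -> : R 1 = St_cf + 1 by rewrite /St_cf subrK.
  by rewrite cfdotDr d_St d_1 addr0.
have [w2 | nw2] := eqVneq (w ^+ 2) 1; first by rewrite -(half_R wn w2 nw1) d_hf.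
by apply: d_irr; [apply: R_irr | apply: half_dot_R].
Qed.

Let d_P w : w ^+ m = 1 -> '[d, P w] = '[d, P 1].
Proof.
move=> wm; have [-> // | nw1] := eqVneq w 1.
have : '[d, pi_cf w] = 0.
  have [w2 | nw2] := eqVneq (w ^+ 2) 1; first by rewrite -(half_pi wm w2 nw1) d_hf.
  by apply: d_irr; [apply: pi_irr | apply: half_dot_pi].
rewrite cfdotBr cfdotDr cfdotBr cfdotZr d_R // d_1 mulr0 subrr add0r.
by move/eqP; rewrite subr_eq0 => /eqP.
Qed.

(** By [d_P] these inner products do not depend on w. Their sum over all w is, by orthogonality of
    the [thf], supported on Z, where d vanishes. *)
Let d_P0 w : w ^+ m = 1 -> '[d, P w] = 0.
Proof.
move=> wm; rewrite d_P //; apply/eqP.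
have : m%:R * '[d, P 1] == 0.
  have -> : m%:R * '[d, P 1] = \sum_(k < m) '[d, P (zm ^+ k)^-1].
    rewrite (eq_bigr (fun=> '[d, P 1])) ?sumr_const ?card_ord ?mulr_natl // => k _.
    by rewrite d_P ?rootV.
  under eq_bigr => k _ do rewrite theta_dot ?rootV // invrK.
  rewrite -mulr_sumr exchange_big /= big1 ?mulr0 // => x Cx.
  rewrite -mulr_sumr thf_orth //; have [Zx | _] := boolP (x \in Z); last first.
    by rewrite mulr0n mulr0.
  by rewrite d_Z ?mul0r.
by rewrite mulf_eq0 pnatr_eq0.
Qed.

Let d_sumB w : w ^+ n = 1 -> \sum_(y in B) d y * lamf w y = 0.
Proof.
move=> wn; have := d_R (rootV wn); rewrite lam_dot ?rootV // invrK => /eqP.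
by rewrite mulf_eq0 invr_eq0 (negPf (neq0CG B)) => /eqP.
Qed.

Let d_sumC w : w ^+ m = 1 -> \sum_(y in C) d y * thf w y = 0.
Proof.
move=> wm; have := d_P0 (rootV wm); rewrite theta_dot ?rootV // invrK => /eqP.
by rewrite mulf_eq0 invr_eq0 (negPf (neq0CG C)) => /eqP.
Qed.

Let d_conj x y : y \in S -> d (x ^ y)%g = d x.
Proof. exact: cfunJ. Qed.

(** Fourier inversion on C modulo Z makes d(x) + d(z x) vanish, and d is invariant under z. *)
Let d_C x : x \in C -> d x = 0.
Proof.
move=> Cx; have Sx := subsetP sCS x Cx.
have := @fourier_coset _ C Z m (fun k => thf (zm ^+ k)) d x (ltn0Sn n) sZC
  (fun k => thfM (zm_m k)) (fun y => @thf_orth zm y prim_m) (fun k => d_sumC (zm_m k)) Cx.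
have Cz : z \in C by rewrite (subsetP sZC) ?set22.
rewrite big_setU1 ?inE 1?eq_sym // big_set1 mul1g (centsP abelC z Cz x Cx) dMz.
by move=> /=; move/eqP; rewrite -mulr2n mulrn_eq0 => /eqP.
Qed.

Let B1P x : x \in B -> (forall w, w ^+ n = 1 -> lamf w x = 1) -> x \in B1.
Proof.
move=> Bx lx; have := lamf_orth prim_n Bx; case: (x \in B1) => //.
rewrite (eq_bigr (fun=> 1)) => [|k _]; last exact: lx.
by rewrite sumr_const card_ord mulr0n => /eqP; rewrite pnatr_eq0 eqn0Ngt n_gt0.
Qed.

Let B1_lamf x y w : x \in B -> y \in B1 -> w ^+ n = 1 -> lamf w (y * x)%g = lamf w x.
Proof. by move=> Bx B1y wn; rewrite (lamfM wn (subsetP sB1B y B1y) Bx) lamf_B1 ?mul1r. Qed.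

Let B1M x y : x \in B -> y \in B1 -> (y * x)%g \in B1 -> x \in B1.
Proof. by move=> Bx B1y B1yx; apply: B1P => // w wn;
  rewrite -(B1_lamf Bx B1y) // lamf_B1. Qed.

(** Fourier inversion on B modulo [B1] makes the sum of d over the coset B1 t vanish. Each element
    of that coset is conjugate in B to t or t z, so d is constant on it. *)
Let d_T t : t \in T -> t \notin B1 -> d t = 0.
Proof.
move=> Tt nB1t; have Bt := subsetP sTB t Tt.
have := @fourier_coset _ B B1 n (fun k => lamf (zn ^+ k)) d t n_gt0 sB1B
  (fun k => lamfM (zn_n k)) (fun y => @lamf_orth zn y prim_n) (fun k => d_sumB (zn_n k)) Bt.
rewrite (eq_bigr (fun=> d t)) => [|y B1y].
  rewrite sumr_const card_B1 => /eqP; rewrite mulrn_eq0 muln_eq0 /=.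
  by move/eqP.
have By := subsetP sB1B y B1y; have Byt : (y * t)%g \in B by rewrite groupM.
have nB1yt : (y * t)%g \notin B1 by apply: contra nB1t; apply: B1M.
have [u Bu Tu] := B_conj_T Byt nB1yt; have Su := subsetP sBS u Bu.
rewrite -(d_conj _ Su); set t' := (_ ^ u)%g in Tu *.
(* Conjugation in B and multiplication by [B1] do not change the [lamf], so t and t' have the same
   values and differ by an element of [B1]. *)
have : (t^-1 * t')%g \in T :&: B1.
  rewrite inE groupM ?groupV //=; apply: B1P => [|w wn].
    by rewrite (subsetP sTB) // groupM ?groupV.
  by rewrite lamfM ?groupV ?(subsetP sTB t') // /t' lamfJ // B1_lamf // -lamfM ?groupV
    // mulVg lamf1.
move/(subsetP TB1)=> Ztt'; rewrite -[t'](mulKVg t).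
by case/set2P: Ztt' => ->; rewrite ?mulg1 // dMz.
Qed.

Let d_B x : x \in B -> x \notin B1 -> d x = 0.
Proof.
move=> Bx nB1x; have [u Bu Tu] := B_conj_T Bx nB1x; have Su := subsetP sBS u Bu.
rewrite -(d_conj _ Su) d_T //; by rewrite B1J.
Qed.

Let x0 := d u1.

Let d_X1 x : x \in X1 -> d x = x0.
Proof. by case/X1J=> y Sy [] ->; rewrite ?dMz d_conj. Qed.

(** Fourier inversion at the identity makes d sum to zero over [B1]; d vanishes on Z and is constant
    on X1 and on X2, which have equal size. *)
Let d_X2 x : x \in X2 -> d x = - x0.
Proof.
have d_u2 y : y \in X2 -> d y = d u2 by case/X2J=> g Sg [] ->; rewrite ?dMz d_conj.
have sumB1 : \sum_(y in B1) d y = 0.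
  have := @fourier_coset _ B B1 n (fun k => lamf (zn ^+ k)) d 1%g n_gt0 sB1B
    (fun k => lamfM (zn_n k)) (fun y => @lamf_orth zn y prim_n) (fun k => d_sumB (zn_n
      k)) (group1 B).
  by under eq_bigr => y _ do rewrite mulg1.
move: sumB1; rewrite (big_setID Z) /= (setIidPr sZB1) big1 => [|y /d_Z //].
rewrite add0r X12 (eq_bigl [predU X1 & X2]) => [|y]; last by rewrite !inE.
rewrite bigU //=.
have -> : \sum_(y in X1) d y = x0 *+ #|X1|.
  by rewrite -sumr_const; apply: eq_bigr => y /d_X1.
have -> : \sum_(y in X2) d y = d u2 *+ #|X2|.
  by rewrite -sumr_const; apply: eq_bigr => y /d_u2.
rewrite cX12 -mulrnDl => /eqP.
have X2_gt0 : (0 < #|X2|)%N by apply/card_gt0P; exists u2.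
rewrite mulrn_eq0 eqn0Ngt X2_gt0 addr_eq0 => /eqP E /d_u2 ->.
by rewrite E opprK.
Qed.

Let card_X12 : #|B1 :\: Z| = (4 * n)%N.
Proof.
by have := cardsID Z B1; rewrite (setIidPr sZB1) card_Z card_B1; move: #|_| => k;
  clear; lia.
Qed.

Let d_B1 x : x \in B1 -> x \notin Z -> `|d x| = `|x0|.
Proof.
move=> B1x nZx; have : x \in B1 :\: Z by rewrite inE nZx.
by rewrite X12 => /setUP[/d_X1 | /d_X2] ->; rewrite ?normrN.
Qed.

(** |d|^2 is supported on the conjugates of [B1 :\: Z], where St = R(1) - 1 is zero. So its inner
    product with R(1) equals that with 1, which is '[d] = 2. On B the former is 4 n |x0|^2 / |B|,
    and |B| = 2 n q. *)
Lemma diff_norm : `|x0| ^+ 2 = q.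
Proof.
pose f : 'CF(S) := d * (d^*)%CF.
have fE x : f x = `|d x| ^+ 2 by rewrite !cfunE normCK.
have f0 x : x \in S -> f x * (St_cf x)^* = 0.
  move=> Sx; have [y Sy cov] := conj_cover Sx.
  rewrite -(cfunJ f x Sy) -(cfunJ St_cf x Sy) fE.
  case: cov => [By | Cy]; last by rewrite d_C // normr0 expr0n mul0r.
  have [B1y | nB1y] := boolP ((x ^ y)%g \in B1); last first.
    by rewrite d_B // normr0 expr0n mul0r.
  have [Zy | nZy] := boolP ((x ^ y)%g \in Z).
    by rewrite d_Z // normr0 expr0n mul0r.
  by rewrite !cfunE R_B1 // cfun1E groupJ // subrr rmorph0 mulr0.
have : '[f, R 1] = '[f, 1].
  have -> : R 1 = St_cf + 1 by rewrite /St_cf subrK.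
  by rewrite cfdotDr [X in X + _]cfdotE big1 ?mulr0 ?add0r.
have -> : '[f, 1] = 2%:R.
  rewrite -d_norm [LHS]cfdotE [RHS]cfdotE; congr (_ * _); apply: eq_bigr => x Sx.
  by rewrite fE cfun1E Sx rmorph1 mulr1 normCK.
rewrite lam_dot // invr1 (eq_bigr f) => [|x _]; last by rewrite lamf_one mulr1.
rewrite (big_setID B1) /= (setIidPr sB1B) [X in _ + X]big1 ?addr0 => [|x /setDP[Bx
  nB1x]]; last first.
  by rewrite fE d_B // normr0 expr0n.
rewrite (big_setID Z) /= (setIidPr sZB1) [X in X + _]big1 ?add0r => [|x Zx]; last first.
  by rewrite fE d_Z // normr0 expr0n.
rewrite (eq_bigr (fun=> `|x0| ^+ 2)) => [|x /setDP[B1x nZx]]; last by rewrite fE d_B1.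
rewrite sumr_const card_X12 card_B => E.
have nn0 : n%:R != 0 :> algC by rewrite pnatr_eq0 -lt0n.
have q0 : q != 0 by rewrite pnatr_eq0.
move: E; rewrite -[X in _ * X]mulr_natr !natrM.
move: q q0 (`|x0| ^+ 2) (n%:R : algC) nn0 => q' q0 a nn nn0 E.
have -> : a = q' * ((2%:R * nn * q')^-1 * (a * (4%:R * nn))) / 2%:R by field;
  rewrite nn0 q0.
by rewrite E; field.
Qed.

(** Conjugation is the value at the inverse element, and [u1V] tells which class contains that
    inverse. *)
Lemma diff_conj : x0^* = (-1) ^+ n * x0.
Proof.
have u1S : u1 \in S.
  have : u1 \in B1 :\: Z by rewrite X12 inE X1u.
  by case/setDP=> /(subsetP sB1B)/(subsetP sBS).
have -> : x0^* = d u1^-1%g.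
  by rewrite /x0 !cfunE rmorphB !irr_inv.
have := u1V; rewrite -(signr_odd _ n).
by case: ifP => _ => [/d_X2 | /d_X1] ->; rewrite ?expr1 ?expr0 ?mulN1r ?mul1r.
Qed.

Lemma diff_sqr : x0 ^+ 2 = (-1) ^+ n * q.
Proof.
rewrite -diff_norm normCK diff_conj [x0 * _]mulrCA signrMK.
exact: expr2.
Qed.

Lemma diff_aut (mu : {rmorphism algC -> algC}) :
     [/\ mu x0 = x0, cfAut mu 'chi_i = 'chi_i & cfAut mu 'chi_j = 'chi_j]
  \/ [/\ mu x0 = - x0, cfAut mu 'chi_i = 'chi_j & cfAut mu 'chi_j = 'chi_i].
Proof.
have := half_aut mu; rewrite Dhf rmorphD /= => E.
have mux0 : mu x0 = (cfAut mu 'chi_i) u1 - (cfAut mu 'chi_j) u1.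
  by rewrite /x0 !cfunE rmorphB.
have : '['chi_(aut_Iirr mu i), 'chi_i + 'chi_j] != 0.
  rewrite -E -!aut_IirrE cfdotDr !cfdot_irr eqxx (inj_eq (aut_Iirr_inj mu)) (negPf nij).
  by rewrite addr0 oner_neq0.
rewrite aut_IirrE in E *; rewrite -{1}aut_IirrE cfdotDr !cfdot_irr.
have [Di _ | _] := eqVneq (aut_Iirr mu i) i; [left | ].
  have Ei : cfAut mu 'chi_i = 'chi_i by rewrite -aut_IirrE Di.
  have Ej : cfAut mu 'chi_j = 'chi_j by apply: (addrI 'chi_i); rewrite -{1}Ei.
  by split=> //; rewrite mux0 Ei Ej /x0 !cfunE.
have [Di _ | _] := eqVneq (aut_Iirr mu i) j; [right | by rewrite addr0 eqxx].
have Ei : cfAut mu 'chi_i = 'chi_j by rewrite -aut_IirrE Di.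
have Ej : cfAut mu 'chi_j = 'chi_i by apply: (addrI 'chi_j); rewrite -{1}Ei E addrC.
by split=> //; rewrite mux0 Ei Ej /x0 !cfunE opprB.
Qed.

(** Fixing x0 <> 0 prevents an automorphism from exchanging the halves. As d is orthogonal to every
    R and P, each half has half the multiplicity that [hf] has: that is 2 for the trivial character
    of C when n is odd, and 2 for [lamf (-1)] on B when n is even. *)
Lemma diff_realizable z0 k : k = i \/ k = j ->
    (forall mu : {rmorphism algC -> algC}, mu z0 = z0 -> mu x0 = x0) ->
  realizable 'chi_k z0.
Proof.
move=> kij mu_x0; have x0_neq0 : x0 != 0.
  by rewrite -normr_eq0 -[_ == 0](expf_eq0 _ 2) diff_norm pnatr_eq0.
have k_aut (mu : {rmorphism algC -> algC}) : mu z0 = z0 -> cfAut mu 'chi_k = 'chi_k.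
  move/mu_x0=> mux; have [[_ Ei Ej] | [E _ _]] := diff_aut mu.
    by case: kij => ->.
  have : x0 *+ 2 == 0 by rewrite mulr2n -{2}mux E subrr.
  by rewrite mulrn_eq0 (negPf x0_neq0).
have dk (f : 'CF(S)) : '[d, f] = 0 -> '['chi_k, f] = '[hf, f] / 2%:R.
  rewrite cfdotBl => /eqP; rewrite subr_eq0 => /eqP E.
  by rewrite Dhf cfdotDl E; case: kij => ->; rewrite ?E; move: '[_, f] => a; field.
have [o | e] := boolP (odd n).
  apply: (@realizable_lin _ _ C sCS _ _ (mem_irr k) k_aut (thf 1)).
  - exact: thfM.
  - exact: thf1.
  - by move=> mu _ h; rewrite thf_one rmorph1.
  rewrite theta_trace // dk ?d_P0 // /half_cf o pi_dot_P ?N1m //.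
  by rewrite invN1 (negPf N1_neq1) !subr0 divff // pnatr_eq0.
have e' := negPf e.
apply: (@realizable_lin _ _ B sBS _ _ (mem_irr k) k_aut (lamf (-1))).
- by apply: lamfM; apply: N1n.
- by apply: lamf1; apply: N1n.
- by move=> mu _ h; rewrite lamf_aut rmorphN1.
rewrite lam_trace ?N1n // dk ?d_R ?N1n // /half_cf e' R_dot_R ?N1n //.
by rewrite invN1 eqxx -mulr2n mulr1n divff // pnatr_eq0.
Qed.

Lemma irr_classification (chi : 'CF(S)) : chi \in irr S -> Z \subset cfker chi ->
  [\/ chi = 1, chi = St_cf,
      exists w, [/\ w ^+ n = 1, w ^+ 2 != 1 & chi = R w]
    | exists w, [/\ w ^+ m = 1, w ^+ 2 != 1 & chi = pi_cf w]]
  \/ exists2 k : Iirr S, k = i \/ k = j & chi = 'chi_k.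
Proof.
move=> irr_chi kerZ.
have in_hf : '[chi, hf] != 0 -> exists2 k : Iirr S, k = i \/ k = j & chi = 'chi_k.
  case/irrP: irr_chi => k ->; rewrite Dhf cfdotDr !cfdot_irr => nz.
  exists k => //; move: nz; have [-> _ | _] := eqVneq k i; first by left.
  by have [-> _ | _] := eqVneq k j; [right | rewrite addr0 eqxx].
have [-> | -> | [w [wn nw1 nz]] | [w [wm nw1 nz]]] := irr_cases irr_chi kerZ.
- by left; constructor 1.
- by left; constructor 2.
- have [w2 | nw2] := eqVneq (w ^+ 2) 1.
    by right; apply: in_hf; rewrite (half_R wn w2 nw1).
  left; constructor 3; exists w; split=> //.
  by apply: irr_dot_neq0 nz => //; apply: R_irr.
have [w2 | nw2] := eqVneq (w ^+ 2) 1.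
  by right; apply: in_hf; rewrite (half_pi wm w2 nw1).
left; constructor 4; exists w; split=> //.
by apply: irr_dot_neq0 nz => //; apply: pi_irr.
Qed.

Let ker_Z (chi : 'CF(S)) : chi \in irr S -> chi z = chi 1%g -> Z \subset cfker chi.
Proof.
move=> irr_chi E; apply/subsetP=> x; rewrite cfkerEchar ?irrWchar // => /set2P[] ->.
  by rewrite inE group1 eqxx.
by rewrite inE E eqxx (subsetP (subset_trans sZC sCS)) // set22.
Qed.

(** * Representatives of the Galois orbits *)

Section Families.

Variable zeta : nat -> algC.
Hypothesis zeta_prim : forall k, (0 < k)%N -> k.-primitive_root (zeta k).

Variables (H : finType) (hc : H -> Iirr S) (hz : algC).
Hypothesis hc_ij : forall h, hc h = i \/ hc h = j.
Hypothesis hz_x0 : forall mu : {rmorphism algC -> algC}, mu hz = hz -> mu x0 = x0.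
Hypothesis hc_aut : forall h (nu mu : {rmorphism algC -> algC}),
  cfAut nu 'chi_(hc h) = cfAut mu 'chi_(hc h) -> nu hz = mu hz.
Hypothesis hc_cover : forall k : Iirr S, k = i \/ k = j ->
  exists h, exists nu : {rmorphism algC -> algC}, 'chi_k = cfAut nu 'chi_(hc h).
Hypothesis hc_inj : forall h h' (nu mu : {rmorphism algC -> algC}),
  cfAut nu 'chi_(hc h) = cfAut mu 'chi_(hc h') -> h = h'.

Local Notation dvs k := {c | c \in divisors_gt2 k}.
Local Notation I := ((unit + H) + (dvs m + (unit + dvs n)))%type.

(** H indexes the orbits of the half characters: one orbit if an automorphism exchanges them, two if
    both are rational. The other indices are the orders of the parameters w. *)
Definition fam_cf (x : I) : 'CF(S) :=
  match x with
  | inl (inl _) => 1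
  | inl (inr h) => 'chi_(hc h)
  | inr (inl c) => pi_cf (zeta (val (val c)))
  | inr (inr (inl _)) => St_cf
  | inr (inr (inr c)) => R (zeta (val (val c)))
  end.

Definition fam_gen (x : I) : algC :=
  match x with
  | inl (inl _) => 0
  | inl (inr _) => hz
  | inr (inl c) => zeta (val (val c)) + (zeta (val (val c)))^-1
  | inr (inr (inl _)) => 0
  | inr (inr (inr c)) => zeta (val (val c)) + (zeta (val (val c)))^-1
  end.

Definition fam_deg (x : I) : nat :=
  match x with
  | inl (inl _) => 1
  | inl (inr _) => half_deg
  | inr (inl _) => 2 * n
  | inr (inr (inl _)) => (2 * n).+1
  | inr (inr (inr _)) => (2 * n).+2
  end.

Let dvsP k (c : dvs k) : (2 < val (val c))%N /\ (val (val c) %| k)%N.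
Proof. by case: c => c /=; rewrite inE => /andP[/andP[-> _] ->]. Qed.

Let zeta_k k (c : dvs k) : zeta (val (val c)) ^+ k = 1.
Proof.
have [d2 dk] := dvsP c; apply/eqP; rewrite -(prim_order_dvd (zeta_prim _)) //.
by apply: leq_trans d2.
Qed.

Let zeta_2 k (c : dvs k) : zeta (val (val c)) ^+ 2 != 1.
Proof.
have [d2 dk] := dvsP c; have d_gt0 : (0 < val (val c))%N by apply: leq_trans d2.
by rewrite -(prim_order_dvd (zeta_prim d_gt0)) gtnNdvd.
Qed.

Let zeta_1 k (c : dvs k) : zeta (val (val c)) != 1.
Proof. by apply: contraNneq (zeta_2 c) => ->; rewrite expr1n. Qed.

Let zeta_cover k w : (0 < k)%N -> w ^+ k = 1 -> w ^+ 2 != 1 ->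
  exists c : dvs k, exists nu : {rmorphism algC -> algC}, w = nu (zeta (val (val c))).
Proof.
move=> k_gt0 wk nw2; have [c prim_w d_k] := prim_order_exists k_gt0 wk.
have d_gt0 : (0 < c)%N := dvdn_gt0 k_gt0 d_k.
have ltdk : (c < k.+1)%N by rewrite ltnS dvdn_leq.
have d_gt2 : (2 < c)%N.
  rewrite ltnNge; apply: contra nw2 => d_le2; rewrite -(prim_order_dvd prim_w).
  by case: c d_gt0 d_le2 {prim_w d_k ltdk} => [|[|[]]].
have Dd : Ordinal ltdk \in divisors_gt2 k by rewrite inE /= d_gt2 dvdn_leq.
have [nu nuE] := prim_root_aut_exists (zeta_prim d_gt0) prim_w.
by exists (exist (fun c => is_true (c \in divisors_gt2 k)) _ Dd), nu; rewrite /= nuE.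
Qed.

(** Automorphisms and inversion preserve the order of a root of unity, and that order is the
    index. *)
Let zeta_inj k (c c' : dvs k) (nu mu : {rmorphism algC -> algC}) :
    mu (zeta (val (val c'))) = nu (zeta (val (val c)))
    \/ mu (zeta (val (val c'))) = (nu (zeta (val (val c))))^-1 ->
  c = c'.
Proof.
have d_gt0 (e : dvs k) : (0 < val (val e))%N by have [e2 _] := dvsP e; apply: leq_trans e2.
have prim (e : dvs k) (la : {rmorphism algC -> algC}) :
    (val (val e)).-primitive_root (la (zeta (val (val e)))).
  by rewrite fmorph_primitive_root zeta_prim.
have order_eq a b (w u : algC) : a.-primitive_root w -> b.-primitive_root u ->
    u = w \/ u = w^-1 -> a = b :> nat.
  move=> pa pb E; apply/eqP; rewrite eqn_dvd.
  rewrite (prim_order_dvd pa) (prim_order_dvd pb).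
  have -> : w ^+ b = 1.
    have := prim_expr_order pb; case: E => -> //; rewrite exprVn => /eqP.
    by rewrite invr_eq1 => /eqP.
  by case: E => ->; rewrite ?exprVn (prim_expr_order pa) ?invr1 eqxx.
by move=> E; apply/val_inj/val_inj; apply: order_eq (prim c nu) (prim c' mu) E.
Qed.

Lemma fam_irr (x : I) : fam_cf x \in irr S.
Proof.
case: x => [[_ | h] | [c | [_ | c]]] /=; rewrite ?mem_irr //.
- by rewrite -irr0 mem_irr.
- by apply: pi_irr; [apply: zeta_k | apply: zeta_2].
- exact: St_irr.
by apply: R_irr; [apply: zeta_k | apply: zeta_2].
Qed.

Lemma fam_one (x : I) : fam_cf x 1%g = (fam_deg x)%:R.
Proof.
case: x => [[_ | h] | [c | [_ | c]]] /=.
- by rewrite cfun11.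
- exact: deg_ij.
- by rewrite pi_one ?zeta_k // -natr1 addrK.
- exact: St_one.
by rewrite R_one ?zeta_k // natr1.
Qed.

Lemma fam_ker (x : I) : Z \subset cfker (fam_cf x).
Proof.
apply: (ker_Z (fam_irr x)).
have [Z1 Zz] : 1%g \in Z /\ z \in Z by rewrite set21 set22.
case: x => [[_ | h] | [c | [_ | c]]] /=.
- by rewrite !cf1_Z.
- exact: ker_ij.
- by rewrite !pi_Z ?zeta_k.
- by rewrite !St_Z.
by rewrite !R_Z ?zeta_k.
Qed.

Lemma fam_realizable (x : I) : realizable (fam_cf x) (fam_gen x).
Proof.
case: x => [[_ | h] | [c | [_ | c]]] /=.
- apply: (@realizable_lin _ _ S (subxx S) 1 0 _ _ (fun=> 1)) => //.
  + by rewrite -irr0 mem_irr.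
  + by move=> nu _; rewrite rmorph1.
  + by move=> x y _ _; rewrite mulr1.
  + by move=> nu _ _; rewrite rmorph1.
  rewrite (eq_bigr (fun=> 1)) => [|x Sx]; last by rewrite cfun1E Sx mulr1.
  by rewrite sumr_const mulVf ?neq0CG.
- by apply: diff_realizable.
- by apply: pi_realizable; [apply: zeta_k | apply: zeta_2].
- exact: St_realizable.
by apply: R_realizable; [apply: zeta_k | apply: zeta_2].
Qed.

Lemma fam_aut (x : I) (nu mu : {rmorphism algC -> algC}) :
  cfAut nu (fam_cf x) = cfAut mu (fam_cf x) -> nu (fam_gen x) = mu (fam_gen x).
Proof.
have sumV (w : algC) : mu w = nu w \/ mu w = (nu w)^-1 -> nu (w + w^-1) = mu (w + w^-1).
  by rewrite !rmorphD !fmorphV => -[] ->; rewrite // invrK addrC.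
have rk k (c : dvs k) (la : {rmorphism algC -> algC}) : la (zeta (val (val c))) ^+ k = 1.
  by rewrite -rmorphXn zeta_k rmorph1.
case: x => [[_ | h] | [c | [_ | c]]] /=; rewrite ?rmorph0 //.
- exact: hc_aut.
- rewrite !pi_aut ?zeta_k // => /pi_inj E; apply: sumV.
  by apply: E; rewrite ?rk // fmorph_eq1 zeta_1.
rewrite !R_aut ?zeta_k // => /R_inj E; apply: sumV.
by apply: E; rewrite rk.
Qed.

Lemma fam_cover (chi : 'CF(S)) : chi \in irr S -> Z \subset cfker chi ->
  exists x : I, exists nu : {rmorphism algC -> algC}, chi = cfAut nu (fam_cf x).
Proof.
move=> irr_chi kerZ.
have [[-> | -> | [w [wn nw2 ->]] | [w [wm nw2 ->]]] | [k kij ->]] := irr_classification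
  irr_chi kerZ.
- by exists (inl (inl tt)), idfun; rewrite rmorph1.
- by exists (inr (inr (inl tt))), idfun; rewrite /= St_aut.
- have [c [nu ->]] := zeta_cover n_gt0 wn nw2.
  by exists (inr (inr (inr c))), nu; rewrite /= R_aut ?zeta_k.
- have [c [nu ->]] := zeta_cover (ltn0Sn n) wm nw2.
  by exists (inr (inl c)), nu; rewrite /= pi_aut ?zeta_k.
have [h [nu ->]] := hc_cover kij.
by exists (inl (inr h)), nu.
Qed.

(** Conjugation preserves degrees, and degrees separate the families, except for the trivial
    character and the half characters when n = 1; [n1] covers that exception by orthogonality to
    1. *)
Lemma fam_inj (x y : I) (nu mu : {rmorphism algC -> algC}) :
  cfAut nu (fam_cf x) = cfAut mu (fam_cf y) -> x = y.
Proof.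
move=> E; have eq_deg : fam_deg x = fam_deg y.
  apply/eqP; rewrite -(eqr_nat algC) -!fam_one.
  have -> : fam_cf x 1%g = cfAut nu (fam_cf x) 1%g.
    by rewrite cfunE fam_one rmorph_nat.
  by rewrite E cfunE fam_one rmorph_nat.
have n1 k (la la' : {rmorphism algC -> algC}) : k = i \/ k = j ->
    cfAut la 'chi_k = cfAut la' 1 -> False.
  move=> kij /eqP; rewrite rmorph1 cfAut_eq1 => /eqP k1.
  have /eqP := half_dot_1; rewrite Dhf cfdotDl -k1 !cfdot_irr.
  by case: kij => ->; rewrite eqxx ?(negPf nij) ?[j == i]eq_sym ?(negPf nij)
    ?addr0 ?add0r oner_eq0.
have := half_deg_neq n_gt0; rewrite -/half_deg; move: E eq_deg; rewrite /fam_deg.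
move: half_deg => hd.
case: x => [[[] | h] | [c | [[] | c]]]; case: y => [[[] | h'] | [c' | [[] | c']]] //=;
  try by move=> _; move: n_gt0; clear; lia.
- by move/esym/(n1 _ _ _ (hc_ij h')).
- by move/(n1 _ _ _ (hc_ij h)).
- by move/hc_inj=> ->.
- rewrite !pi_aut ?zeta_k // => /pi_inj E _ _; congr (inr (inl _)).
  apply: (zeta_inj (nu := nu) (mu := mu)); apply: E; rewrite ?fmorph_eq1 ?zeta_1 //.
    by rewrite -rmorphXn zeta_k rmorph1.
  by rewrite -rmorphXn zeta_k rmorph1.
rewrite !R_aut ?zeta_k // => /R_inj E _ _; congr (inr (inr (inr _))).
by apply: (zeta_inj (nu := nu) (mu := mu)); apply: E; rewrite -rmorphXn zeta_k rmorph1.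
Qed.

Lemma fam_wedderburn : wedderburn_family (S / 'Z(S))%G fam_gen fam_deg.
Proof.
apply: (@rational_wedderburn_quotient _ S 'Z(S)%G I fam_cf).
- exact: center_normal.
- exact: fam_irr.
- by move=> x /=; rewrite cenS fam_ker.
- exact: fam_realizable.
- exact: fam_one.
- exact: fam_aut.
- by move=> chi irr_chi; rewrite /= cenS; apply: fam_cover.
exact: fam_inj.
Qed.

End Families.

End Difference.

Variable zeta : nat -> algC.
Hypothesis zeta_prim : forall k, (0 < k)%N -> k.-primitive_root (zeta k).

Let chi_neq (i j : Iirr S) : i != j -> 'chi_i = 'chi_j -> False.
Proof. by move/eqP=> nij /irr_inj. Qed.

(** s is x0 or -x0, so an automorphism moving s exchanges the halves: they form one orbit, with
    field Q(s). *)
Lemma wedderburn_irrational (s : algC) : s ^+ 2 = (-1) ^+ n * q ->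
    (exists mu : {rmorphism algC -> algC}, mu s != s) ->
  wedderburn_family (S / 'Z(S))%G (@fam_gen zeta unit s) (@fam_deg unit).
Proof.
move=> s2 [mu1 mu1s]; have [i [j [nij Dhf deg_ij ker_ij]]] := half_split.
have := diff_sqr nij Dhf deg_ij ker_ij; have := diff_aut nij Dhf.
set x0 := (X in X ^+ 2) => x0_aut x0_2.
have Ds : s = x0 \/ s = - x0.
  by move/eqP: s2; rewrite -x0_2 eqf_sqr => /orP[] /eqP; [left | right].
have nu_eq (nu mu : {rmorphism algC -> algC}) : nu s = mu s <-> nu x0 = mu x0.
  by case: Ds => ->; rewrite ?rmorphN //; split=> [/oppr_inj | ->].
apply: (fam_wedderburn nij Dhf deg_ij ker_ij zeta_prim (hc := fun=> i)).
- by left.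
- by move=> mu mus; apply: (nu_eq mu idfun).1.
- move=> _ nu mu E; apply: (nu_eq nu mu).2; move: E.
  case: (x0_aut nu) => -[-> -> _]; case: (x0_aut mu) => -[-> -> _] //.
    by move/(chi_neq nij).
  by move/esym/(chi_neq nij).
- move=> k [] ->; exists tt.
    by exists idfun; apply/cfun_inP=> x Sx; rewrite cfunE.
  exists mu1; case: (x0_aut mu1) => -[] // E; case/eqP: mu1s.
  exact: (nu_eq mu1 idfun).2.
by case; case.
Qed.

(** x0 is rational up to the sign of r, hence no automorphism exchanges the halves: they form two
    orbits, each with field Q(0) = Q. *)
Lemma wedderburn_rational (r : rat) : ratr r ^+ 2 = (-1) ^+ n * q ->
  wedderburn_family (S / 'Z(S))%G (@fam_gen zeta bool 0) (@fam_deg bool).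
Proof.
move=> r2; have [i [j [nij Dhf deg_ij ker_ij]]] := half_split.
have := diff_norm nij Dhf deg_ij ker_ij.
have := diff_sqr nij Dhf deg_ij ker_ij; have := diff_aut nij Dhf.
set x0 := (X in X ^+ 2) => x0_aut x0_2 x0_norm.
have mu_x0 (mu : {rmorphism algC -> algC}) : mu x0 = x0.
  move/eqP: r2; rewrite -x0_2 eqf_sqr => /orP[] /eqP Er.
    by rewrite -Er fmorph_rat.
  by rewrite -[x0]opprK -Er !rmorphN fmorph_rat.
have x0_neq0 : x0 != 0.
  by rewrite -normr_eq0 -[_ == 0](expf_eq0 _ 2) x0_norm pnatr_eq0.
have mu_chi (mu : {rmorphism algC -> algC}) :
    cfAut mu 'chi_i = 'chi_i /\ cfAut mu 'chi_j = 'chi_j.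
  case: (x0_aut mu) => -[] // E;
    have : x0 *+ 2 == 0 by rewrite mulr2n -{2}(mu_x0 mu) E subrr.
  by rewrite mulrn_eq0 (negPf x0_neq0).
have hcE (b : bool) mu : cfAut mu 'chi_(if b then i else j) = 'chi_(if b then i else j).
  by case: b; case: (mu_chi mu).
apply: (fam_wedderburn nij Dhf deg_ij ker_ij zeta_prim (hc := fun b : bool => if b then
  i else j)).
- by case; [left | right].
- by move=> mu _.
- by move=> _ nu mu _; rewrite !rmorph0.
- move=> k [] ->.
    by exists true, idfun; apply/esym/(hcE true).
  by exists false, idfun; apply/esym/(hcE false).
move=> b c nu mu /=; rewrite !hcE; case: b; case: c => //.
  by move/(chi_neq nij).
by move/esym/(chi_neq nij).
Qed.

Lemma wedderburn_cases :
  (forall s, s ^+ 2 = (-1) ^+ n * q ->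
     (exists mu : {rmorphism algC -> algC}, mu s != s) ->
   wedderburn_family (S / 'Z(S))%G (@fam_gen zeta unit s) (@fam_deg unit))
  /\ (forall r : rat, ratr r ^+ 2 = (-1) ^+ n * q ->
   wedderburn_family (S / 'Z(S))%G (@fam_gen zeta bool 0) (@fam_deg bool)).
Proof. by split; [exact: wedderburn_irrational | exact: wedderburn_rational]. Qed.

End HalfCharacters.

End AbstractSL2.

(** * Linear characters of cyclic groups *)

Section CyclicLinear.

Variables (gT : finGroupType) (c : gT).

(** Discrete logarithm to the base c. Its default 0 outside the cycle lets [cyc_lin] be
    multiplicative in w and commute with automorphisms at every h. *)
Definition cyc_log (h : gT) : nat :=
  odflt 0 (omap val [pick i : 'I_(#[c]%g) | (c ^+ i)%g == h]).

(* The linear character of <[c]> with value w at c, when w ^+ #[c]%g = 1. *)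
Definition cyc_lin (w : algC) (h : gT) : algC := w ^+ cyc_log h.

Lemma cyc_logK h : h \in <[c]>%g -> (c ^+ cyc_log h)%g = h.
Proof.
case/cycleP=> i ->; rewrite /cyc_log; case: pickP => [j /eqP // | noj].
by have := noj (Ordinal (ltn_pmod i (order_gt0 c))); rewrite /= expg_mod_order eqxx.
Qed.

Lemma cyc_linX w i : w ^+ #[c]%g = 1 -> cyc_lin w (c ^+ i) = w ^+ i.
Proof.
move=> wc; rewrite /cyc_lin -[RHS](expr_mod _ wc) -(expr_mod (cyc_log _) wc).
congr (_ ^+ _); apply/eqP; rewrite -eq_expg_mod_order cyc_logK //.
exact: mem_cycle.
Qed.

Lemma cyc_linM w : w ^+ #[c]%g = 1 ->
  {in <[c]>%g &, {morph cyc_lin w : x y / (x * y)%g >-> x * y}}.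
Proof.
move=> wc _ _ /cycleP[i ->] /cycleP[j ->].
by rewrite -expgnDr !cyc_linX // exprD.
Qed.

Lemma cyc_lin1 w : w ^+ #[c]%g = 1 -> cyc_lin w 1%g = 1.
Proof. by move=> wc; rewrite -[1%g](expg0 c) cyc_linX ?expr0. Qed.

Lemma cyc_lin_one h : cyc_lin 1 h = 1.
Proof. exact: expr1n. Qed.

Lemma cyc_lin_mul w1 w2 h : cyc_lin (w1 * w2) h = cyc_lin w1 h * cyc_lin w2 h.
Proof. exact: exprMn. Qed.

Lemma cyc_lin_aut (nu : {rmorphism algC -> algC}) w h :
  nu (cyc_lin w h) = cyc_lin (nu w) h.
Proof. exact: rmorphXn. Qed.

Section Involution.

Variables (m : nat) (z : gT).
Hypotheses (oc : #[c]%g = (2 * m)%N) (cz : z \in <[c]>%g) (oz : #[z]%g = 2%N).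

Let m_gt0 : (0 < m)%N.
Proof. by have := order_gt0 c; rewrite oc; case: (m). Qed.

(** 2 m divides twice the exponent of z, so z is c^(k m); only the parity of k matters, and even k
    would give the identity. *)
Lemma cycle_involution : z = (c ^+ m)%g.
Proof.
have /cycleP[i Dz] := cz; have z2 := expg_order z; rewrite oz in z2.
have : (#[c]%g %| i * 2)%N by rewrite order_dvdn expgM -Dz z2.
rewrite oc mulnC dvdn_pmul2r // => /dvdnP[k Dk].
have c2m : (c ^+ m ^+ 2)%g = 1%g by rewrite -expgM mulnC -oc expg_order.
move: oz; rewrite {}Dz {}Dk mulnC expgM -(odd_double_half k) expgnDr.
rewrite -muln2 [(_ * 2)%N]mulnC [X in (_ * X)%g]expgM c2m expg1n mulg1.
by case: (odd k); rewrite ?expg1 // expg0 order1.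
Qed.

Lemma cyc_lin_involution w : w ^+ m = 1 -> cyc_lin w z = 1.
Proof.
by move=> wm; rewrite cycle_involution cyc_linX // oc mulnC exprM wm expr1n.
Qed.

(** At h = c^j this is a geometric sum of ratio w^j, nonzero only if m divides j, and then h is 1 or
    z = c^m. *)
Lemma sum_cyc_lin w h : m.-primitive_root w -> h \in <[c]>%g ->
  \sum_(i < m) cyc_lin (w ^+ i) h = m%:R *+ (h \in [set 1%g; z]).
Proof.
move=> prim_w /cycleP[j ->].
have -> : (c ^+ j \in [set 1; z])%g = (m %| j)%N.
  rewrite cycle_involution !inE -order_dvdn -[X in _ || X]/(_ == _).
  rewrite eq_expg_mod_order oc.
  apply/orP/idP=> [[/(dvdn_trans (dvdn_mull 2 (dvdnn m))) // | /eqP ejm]|].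
    rewrite (divn_eq j (2 * m)) ejm dvdn_addr ?dvdn_mull //.
    by rewrite -(dvdn_addr _ (dvdn_mull (m %/ (2 * m)) (dvdn_mull 2 (dvdnn m)))) -divn_eq.
  case/dvdnP=> k ->; rewrite -(odd_double_half k) -muln2 mulnDl -mulnA.
  case: (odd k); first by right; rewrite mul1n addnC modnMDl.
  by left; rewrite mul0n add0n dvdn_mull.
rewrite (eq_bigr (fun i : 'I_m => w ^+ j ^+ i)) => [|i _]; last first.
  rewrite cyc_linX; first exact: exprAC.
  by rewrite oc mulnC exprM [_ ^+ i ^+ m]exprAC (prim_expr_order prim_w) !expr1n.
rewrite (prim_order_dvd prim_w); have [-> | nw1] := eqVneq (w ^+ j) 1.
  by rewrite (eq_bigr (fun=> 1)) ?sumr_const ?card_ord // => i _; rewrite expr1n.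
apply/eqP; have /eqP := subrX1 (w ^+ j) m.
rewrite [w ^+ j ^+ m]exprAC (prim_expr_order prim_w) expr1n subrr eq_sym mulf_eq0.
by rewrite subr_eq0 (negPf nw1).
Qed.

End Involution.

End CyclicLinear.

(** * Subgroups of SL_2 *)

Section SL2Matrices.

Variable F : finFieldType.
Implicit Types (a b c d : F) (x y : {'GL_2[F]}).

Local Notation S := (SL2 F).

Definition mx2 a b c d : 'M[F]_2 :=
  \matrix_(i, j) if i == 0 then (if j == 0 then a else b)
                 else (if j == 0 then c else d).

(** The identity is the junk value for a singular matrix. *)
Definition sl2 a b c d : {'GL_2[F]} := insubd (1%g : {'GL_2[F]}) (mx2 a b c d).

Definition e11 x : F := GLval x 0 0.
Definition e12 x : F := GLval x 0 1.
Definition e21 x : F := GLval x 1 0.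
Definition e22 x : F := GLval x 1 1.

Lemma mx2P (M N : 'M[F]_2) :
  M 0 0 = N 0 0 -> M 0 1 = N 0 1 -> M 1 0 = N 1 0 -> M 1 1 = N 1 1 -> M = N.
Proof.
move=> M00 M01 M10 M11; apply/matrixP=> i j.
have I2 (k : 'I_2) : k = 0 \/ k = 1.
  by case: k => [[|[|//]] ?]; [left | right]; apply: val_inj.
by case: (I2 i) => ->; case: (I2 j) => ->.
Qed.

Lemma det_mx2E (M : 'M[F]_2) : \det M = M 0 0 * M 1 1 - M 0 1 * M 1 0.
Proof.
rewrite (expand_det_row _ 0) !big_ord_recl big_ord0 addr0 /cofactor.
rewrite !det_mx11 !mxE expr0 mul1r expr1 mulN1r mulrN.
by congr (_ * M _ _ - M _ _ * M _ _); apply: val_inj.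
Qed.

Lemma sl2_val a b c d : a * d - b * c = 1 -> GLval (sl2 a b c d) = mx2 a b c d.
Proof.
move=> det1; rewrite -[LHS]/(val (sl2 a b c d)) val_insubd.
by rewrite -[_ \is a _]/(_ \in unitmx) unitmxE det_mx2E !mxE /= det1 unitr1.
Qed.

Lemma sl2E a b c d : a * d - b * c = 1 ->
  (e11 (sl2 a b c d) = a) * (e12 (sl2 a b c d) = b)
  * (e21 (sl2 a b c d) = c) * (e22 (sl2 a b c d) = d).
Proof. by move=> det1; rewrite /e11 /e12 /e21 /e22 sl2_val // !mxE. Qed.

Lemma sl2_in a b c d : a * d - b * c = 1 -> sl2 a b c d \in S.
Proof. by move=> det1; rewrite inE sl2_val // det_mx2E !mxE /= det1. Qed.

Lemma SL2_det x : x \in S -> e11 x * e22 x - e12 x * e21 x = 1.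
Proof. by rewrite inE det_mx2E => /eqP. Qed.

Lemma SL2_eqP x y : e11 x = e11 y -> e12 x = e12 y -> e21 x = e21 y ->
  e22 x = e22 y -> x = y.
Proof. by move=> ? ? ? ?; apply: val_inj; apply: mx2P. Qed.

Lemma SL2_sl2 x : x \in S -> x = sl2 (e11 x) (e12 x) (e21 x) (e22 x).
Proof. by move/SL2_det=> d1; apply: SL2_eqP; rewrite sl2E. Qed.

Lemma SL2_mulE x y :
  (e11 (x * y)%g = e11 x * e11 y + e12 x * e21 y)
  * (e12 (x * y)%g = e11 x * e12 y + e12 x * e22 y)
  * (e21 (x * y)%g = e21 x * e11 y + e22 x * e21 y)
  * (e22 (x * y)%g = e21 x * e12 y + e22 x * e22 y).
Proof.
rewrite /e11 /e12 /e21 /e22 !GL_ME !mxE !big_ord_recl !big_ord0 !addr0.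
suff -> : lift ord0 ord0 = 1 :> 'I_2 by [].
exact: val_inj.
Qed.

Lemma SL2_oneE : (e11 1%g = 1) * (e12 1%g = 0) * (e21 1%g = 0) * (e22 1%g = 1).
Proof. by rewrite /e11 /e12 /e21 /e22 GL_1E !mxE. Qed.

Lemma SL2_invE x : x \in S ->
  (e11 x^-1%g = e22 x) * (e12 x^-1%g = - e12 x)
  * (e21 x^-1%g = - e21 x) * (e22 x^-1%g = e11 x).
Proof.
move=> Sx; have d1 := SL2_det Sx.
have d1' : e22 x * e11 x - - e12 x * - e21 x = 1 by rewrite -d1; ring.
suff -> : x^-1%g = sl2 (e22 x) (- e12 x) (- e21 x) (e11 x) by rewrite !sl2E.
apply/eqP; rewrite eq_invg_mul; apply/eqP.
apply: SL2_eqP; rewrite SL2_mulE SL2_oneE !sl2E //; try (by rewrite -d1; ring).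
  by ring.
by ring.
Qed.

Lemma SL2_trace_conj x y : x \in S -> y \in S ->
  e11 (x ^ y)%g + e22 (x ^ y)%g = e11 x + e22 x.
Proof.
move=> Sx Sy; have dy := SL2_det Sy.
rewrite conjgE !SL2_mulE !SL2_invE // -[RHS]mulr1 -dy; ring.
Qed.


Local Notation q := #|F|.

Lemma card_nonzero : #|[set a : F | a != 0]| = q.-1.
Proof. by have := cardsC1 (0 : F); rewrite (eq_card (B := [set a | a != 0])) // => a;
  rewrite !inE. Qed.

(** The fibre of the determinant over a is the coset of SL_2 through diag(a, 1), so |GL_2| = (q - 1)
    |SL_2|. *)
Lemma card_SL2 : #|S| = (q * (q.-1 * q.+1))%N.
Proof.
pose D a : {'GL_2[F]} := insubd (1%g : {'GL_2[F]}) (mx2 a 0 0 1).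
have DE a : a != 0 -> \det (D a) = a.
  move=> nza; have -> : GLval (D a) = mx2 a 0 0 1.
    rewrite -[LHS]/(val (D a)) val_insubd.
    by rewrite -[_ \is a _]/(_ \in unitmx) unitmxE det_mx2E !mxE /= mulr1 mul0r subr0
      unitfE nza.
  by rewrite det_mx2E !mxE /= mulr1 mul0r subr0.
have : #|'GL_2[F]%g| = (q.-1 * #|S|)%N.
  rewrite -card_nonzero -sum_nat_const -sum1_card.
  rewrite (partition_big (fun x => \det (GLval x)) [in [set a : F | a != 0]]) /=.
    apply: eq_bigr => a; rewrite inE => nza; rewrite -(card_rcoset S (D a)).
    rewrite -sum1_card; apply: eq_bigl => x; rewrite mem_rcoset !inE.
    rewrite GL_ME detM GL_VxE det_inv DE // .
    by apply/eqP/eqP=> [-> | /(canRL (mulfVK nza))]; rewrite ?mulfV ?mul1r.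
  by move=> x _; rewrite inE -unitfE -unitmxE; exact: (valP x).
rewrite card_GL_2; have q_gt1 := finNzRing_gt1 F => /eqP.
have qm_gt0 : (0 < q.-1)%N by rewrite -ltnS prednK // ltnW.
suff -> : (q * q.-1 ^ 2 * q.+1 = q.-1 * (q * (q.-1 * q.+1)))%N.
  by rewrite eqn_pmul2l // => /eqP.
by rewrite expnS expn1; ring.
Qed.

Lemma tor_det a : a != 0 -> a * a^-1 - 0 * 0 = 1.
Proof. by move=> nza; rewrite mulfV // mul0r subr0. Qed.

Definition tor a := sl2 a 0 0 a^-1.
Definition uni b := sl2 1 b 0 1.
Definition weyl := sl2 0 1 (-1) 0.

Definition borel_set : {set {'GL_2[F]}} := [set x in S | e21 x == 0].

Fact borel_group_set : group_set borel_set.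
Proof.
have in_borel x : (x \in borel_set) = (x \in S) && (e21 x == 0) by rewrite in_set.
apply/group_setP; split=> [|x y]; first by rewrite in_borel group1 SL2_oneE eqxx.
rewrite !in_borel => /andP[Sx /eqP x0] /andP[Sy /eqP y0].
by rewrite groupM //= SL2_mulE x0 y0 mul0r mulr0 addr0.
Qed.

Definition borel : {group {'GL_2[F]}} := Group borel_group_set.

Lemma borelE x : (x \in borel) = (x \in S) && (e21 x == 0).
Proof. by rewrite -[LHS]/(x \in borel_set) in_set. Qed.

Lemma borel_sub : borel \subset S.
Proof. by apply/subsetP=> x; rewrite borelE => /andP[]. Qed.

Lemma borel_e22 x : x \in borel -> (e11 x != 0) * (e22 x = (e11 x)^-1).
Proof.
rewrite borelE => /andP[/SL2_det + /eqP x0]; rewrite x0 mulr0 subr0 => d1.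
have nz : e11 x != 0 by apply: contra_eq_neq d1 => ->; rewrite mul0r eq_sym oner_neq0.
by split=> //; apply: (mulfI nz); rewrite d1 mulfV.
Qed.

Lemma card_borel : #|borel| = (q.-1 * q)%N.
Proof.
rewrite -card_nonzero -[X in (_ * X)%N]cardsT -cardsX.
rewrite -(card_in_imset (f := fun ab : F * F => sl2 ab.1 ab.2 0 ab.1^-1)).
  apply: eq_card => x; apply/idP/imsetP=> [Bx | [[a b]]].
    have [nz x22] := borel_e22 Bx; have := Bx; rewrite borelE => /andP[Sx /eqP x21].
    exists (e11 x, e12 x); first by rewrite !inE nz.
    by rewrite [LHS]SL2_sl2 // x21 x22.
  rewrite in_setX in_setT andbT /= in_set => nza ->.
  have d1 : a * a^-1 - b * 0 = 1 by rewrite mulfV // mulr0 subr0.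
  by rewrite borelE sl2_in // sl2E // eqxx.
move=> [a b] [a' b']; rewrite !inE !andbT /= => nza nza' E.
have d c e : c != 0 -> c * c^-1 - e * 0 = 1 :> F.
  by move=> nzc; rewrite mulfV // mulr0 subr0.
have := congr1 e11 E; have := congr1 e12 E.
by rewrite !sl2E ?d // => -> ->.
Qed.

Definition torus_set : {set {'GL_2[F]}} := [set x in borel | e12 x == 0].

Fact torus_group_set : group_set torus_set.
Proof.
have in_torus x : (x \in torus_set) = (x \in borel) && (e12 x == 0) by rewrite in_set.
apply/group_setP; split=> [|x y]; first by rewrite in_torus group1 SL2_oneE eqxx.
rewrite !in_torus => /andP[Bx /eqP x0] /andP[By /eqP y0].
by rewrite groupM //= SL2_mulE x0 y0 mul0r mulr0 addr0.
Qed.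

Definition torus : {group {'GL_2[F]}} := Group torus_group_set.

Lemma torusE x : (x \in torus) = (x \in borel) && (e12 x == 0).
Proof. by rewrite -[LHS]/(x \in torus_set) in_set. Qed.

Lemma tor_in a : a != 0 -> tor a \in torus.
Proof.
move=> nza; have d1 := tor_det nza.
by rewrite torusE borelE /tor sl2_in // !sl2E // eqxx.
Qed.

Lemma tor_e11 x : x \in torus -> x = tor (e11 x).
Proof.
rewrite torusE => /andP[Bx /eqP x12]; have [nz x22] := borel_e22 Bx.
have := Bx; rewrite borelE => /andP[Sx /eqP x21].
by rewrite [LHS]SL2_sl2 // x21 x22 x12.
Qed.

Lemma torE a : a != 0 -> (e11 (tor a) = a) * (e12 (tor a) = 0)
  * (e21 (tor a) = 0) * (e22 (tor a) = a^-1).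
Proof. by move=> nza; rewrite /tor !sl2E ?tor_det. Qed.

Lemma torM : {in [pred a | a != 0] &, {morph tor : a b / a * b >-> (a * b)%g}}.
Proof.
move=> a b; rewrite !inE => nza nzb; have nzab : a * b != 0 by rewrite mulf_neq0.
apply: SL2_eqP; rewrite SL2_mulE !torE //; try ring.
by rewrite invfM; ring.
Qed.

Lemma card_torus : #|torus| = q.-1.
Proof.
rewrite -card_nonzero -(card_in_imset (f := tor)).
  apply: eq_card => x; apply/idP/imsetP=> [Tx | [a + ->]].
    exists (e11 x); last exact: tor_e11.
    by have := Tx; rewrite torusE inE => /andP[/borel_e22[]].
  by rewrite inE; exact: tor_in.
move=> a b; rewrite !inE => nza nzb /(congr1 e11).
by rewrite !torE.
Qed.

Lemma torus_cyclic : cyclic torus.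
Proof.
apply: (@field_mul_group_cyclic _ _ _ e11) => [x y | x Tx].
  rewrite !torusE => /andP[Bx /eqP x0] /andP[By /eqP y0].
  by rewrite SL2_mulE x0 mul0r addr0.
split=> [|->]; last by rewrite SL2_oneE.
rewrite (tor_e11 Tx) => E; rewrite torE in E; last first.
  by have := Tx; rewrite torusE => /andP[/borel_e22[]].
by apply: SL2_eqP; rewrite E torE ?oner_neq0 ?SL2_oneE // invr1.
Qed.

End SL2Matrices.
Prenex Implicits e11 e12 e21 e22 tor uni.

Section SplitPart.

Variable F : finFieldType.
Implicit Types (a b c d : F) (x y : {'GL_2[F]}).
Local Notation S := (SL2 F).
Local Notation q := #|F|.

Lemma weyl_det : 0 * 0 - 1 * -1 = 1 :> F.
Proof. ring. Qed.

Lemma weylE : (e11 (weyl F) = 0) * (e12 (weyl F) = 1)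
  * (e21 (weyl F) = -1) * (e22 (weyl F) = 0).
Proof. by rewrite /weyl !sl2E ?weyl_det. Qed.

Lemma weyl_in : weyl F \in S.
Proof. exact/sl2_in/weyl_det. Qed.

Lemma uni_det b : 1 * 1 - b * 0 = 1 :> F.
Proof. ring. Qed.

Lemma uniE b : (e11 (uni b) = 1) * (e12 (uni b) = b)
  * (e21 (uni b) = 0) * (e22 (uni b) = 1).
Proof. by rewrite /uni !sl2E ?uni_det. Qed.

Lemma uni_in b : uni b \in borel F.
Proof. by rewrite borelE sl2_in ?uniE ?eqxx // uni_det. Qed.

Lemma borelM_e11 x y : x \in borel F -> y \in borel F ->
  e11 (x * y)%g = e11 x * e11 y.
Proof.
rewrite !borelE => /andP[_ /eqP x0] /andP[_ /eqP y0].
by rewrite SL2_mulE y0 mulr0 addr0.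
Qed.

Definition negone : {'GL_2[F]} := sl2 (-1) 0 0 (-1).

Lemma negone_det : -1 * -1 - 0 * 0 = 1 :> F.
Proof. ring. Qed.

Lemma negoneE : (e11 negone = -1) * (e12 negone = 0)
  * (e21 negone = 0) * (e22 negone = -1).
Proof. by rewrite /negone !sl2E ?negone_det. Qed.

Lemma negone_in : negone \in S.
Proof. exact/sl2_in/negone_det. Qed.

Lemma negone_torus : negone \in torus F.
Proof. by rewrite torusE borelE negone_in !negoneE eqxx. Qed.

Lemma weyl_sqr : (weyl F * weyl F)%g = negone.
Proof. by apply: SL2_eqP; rewrite SL2_mulE !weylE negoneE; ring. Qed.

(** Commuting with one transvection and with the Weyl element already forces a scalar matrix. *)
Lemma center_SL2 : 'Z(S)%g = [set 1%g; negone].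
Proof.
apply/setP=> y; rewrite in_set2; apply/idP/orP.
  case/centerP=> Sy cy; have d1 := SL2_det Sy.
  have := cy _ (subsetP (borel_sub F) _ (uni_in 1)).
  move/(congr1 e11); rewrite /= !SL2_mulE !uniE !(mul1r, mulr1, mulr0, addr0).
  move=> E1; have y21 : e21 y = 0.
    by apply: (addrI (e11 y)); rewrite -E1 addr0.
  have E2 := congr1 e11 (cy _ weyl_in); rewrite /= !SL2_mulE !weylE in E2.
  have E3 := congr1 e12 (cy _ weyl_in); rewrite /= !SL2_mulE !weylE in E3.
  rewrite !(mul0r, mulr0, mul1r, mulr1, mulN1r, mulrN1, addr0, add0r) in E2 E3.
  have y12 : e12 y = 0 by apply: oppr_inj; rewrite E2 y21 oppr0.
  have : (e11 y - 1) * (e11 y + 1) = 0.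
    transitivity (e11 y * e22 y - e12 y * e21 y - 1); last by rewrite d1 subrr.
    by rewrite y12 y21 -E3; ring.
  move/eqP; rewrite mulf_eq0 subr_eq0 addr_eq0 => /orP[] /eqP E; [left | right].
    by apply/eqP/SL2_eqP; rewrite SL2_oneE -?E3.
  by apply/eqP/SL2_eqP; rewrite negoneE -?E3.
case=> /eqP->; first exact: group1.
apply/centerP; split=> [|y' _]; first exact: negone_in.
by apply: SL2_eqP; rewrite !SL2_mulE !negoneE; ring.
Qed.

Hypothesis nz2 : 2%:R != 0 :> F.

Lemma neq_N1 : -1 != 1 :> F.
Proof. by rewrite -subr_eq0 -opprD oppr_eq0. Qed.

Lemma negone_neq1 : negone != 1%g.
Proof.
by apply/eqP=> /(congr1 e11); rewrite negoneE SL2_oneE => /eqP; apply/negP/neq_N1.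
Qed.

Lemma negone_sqr : (negone * negone)%g = 1%g.
Proof. by apply: SL2_eqP; rewrite SL2_mulE !negoneE SL2_oneE; ring. Qed.

Lemma order_negone : #[negone]%g = 2%N.
Proof.
apply/eqP; rewrite eqn_leq order_gt1 negone_neq1 andbT dvdn_leq //.
by rewrite order_dvdn expgS expg1 negone_sqr.
Qed.

Lemma bruhat x : x \in S -> x \notin borel F ->
  exists2 b, b \in borel F & exists2 b', b' \in borel F & x = (b * weyl F * b')%g.
Proof.
move=> Sx; rewrite borelE Sx /= => nz; have d1 := SL2_det Sx.
have d2 : (- e21 x)^-1 * - e21 x - - e11 x * 0 = 1.
  by rewrite mulVf ?oppr_eq0 // mulr0 subr0.
have d3 : 1 * 1 - (e22 x / e21 x) * 0 = 1 by ring.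
(* This factor is chosen so that its product with the Weyl element has the first column of x; the
   unipotent factor keeps that column and adjusts the second one. *)
exists (sl2 (- e21 x)^-1 (- e11 x) 0 (- e21 x)).
  by rewrite borelE sl2_in // sl2E // eqxx.
exists (uni (e22 x / e21 x)); first exact: uni_in.
have e12x : e11 x * e22 x = 1 + e12 x * e21 x by rewrite -d1; ring.
by apply: SL2_eqP; rewrite !SL2_mulE !weylE !uniE !sl2E //; field: e12x;
  rewrite ?oppr_eq0 ?nz.
Qed.

Lemma weyl_conj_torus t : t \in torus F -> (t ^ weyl F)%g = t^-1%g.
Proof.
move=> Tt; rewrite (tor_e11 Tt).
have nz : e11 t != 0 by have := Tt; rewrite torusE => /andP[/borel_e22[]].
have St : tor (e11 t) \in S by exact/sl2_in/tor_det.
by apply: SL2_eqP; rewrite conjgE !SL2_mulE !(SL2_invE weyl_in) !(SL2_invE St) !weylE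
  !torE //; ring.
Qed.

End SplitPart.

(** * The nonsplit torus *)

Section NonsplitPart.

Variable F : finFieldType.
Implicit Types (a b c d : F) (x y : {'GL_2[F]}).
Local Notation S := (SL2 F).
Local Notation q := #|F|.
Hypothesis nz2 : 2%:R != 0 :> F.

(** Each nonzero square has at most two roots, and 0 has only one. *)
Lemma card_squares : (q.+1 <= 2 * #|[set a ^+ 2 | a : F]|)%N.
Proof.
set A := [set _ | _ in _]; have A0 : 0 \in A.
  by apply/imsetP; exists 0; rewrite ?expr0n.
have : (q.-1 <= \sum_(v in A :\ 0%R) 2)%N.
  rewrite -card_nonzero -sum1_card (partition_big (fun a => a ^+ 2) [in A :\ 0]) /=.
    apply: leq_sum => v; rewrite !inE => /andP[_ /imsetP[a _ ->]].
    rewrite sum1_card; apply: (@leq_trans #|[set a; - a]|); last first.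
      by rewrite cards2; case: (a != _).
    apply/subset_leq_card/subsetP=> b; rewrite unfold_in => /andP[_].
    by rewrite eqf_sqr !inE.
  move=> a; rewrite !inE => nza; rewrite expf_eq0 nza /=.
  by apply/imsetP; exists a.
rewrite sum_nat_const (cardsD1 0 A) A0 add1n mulnC mulnS => h.
have q_gt0 : (0 < q)%N by have := finNzRing_gt1 F; case: (q).
by move: h; rewrite -ltnS prednK // => h; rewrite add2n ltnS.
Qed.

(** Pigeonhole: the squares and their images under v |-> m + nu v each fill more than half of F. *)
Lemma square_plus_solvable nu m : nu != 0 -> exists a b, a ^+ 2 = m + nu * b ^+ 2.
Proof.
move=> nznu; set A := [set a ^+ 2 | a : F].
pose f v := m + nu * v; have f_inj : injective f.
  by move=> v v' /addrI /(mulfI nznu).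
have [AB0 | [v /setIP[/imsetP[a _ ->] /imsetP[_ /imsetP[b _ ->] E]]]] :=
    set_0Vmem (A :&: [set f v | v in A]); last by exists a, b.
have : (#|A :|: f @: A| <= q)%N := max_card _.
rewrite cardsU AB0 cards0 subn0 (card_imset _ f_inj) addnn -mul2n.
by rewrite leqNgt card_squares.
Qed.

Variable nu : F.
Hypothesis nu_nsq : forall a, a ^+ 2 != nu.

Let nz_nu : nu != 0.
Proof. by rewrite eq_sym; have := nu_nsq 0; rewrite expr0n. Qed.

Let nu_sqr_eq a b : a ^+ 2 = nu * b ^+ 2 -> (a == 0) && (b == 0).
Proof.
move=> E; have [b0 | nzb] := eqVneq b 0.
  by move: E; rewrite b0 expr0n mulr0 => /eqP; rewrite sqrf_eq0 => ->.
by case/eqP: (nu_nsq (a / b)); rewrite expr_div_n E mulfK // expf_neq0.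
Qed.

(** The elements of norm 1 in the quadratic extension F(sqrt nu), as matrices of multiplication by
    e11 + e21 sqrt nu. *)
Definition nsplit_set : {set {'GL_2[F]}} :=
  [set x in S | (e22 x == e11 x) && (e12 x == nu * e21 x)].

Fact nsplit_group_set : group_set nsplit_set.
Proof.
have in_C x : (x \in nsplit_set) = (x \in S) && ((e22 x == e11 x) && (e12 x == nu * e21 x)).
  by rewrite in_set.
apply/group_setP; split=> [|x y].
  by rewrite in_C group1 !SL2_oneE mulr0 !eqxx.
rewrite !in_C => /and3P[Sx /eqP x22 /eqP x12] /and3P[Sy /eqP y22 /eqP y12].
rewrite groupM //= !SL2_mulE x22 x12 y22 y12.
by apply/andP; split; apply/eqP; ring.
Qed.

Definition nsplit : {group {'GL_2[F]}} := Group nsplit_group_set.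

Lemma nsplitE x : (x \in nsplit) = [&& x \in S, e22 x == e11 x & e12 x == nu * e21 x].
Proof. by rewrite -[LHS]/(x \in nsplit_set) in_set. Qed.

Lemma nsplitP x : reflect [/\ x \in S, e22 x = e11 x & e12 x = nu * e21 x] (x \in nsplit).
Proof.
rewrite nsplitE; apply: (iffP and3P) => [[Sx /eqP x22 /eqP x12] | [Sx x22 x12]] //.
by split=> //; apply/eqP.
Qed.

Lemma nsplit_det x : x \in nsplit -> e11 x ^+ 2 = 1 + nu * e21 x ^+ 2.
Proof. by case/nsplitP=> /SL2_det d1 x22 x12; rewrite -d1 x22 x12; ring. Qed.

Lemma nsplit_sub : nsplit \subset S.
Proof. by apply/subsetP=> x /nsplitP[]. Qed.

Lemma nsplit_eqP x y : x \in nsplit -> y \in nsplit ->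
  e11 x = e11 y -> e21 x = e21 y -> x = y.
Proof.
move=> /nsplitP[_ x22 x12] /nsplitP[_ y22 y12] e e'.
by apply: SL2_eqP; rewrite ?x22 ?y22 ?x12 ?y12 ?e'.
Qed.

Lemma sl2_nsplit a b : a ^+ 2 = 1 + nu * b ^+ 2 -> sl2 a (nu * b) b a \in nsplit.
Proof.
move=> d; have d1 : a * a - nu * b * b = 1 by rewrite -expr2 d; ring.
by apply/nsplitP; rewrite !sl2E // sl2_in.
Qed.

Lemma nsplit_abelian : abelian nsplit.
Proof.
apply/centsP=> x /nsplitP[Sx x22 x12] y /nsplitP[Sy y22 y12].
by apply: SL2_eqP; rewrite !SL2_mulE ?x22 ?x12 ?y22 ?y12; ring.
Qed.

Lemma negone_nsplit : negone F \in nsplit.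
Proof. by rewrite nsplitE negone_in !negoneE mulr0 !eqxx. Qed.

Lemma nsplit_e21_eq0 x : x \in nsplit -> e21 x = 0 -> x \in [set 1%g; negone F].
Proof.
move=> Cx x21; have := nsplit_det Cx; rewrite x21 expr0n mulr0 addr0 => /eqP.
rewrite sqrf_eq1 in_set2 => /orP[] /eqP x11; apply/orP; [left | right]; apply/eqP.
  by apply: nsplit_eqP; rewrite ?group1 // ?SL2_oneE.
by apply: nsplit_eqP; rewrite ?negone_nsplit // ?negoneE.
Qed.

(** For x <> 1 the difference x - 1 is invertible, as in a field: its determinant is 2 - 2 e11 x,
    and e11 x = 1 forces x = 1. *)
Lemma nsplit_cyclic : cyclic nsplit.
Proof.
apply: (@div_ring_mul_group_cyclic _ _ _ (@GLval 2 F)) => //; last exact: nsplit_abelian.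
move=> x /setD1P[n1 Cx]; have /nsplitP[Sx x22 x12] := Cx.
rewrite -[_ \is a _]/(_ \in unitmx) unitmxE det_mx2E !mxE /=.
rewrite -[GLval x 0 0]/(e11 x) -[GLval x 1 0]/(e21 x) -[GLval x 0 1]/(e12 x).
rewrite -[GLval x 1 1]/(e22 x) unitfE x22 x12 !subr0.
apply: contraNneq n1 => d0; have d1 := nsplit_det Cx.
have E : e11 x = 1.
  apply: (mulfI nz2).
  transitivity (2%:R * 1 - ((e11 x - 1) * (e11 x - 1) - nu * e21 x * e21 x)).
    by ring: d1.
  by rewrite d0 subr0.
apply/eqP/nsplit_eqP; rewrite ?group1 // SL2_oneE ?E //.
move/eqP: d1; rewrite E expr1n -subr_eq0 opprD addNKr oppr_eq0 mulf_eq0.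
by rewrite (negPf nz_nu) sqrf_eq0 => /eqP.
Qed.

(* Rational parametrization of the conic a^2 - nu b^2 = 1 from (-1, 0). *)
Lemma card_nsplit : #|nsplit| = q.+1.
Proof.
pose D t := 1 - nu * t ^+ 2.
have nzD t : D t != 0.
  rewrite subr_eq0; apply/eqP=> E; have := @nu_sqr_eq 1 t.
  by rewrite expr1n oner_eq0 => /(_ E).
pose u t := (1 + nu * t ^+ 2) / D t; pose v t := 2%:R * t / D t.
have Duv t : u t ^+ 2 = 1 + nu * v t ^+ 2.
  by rewrite /u /v; move: (nzD t); rewrite /D => nzDt; field.
have u1 t : 1 + u t = 2%:R / D t.
  by rewrite /u; move: (nzD t); rewrite /D => nzDt; field.
pose f o := if o is Some t then sl2 (u t) (nu * v t) (v t) (u t) else negone F.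
have fE t : (e11 (f (Some t)) = u t) * (e21 (f (Some t)) = v t).
  by rewrite /f !sl2E // -expr2 Duv; ring.
have nz1u t : 1 + u t != 0 by rewrite u1 mulf_neq0 ?invr_eq0.
have fN t : f (Some t) != f None.
  apply/eqP=> /(congr1 e11); rewrite fE /= negoneE => E.
  by have := nz1u t; rewrite E subrr eqxx.
have f_inj : injective f.
  have vu t : v t / (1 + u t) = t.
    by rewrite u1 /v; field; rewrite nz2 nzD.
  move=> [t|] [t'|] //= E.
  - have := congr1 e11 E; have := congr1 e21 E.
    by rewrite -/(f (Some t)) -/(f (Some t')) !fE => ev eu; rewrite -(vu t) ev eu vu.
  - by case/eqP: (fN t).
  - by case/eqP: (fN t').
rewrite -card_option -cardsT -(card_imset _ f_inj).
apply: eq_card => x; apply/idP/imsetP=> [Cx | [[t|] _ ->]]; last 2 first.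
- exact: sl2_nsplit.
- exact: negone_nsplit.
have dx := nsplit_det Cx; have [x11 | nx11] := eqVneq (1 + e11 x) 0.
  have x11N : e11 x = -1 by apply/eqP; rewrite -addr_eq0 addrC x11.
  exists None => //=; apply: nsplit_eqP; rewrite ?negone_nsplit ?negoneE //.
  move/eqP: dx; rewrite x11N sqrrN expr1n -subr_eq0 opprD addNKr oppr_eq0.
  by rewrite mulf_eq0 (negPf nz_nu) sqrf_eq0 => /eqP.
(* The slope of the line from (-1, 0) through the point of x recovers the parameter. *)
pose t := e21 x / (1 + e11 x); have nvx : nu * e21 x ^+ 2 = e11 x ^+ 2 - 1.
  by rewrite dx; ring.
have Dt : D t = 2%:R / (1 + e11 x).
  by rewrite /D /t expr_div_n mulrA nvx; field.
exists (Some t) => //; apply: nsplit_eqP; rewrite // ?fE; first exact: sl2_nsplit.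
  apply: (addrI 1); rewrite u1 Dt; field; exact/andP.
by rewrite /v Dt /t; field; rewrite nz2 nx11.
Qed.

(** The trace determines e11, and the norm equation then determines e21 up to sign. *)
Lemma nsplit_conj (c y : {'GL_2[F]}) : c \in nsplit -> y \in S -> (c ^ y)%g \in nsplit ->
  (c ^ y)%g = c \/ (c ^ y)%g = c^-1%g.
Proof.
move=> Cc Sy Ccy; have /nsplitP[Sc c22 c12] := Cc; have /nsplitP[Scy cy22 cy12] := Ccy.
have e11E : e11 (c ^ y)%g = e11 c.
  apply: (mulfI nz2); rewrite !mulr2n !mulrDl !mul1r.
  by rewrite -{2}cy22 -{2}c22 SL2_trace_conj.
have : e21 (c ^ y)%g ^+ 2 = e21 c ^+ 2.
  by apply: (mulfI nz_nu); apply: (addrI 1); rewrite -!nsplit_det // e11E.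
move/eqP; rewrite eqf_sqr => /orP[] /eqP E; [left | right].
  exact: nsplit_eqP.
by apply: nsplit_eqP; rewrite ?groupV // SL2_invE // c22.
Qed.

Lemma nsplit_cent (c y : {'GL_2[F]}) : c \in nsplit -> c \notin [set 1%g; negone F] ->
  y \in S -> (c ^ y)%g = c -> y \in nsplit.
Proof.
move=> Cc ncZ Sy /conjg_fixP /commgP cyc.
have /nsplitP[Sc c22 c12] := Cc.
have nz21 : e21 c != 0 by apply: contraNneq ncZ => c21; apply: nsplit_e21_eq0.
have := congr1 e11 cyc; have := congr1 e21 cyc; rewrite /= !SL2_mulE c22 c12.
move=> E21 E11; apply/nsplitP; split=> //.
  apply: (mulfI nz21); apply: (addrI (e11 c * e21 y)).
  by rewrite [RHS]addrC [RHS]addrC mulrC [e21 c * e22 y]mulrC -E21; ring.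
apply: (mulfI nz21); apply: (addrI (e11 c * e11 y)).
by rewrite [e21 c * e12 y]mulrC [e11 c * e11 y]mulrC -E11; ring.
Qed.

(** If a is an eigenvalue, the trace gives e11 c = (a + a^-1) / 2, so nu e21^2 is the square of (a -
    a^-1) / 2. As nu is not a square, e21 c = 0. *)
Lemma nsplit_borel (c y : {'GL_2[F]}) : c \in nsplit -> y \in S -> (c ^ y)%g \in borel F ->
  c \in [set 1%g; negone F].
Proof.
move=> Cc Sy Bcy; have /nsplitP[Sc c22 c12] := Cc; have [nza cy22] := borel_e22 Bcy.
have := SL2_trace_conj Sc Sy; rewrite cy22 c22; set a := e11 (c ^ y)%g in nza *.
move=> tr; apply: nsplit_e21_eq0 => //.
have : ((a - a^-1) / 2%:R) ^+ 2 = nu * e21 c ^+ 2.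
  have e1 : e11 c = (a + a^-1) / 2%:R by rewrite tr; field.
  apply: (addrI 1); rewrite -nsplit_det // e1; field; exact/andP.
by move/nu_sqr_eq => /andP[_ /eqP].
Qed.

(** The conjugation of F(sqrt nu) inverts elements of norm 1 but has determinant -1; composing it
    with multiplication by an element of norm -1 brings it into SL_2. *)
Lemma nsplit_weyl_exists : exists2 w, w \in S &
  (w * w)%g = negone F /\ {in nsplit, forall c : {'GL_2[F]}, (c ^ w)%g = c^-1%g}.
Proof.
have [a [b Dab]] := square_plus_solvable (-1) nz_nu.
have d1 : a * (- a) - (- nu * b) * b = 1.
  by transitivity (- (a ^+ 2 - nu * b ^+ 2)); [ring | rewrite Dab; ring].
exists (sl2 a (- nu * b) b (- a)); first exact: sl2_in.
have aa : a * a = -1 + nu * b ^+ 2 by rewrite -expr2.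
split; first by apply: SL2_eqP; rewrite [RHS]negoneE SL2_mulE !sl2E //; ring: aa.
move=> c Cc; have /nsplitP[Sc c22 c12] := Cc.
apply: SL2_eqP; rewrite conjgE !SL2_mulE !(SL2_invE (sl2_in d1)) (SL2_invE Sc) !sl2E //.
all: rewrite ?c22 ?c12; ring: aa.
Qed.

End NonsplitPart.

(** * Jacobi sums *)

Section JacobiSum.

Variables (F : finFieldType) (L M : F -> algC).
Hypotheses (L0 : L 0 = 0) (L1 : L 1 = 1) (LM : forall a b, L (a * b) = L a * L b).
Hypotheses (M0 : M 0 = 0) (LMV : forall a, a != 0 -> L a * M a = 1).
Hypotheses (sumL : \sum_a L a = 0) (sumL2 : \sum_a L a ^+ 2 = 0).

Let ME a : M a = L a^-1.
Proof.
have [-> | nza] := eqVneq a 0; first by rewrite invr0 M0 L0.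
have nzL : L a != 0 by apply: contra_eq_neq (LMV nza) => ->; rewrite mul0r eq_sym oner_eq0.
by apply: (mulfI nzL); rewrite LMV // -LM mulfV.
Qed.

(* [y |-> (1 - s y) / (1 - y)] permutes the projective line. *)
Let moebius_sum s : s != 1 ->
  \sum_(y | (y != 0) && (y != 1)) L ((1 - s * y) / (1 - y)) = - 1 - L s.
Proof.
move=> ns1; transitivity (\sum_(u | (u != 1) && (u != s)) L u); last first.
  have := sumL; rewrite (bigD1 1) //= L1 (bigD1 s) //= addrA addrC => /eqP.
  by rewrite addr_eq0 => /eqP ->; rewrite opprD.
rewrite [RHS](reindex_onto (fun y => (1 - s * y) / (1 - y)) (fun u => (u - 1) / (u -
  s))) /=.
  apply: eq_bigl => y; have [-> | ny1] := eqVneq y 1.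
    rewrite andbF subrr invr0 mulr0 !sub0r; apply/esym/negbTE/negP=> /andP[_ /eqP].
    by move/divr1_eq/oppr_inj=> s1; rewrite s1 eqxx in ns1.
  have nz1y : 1 - y != 0 by rewrite subr_eq0 eq_sym.
  have -> : (1 - s * y) / (1 - y) - 1 = (1 - s) * y / (1 - y) by field.
  have -> : (1 - s * y) / (1 - y) - s = (1 - s) / (1 - y) by field.
  have nz1s : 1 - s != 0 by rewrite subr_eq0 eq_sym.
  have -> : (1 - s) * y / (1 - y) / ((1 - s) / (1 - y)) = y by field; rewrite nz1s nz1y.
  rewrite eqxx !andbT -(subr_eq0 _ 1) -(subr_eq0 _ s).
  have -> : (1 - s * y) / (1 - y) - 1 = (1 - s) * y / (1 - y) by field.
  have -> : (1 - s * y) / (1 - y) - s = (1 - s) / (1 - y) by field.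
  by rewrite !mulf_eq0 !invr_eq0 (negPf nz1s) (negPf nz1y) !orbF andbT.
move=> u /andP[nu1 nus]; have nz : u - s != 0 by rewrite subr_eq0.
field; rewrite nz; have -> : u - s - (u - 1) = 1 - s by ring.
by rewrite subr_eq0 eq_sym.
Qed.

(** After the substitution a = s y the double sum runs over s with weight L s. The term s = 1
    contributes q - 2; the others contribute - L s - (L s)^2, which add up to 2 because L and L^2
    sum to zero. *)
Lemma jacobi_sum_mul :
  (\sum_a L a * L (1 - a)) * (\sum_a M a * M (1 - a)) = #|F|%:R.
Proof.
transitivity (\sum_s L s * \sum_(y | (y != 0) && (y != 1)) L ((1 - s * y) / (1 - y))).
  under [RHS]eq_bigr => s _ do rewrite mulr_sumr.
  rewrite exchange_big /= mulr_sumr [RHS]big_mkcond /=; apply: eq_bigr => y _.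
  have [-> | ny0] := eqVneq y 0; first by rewrite M0 mul0r mulr0.
  have [-> | ny1] := eqVneq y 1; first by rewrite subrr M0 !mulr0.
  (* The variable of the first sum is replaced by s y, y being that of the second. *)
  rewrite mulr_suml (reindex_inj (mulIf ny0)) /=; apply: eq_bigr => s _.
  rewrite !LM -ME; have := LMV ny0; move: (L s) (L y) (M y) (L _) (M _) => a b c d e bc.
  by rewrite -[RHS]mulr1 -bc; ring.
rewrite (bigD1 1) //= L1 mul1r (eq_bigr (fun=> 1)) => [|y /andP[ny0 ny1]]; last first.
  by rewrite mul1r mulfV ?L1 // subr_eq0 eq_sym.
rewrite [X in _ + X](eq_bigr (fun s => - L s - L s ^+ 2)) => [|s ns1]; last first.
  by rewrite moebius_sum //; ring.
have -> : \sum_(i | i != 1) (- L i - L i ^+ 2) = 2%:R.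
  have : \sum_i (- L i - L i ^+ 2) = 0 by rewrite sumrB sumrN sumL sumL2 oppr0 addr0.
  rewrite (bigD1 1) //= L1 expr1n => /eqP; rewrite addr_eq0 => /eqP E.
  by rewrite -[LHS]opprK -E; ring.
rewrite sumr_const -natrD; congr _%:R.
have <- : #|[set: F] :\ 0 :\ 1| = #|fun y : F => (y != 0) && (y != 1)|.
  by apply: eq_card => y; rewrite !inE andbT andbC.
by have := cardsD1 0 [set: F]; have := cardsD1 1 ([set: F] :\ 0);
  rewrite !inE oner_eq0 cardsT /= => -> ->; rewrite addnC.
Qed.

End JacobiSum.

(** * The characters of SL_2(q) *)

(** If every element were a square, squaring would be bijective on the finite field, yet 1 and -1
    have the same square. *)
Lemma nonsquare_exists (F : finFieldType) : 2%:R != 0 :> F ->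
  exists nu : F, forall a, a ^+ 2 != nu.
Proof.
move=> nz2; apply: contrapT => no_nu.
have /fin_all_exists[r rE] (nu : F) : exists a, a ^+ 2 = nu.
  apply: contrapT => no_a; apply: no_nu; exists nu => a.
  by apply/eqP=> E; apply: no_a; exists a.
have inj_r : injective r by move=> x y E; rewrite -(rE x) E rE.
have r_sq x : r (x ^+ 2) = x by rewrite -[x](f_finv inj_r) rE.
by case/eqP: (neq_N1 nz2); rewrite -(r_sq (-1)) sqrrN expr1n -{2}(r_sq 1) expr1n.
Qed.

(* Unification otherwise unfolds membership and products down to matrices. *)
Opaque SL2 borel torus nsplit sl2 tor uni weyl negone e11 e12 e21 e22 order.

Section SL2Structure.

Variable F : finFieldType.
Hypothesis nz2 : 2%:R != 0 :> F.
Variable nu : F.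
Hypothesis nu_nsq : forall a, a ^+ 2 != nu.
Variable n : nat.
Hypothesis Dq : #|F| = (2 * n).+1.
Variables t0 c0 : {'GL_2[F]}.
Hypothesis T_gen : torus F = <[t0]>%G.
Hypothesis C_gen : nsplit nu = <[c0]>%G.

Local Notation S := (SL2 F).
Local Notation B := (borel F).
Local Notation T := (torus F).
Local Notation C := (nsplit nu).
Local Notation m := n.+1.
Local Notation Z := [set 1%g; negone F].
Implicit Types w : algC.

Definition lamf (w : algC) x := cyc_lin t0 w (tor (e11 x)).
Definition unib_set : {set {'GL_2[F]}} := [set x in B | e11 x \in [set 1; -1]].
Local Notation B1 := unib_set.

Let n_gt0 : (0 < n)%N.
Proof. by have := finNzRing_gt1 F; rewrite Dq; case: (n). Qed.

Let order_t0 : #[t0]%g = (2 * n)%N.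
Proof. by rewrite orderE -[<[t0]>%g]/(gval <[t0]>%G) -T_gen card_torus Dq. Qed.

Let order_c0 : #[c0]%g = (2 * m)%N.
Proof.
by rewrite orderE -[<[c0]>%g]/(gval <[c0]>%G) -C_gen card_nsplit // Dq mulnS.
Qed.

Let root_t0 w : w ^+ n = 1 -> w ^+ #[t0]%g = 1.
Proof. by rewrite order_t0 mulnC exprM => ->; rewrite expr1n. Qed.

Let root_c0 w : w ^+ m = 1 -> w ^+ #[c0]%g = 1.
Proof. by rewrite order_c0 mulnC exprM => ->; rewrite expr1n. Qed.

Let borel_e11_neq0 x : x \in B -> e11 x != 0.
Proof. by case/borel_e22. Qed.

Let T_t0 x : (x \in <[t0]>%g) = (x \in T).
Proof. by rewrite -[<[t0]>%g]/(gval <[t0]>%G) -T_gen. Qed.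

Let C_c0 x : (x \in <[c0]>%g) = (x \in C).
Proof. by rewrite -[<[c0]>%g]/(gval <[c0]>%G) -C_gen. Qed.

Let tor_e11_in x : x \in B -> tor (e11 x) \in <[t0]>%g.
Proof. by rewrite T_t0 => /borel_e11_neq0/tor_in. Qed.

Let tor1 : tor 1 = 1%g :> {'GL_2[F]}.
Proof. by apply: SL2_eqP; rewrite torE ?oner_neq0 // SL2_oneE ?invr1. Qed.

Lemma lamfM w : w ^+ n = 1 -> {in B &, {morph lamf w : x y / (x * y)%g >-> x * y}}.
Proof.
move=> wn x y Bx By; rewrite /lamf borelM_e11 // torM ?inE ?borel_e11_neq0 //.
by rewrite (cyc_linM (root_t0 wn)) ?tor_e11_in.
Qed.

Lemma lamf1 w : w ^+ n = 1 -> lamf w 1%g = 1.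
Proof. by move=> wn; rewrite /lamf SL2_oneE tor1 (cyc_lin1 (root_t0 wn)). Qed.

Lemma thfM w : w ^+ m = 1 ->
  {in C &, {morph cyc_lin c0 w : x y / (x * y)%g >-> x * y}}.
Proof. by move=> wm; rewrite C_gen; apply: cyc_linM (root_c0 wm). Qed.

Lemma tor_e11_Z x : x \in B -> (tor (e11 x) \in Z) = (e11 x \in [set 1; -1]).
Proof.
move=> Bx; have nz := borel_e11_neq0 Bx.
have N10 : -1 != 0 :> F by rewrite oppr_eq0 oner_neq0.
rewrite !in_set2; congr (_ || _); apply/eqP/eqP=> [/(congr1 e11) | ->].
- by rewrite torE // SL2_oneE.
- exact: tor1.
- by rewrite torE // negoneE.
by apply: SL2_eqP; rewrite torE // negoneE ?invrN1.
Qed.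

Lemma unib_tor x : x \in B -> (x \in B1) = (tor (e11 x) \in Z).
Proof. by move=> Bx; rewrite inE Bx tor_e11_Z. Qed.

Let negone_t0 : negone F \in <[t0]>%g.
Proof. by rewrite T_t0 negone_torus. Qed.

Let negone_c0 : negone F \in <[c0]>%g.
Proof. by rewrite C_c0 negone_nsplit. Qed.

Lemma lamf_B1 w x : w ^+ n = 1 -> x \in B1 -> lamf w x = 1.
Proof.
move=> wn B1x; have Bx : x \in B by move: B1x; rewrite inE => /andP[].
move: B1x; rewrite unib_tor // in_set2 /lamf => /orP[] /eqP->.
  by rewrite (cyc_lin1 (root_t0 wn)).
by apply: (cyc_lin_involution order_t0) => //; exact: order_negone.
Qed.

Lemma lamf_gen : exists2 t, t \in T & forall w, w ^+ n = 1 -> lamf w t = w.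
Proof.
have Tt0 : t0 \in T by rewrite -T_t0 cycle_id.
exists t0 => // w wn; rewrite /lamf -tor_e11 //.
by have := cyc_linX 1 (root_t0 wn); rewrite expg1 expr1.
Qed.

Lemma lamf_orth w x : n.-primitive_root w -> x \in B ->
  \sum_(i < n) lamf (w ^+ i) x = n%:R *+ (x \in B1).
Proof.
move=> prim_w Bx; rewrite unib_tor // /lamf.
by apply: (sum_cyc_lin order_t0 negone_t0 _ prim_w) => //;
  [exact: order_negone | exact: tor_e11_in].
Qed.

Lemma thf_Z w x : w ^+ m = 1 -> x \in Z -> cyc_lin c0 w x = 1.
Proof.
move=> wm; rewrite in_set2 => /orP[] /eqP->; first by rewrite (cyc_lin1 (root_c0 wm)).
by apply: (cyc_lin_involution order_c0) => //; exact: order_negone.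
Qed.

Lemma thf_gen : exists2 t, t \in C & forall w, w ^+ m = 1 -> cyc_lin c0 w t = w.
Proof.
exists c0 => [|w wm]; first by rewrite -C_c0 cycle_id.
by have := cyc_linX 1 (root_c0 wm); rewrite expg1 expr1.
Qed.

Lemma thf_orth w x : m.-primitive_root w -> x \in C ->
  \sum_(i < m) cyc_lin c0 (w ^+ i) x = m%:R *+ (x \in Z).
Proof.
rewrite -C_c0 => prim_w Cx.
by apply: (sum_cyc_lin order_c0 negone_c0 _ prim_w) => //; exact: order_negone.
Qed.

Lemma card_borel2 : #|B| = (2 * n * (2 * n).+1)%N.
Proof. by rewrite card_borel Dq. Qed.

Lemma card_nsplit2 : #|C| = (2 * m)%N.
Proof. by rewrite card_nsplit // Dq mulnS. Qed.

Lemma card_SL2_2 : #|S| = ((2 * n).+1 * (2 * n * (2 * m)))%N.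
Proof. by rewrite card_SL2 Dq /= [(2 * m)%N]mulnS. Qed.

Lemma negone_borel : negone F \in B.
Proof. by have := negone_torus F; rewrite torusE => /andP[]. Qed.

Lemma Z_unib : Z \subset B1.
Proof.
apply/subsetP=> x Zx; have Bx : x \in B.
  by move: Zx; rewrite in_set2 => /orP[] /eqP->; rewrite ?group1 ?negone_borel.
rewrite inE Bx; move: Zx; rewrite !in_set2 => /orP[] /eqP->;
by rewrite ?SL2_oneE ?negoneE eqxx ?orbT.
Qed.

Lemma unib_sub : B1 \subset B.
Proof. by apply/subsetP=> x; rewrite inE => /andP[]. Qed.

Lemma Z_nsplit : Z \subset C.
Proof.
by apply/subsetP=> x; rewrite in_set2 => /orP[] /eqP->; rewrite ?group1 ?negone_nsplit.
Qed.

Lemma torus_sub : T \subset B.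
Proof. by apply/subsetP=> x; rewrite torusE => /andP[]. Qed.

Let sBS x : x \in B -> x \in S. Proof. exact: subsetP (borel_sub F) x. Qed.

Let borel_e21 x : x \in B -> e21 x = 0.
Proof. by rewrite borelE => /andP[_ /eqP]. Qed.

Lemma weyl_notin : weyl F \notin B.
Proof. by rewrite borelE weylE oppr_eq0 oner_eq0 andbF. Qed.

Lemma borel_e12_Z x : x \in B1 -> e12 x = 0 -> x \in Z.
Proof.
move=> B1x x12; have Bx := subsetP unib_sub x B1x; rewrite unib_tor // in B1x.
suff Tx : x \in T by rewrite (tor_e11 Tx).
by rewrite torusE Bx x12 eqxx.
Qed.

(** This product decides when a conjugate stays in B. For x in T the term with e12 x drops out, for
    x in [B1] the term with e11 x; in both cases the remaining factors determine the coset of y. *)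
Lemma borel_conj_e21 x y : x \in B -> y \in S ->
  e21 (x ^ y)%g = - e21 y * ((e11 x - (e11 x)^-1) * e11 y + e12 x * e21 y).
Proof.
move=> Bx Sy; have x21 := borel_e21 Bx.
rewrite conjgE !SL2_mulE !(SL2_invE Sy) (borel_e22 Bx).2 x21.
by ring.
Qed.

Let notB1 x : x \in B -> x \notin B1 -> e11 x - (e11 x)^-1 != 0.
Proof.
move=> Bx; rewrite inE Bx /=; apply: contraNneq => a1; rewrite in_set2 -sqrf_eq1 expr2.
by move/eqP: a1; rewrite subr_eq0 => /eqP {2}->; rewrite mulfV ?borel_e11_neq0.
Qed.

Lemma borel_conj_torus x : x \in B -> x \notin B1 ->
  exists2 u, u \in B & (x ^ u)%g \in T.
Proof.
move=> Bx nB1x; pose a := e11 x; have nza : a != 0 := borel_e11_neq0 Bx.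
have nza1 : a - a^-1 != 0 by apply: notB1.
(* The parameter solves the linear equation that makes the upper right entry of the conjugate
   vanish. *)
pose u : {'GL_2[F]} := uni (- e12 x / (a - a^-1)).
have Bu : u \in B := uni_in _; exists u => //.
rewrite torusE groupJ //=.
rewrite conjgE !SL2_mulE !(SL2_invE (sBS Bu)) !uniE (borel_e22 Bx).2 -/a (borel_e21 Bx).
set b := - e12 x / (a - a^-1); rewrite !(mul1r, mulr1, mul0r, mulr0, add0r, addr0).
apply/eqP; transitivity (b * (a - a^-1) + e12 x); first by ring.
by rewrite divfK // addNr.
Qed.

Lemma torus_conj_borel t y : t \in T -> t \notin B1 -> y \in S -> y \notin B ->
  (t ^ y)%g \in B -> y \in (weyl F *: B)%g.
Proof.
move=> Tt nB1t Sy nBy; have Bt := subsetP torus_sub t Tt.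
have nz := notB1 Bt nB1t; move/borel_e21/eqP.
rewrite borel_conj_e21 //; have -> : e12 t = 0 by move: Tt; rewrite torusE => /andP[_ /eqP].
rewrite mul0r addr0 mulf_eq0 oppr_eq0 mulf_eq0 (negPf nz) /=.
move: nBy; rewrite borelE Sy /= => /negPf-> /= y11.
rewrite mem_lcoset borelE groupM ?groupV ?weyl_in //=.
by rewrite SL2_mulE !(SL2_invE (weyl_in F)) !weylE opprK mul0r addr0 mul1r.
Qed.

Lemma unib_conj_borel x y : x \in B1 -> x \notin Z -> y \in S ->
  (x ^ y)%g \in B -> y \in B.
Proof.
move=> B1x nZx Sy; have Bx := subsetP unib_sub x B1x.
have nz12 : e12 x != 0 by apply: contraNneq nZx; apply: borel_e12_Z.
move/borel_e21; rewrite borel_conj_e21 //.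
have -> : e11 x - (e11 x)^-1 = 0.
  by move: B1x; rewrite inE in_set2 => /andP[_ /orP[]] /eqP->; rewrite ?invr1 ?invrN1 subrr.
move/eqP; rewrite mul0r add0r !mulf_eq0 oppr_eq0 (negPf nz12) /= orbb => y21.
by rewrite borelE Sy y21.
Qed.

Lemma weyl_borel_weyl b : b \in B -> (weyl F * b * weyl F)%g \in B -> b \in T.
Proof.
move=> Bb /borel_e21; rewrite !SL2_mulE !weylE.
rewrite !(mul0r, mulr0, add0r, addr0) mulN1r mulrN1 opprK => b12.
by rewrite torusE Bb b12 eqxx.
Qed.

Lemma nsplit_involution c : c \in C -> c^-1%g = c -> c \in Z.
Proof.
move=> Cc cV; apply: (nsplit_e21_eq0 Cc).
have := congr1 e21 cV; rewrite (SL2_invE (subsetP (nsplit_sub nu) c Cc)) => /esym/eqP.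
by rewrite -addr_eq0 -mulr2n -mulr_natl mulf_eq0 (negPf nz2) => /eqP.
Qed.

Lemma torus_unib : T :&: B1 \subset Z.
Proof.
apply/subsetP=> x; rewrite in_setI torusE => /andP[/andP[_ /eqP x12] B1x].
exact: borel_e12_Z.
Qed.

(** * Squares in the field and the unipotent classes *)

Let g := e11 t0.

Let Tt0 : t0 \in T. Proof. by rewrite -T_t0 cycle_id. Qed.

Let e11_t0X i : e11 (t0 ^+ i)%g = g ^+ i.
Proof.
have Bt0 := subsetP torus_sub t0 Tt0.
elim: i => [|i IHi]; first by rewrite expg0 SL2_oneE expr0.
by rewrite expgS borelM_e11 ?groupX // IHi exprS.
Qed.

Lemma torus_log b : b != 0 -> exists i, b = g ^+ i.
Proof.
move=> nzb; have : tor b \in <[t0]>%g by rewrite T_t0 tor_in.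
by case/cycleP=> i /(congr1 e11); rewrite torE // e11_t0X => E; exists i.
Qed.

Let nzg : g != 0.
Proof. exact: borel_e11_neq0 (subsetP torus_sub t0 Tt0). Qed.

Let g_order : g ^+ (2 * n) = 1.
Proof. by rewrite -e11_t0X -order_t0 expg_order SL2_oneE. Qed.

Let g_n : g ^+ n = -1.
Proof.
rewrite -e11_t0X -(cycle_involution order_t0 negone_t0) ?negoneE //.
exact: order_negone.
Qed.

Definition is_square (a : F) : bool := a \in [set b ^+ 2 | b : F].

Let is_squareX b : is_square (b ^+ 2).
Proof. exact: imset_f. Qed.

Let square_log i : ~~ odd i -> is_square (g ^+ i).
Proof. by move=> e; rewrite -(odd_double_half i) (negPf e) -mul2n mulnC exprM. Qed.

Let nu_nonsquare s : s != 0 -> ~~ is_square (nu * s ^+ 2).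
Proof.
move=> nzs; apply/negP=> /imsetP[a _ E]; case/eqP: (nu_nsq (a / s)).
by rewrite exprMn exprVn -E mulfK // expf_neq0.
Qed.

(** Nonsquares have odd exponents in the generator g, so nu b is a square a^2, and b = nu (a /
    nu)^2. *)
Lemma nonsquare_class b : b != 0 -> ~~ is_square b -> exists2 s, s != 0 & b = nu * s ^+ 2.
Proof.
move=> nzb nsb; have nznu : nu != 0.
  by have := nu_nsq 0; rewrite expr0n eq_sym.
have [i Di] := torus_log nzb; have [j Dj] := torus_log nznu.
have oi : odd i by apply: contraNT nsb => ei; rewrite Di square_log.
have oj : odd j.
  have := @nu_nonsquare 1 (oner_neq0 _); rewrite expr1n mulr1.
  by apply: contraNT => ej; rewrite Dj square_log.
have /imsetP[a _ E] : is_square (nu * b).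
  by rewrite Di Dj -exprD square_log // oddD oi oj.
exists (a / nu).
  rewrite mulf_neq0 ?invr_eq0 //; apply: contraNneq nzb => a0.
  by move/eqP: E; rewrite a0 expr0n mulf_eq0 (negPf nznu).
by rewrite exprMn -E; field.
Qed.

Lemma neg1_square : is_square (-1) = ~~ odd n.
Proof.
apply/idP/idP=> [/imsetP[a _ E] | e]; last by rewrite -g_n square_log.
apply/negP=> o; have nza : a != 0.
  by apply: contraTneq isT => a0; move/eqP: E; rewrite a0 expr0n oppr_eq0 oner_eq0.
have [i Di] := torus_log nza; case/eqP: (neq_N1 nz2).
have : a ^+ (2 * n) = 1 by rewrite Di exprAC g_order expr1n.
by rewrite exprM -E -signr_odd o expr1.
Qed.

(** An element of [B1] is e [uni] c with e = 1 or -1, and e11 x * e12 x is c: the class ignores the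
    sign e. *)
Definition unip_class (b : bool) : {set {'GL_2[F]}} :=
  [set x in B1 :\: Z | is_square (e11 x * e12 x) == b].

Let in_unib x : (x \in B1 :\: Z) = (x \in B1) && (e12 x != 0).
Proof.
rewrite in_setD andbC; case B1x: (x \in B1) => //=.
congr (~~ _); apply/idP/eqP=> [|x12]; last exact: borel_e12_Z.
by rewrite in_set2 => /orP[] /eqP->; rewrite ?SL2_oneE ?negoneE.
Qed.

Let unibP x : x \in B1 -> e11 x = 1 \/ e11 x = -1.
Proof. by rewrite inE in_set2 => /andP[_ /orP[] /eqP]; [left | right]. Qed.

Let in_class b x : (x \in unip_class b) =
  [&& x \in B1, e12 x != 0 & is_square (e11 x * e12 x) == b].
Proof. by rewrite in_set in_unib andbA. Qed.

Lemma unib_cover : B1 :\: Z = unip_class true :|: unip_class false.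
Proof.
apply/setP=> x; rewrite in_setU !in_class in_unib.
by case: (x \in B1) => //=; case: (e12 x != 0) => //=; case: is_square.
Qed.

Lemma unib_disjoint : [disjoint unip_class true & unip_class false].
Proof.
rewrite -setI_eq0; apply/eqP/setP=> x; rewrite in_setI in_set0 !in_class.
by case: is_square; rewrite !(andbF, andbT).
Qed.

Let nznu : nu != 0. Proof. by have := nu_nsq 0; rewrite expr0n eq_sym. Qed.

Let square_mul_nu a : a != 0 -> is_square (nu * a) = ~~ is_square a.
Proof.
move=> nza; have [/imsetP[s _ E] | nsa] := boolP (is_square a).
  have nzs : s != 0 by apply: contraNneq nza => s0; rewrite E s0 expr0n.
  by rewrite E; apply/negbTE/nu_nonsquare.
have [s _ ->] := nonsquare_class nza nsa.
by rewrite mulrA -expr2 -exprMn is_squareX.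
Qed.

(** Multiplying the entry e12 by the nonsquare nu exchanges the two classes. *)
Lemma unip_class_card : #|unip_class true| = #|unip_class false|.
Proof.
pose f x := sl2 (e11 x) (nu * e12 x) 0 (e22 x).
have det x : x \in B1 -> e11 x * e22 x - nu * e12 x * 0 = 1.
  move=> /(subsetP unib_sub) Bx; have := SL2_det (sBS Bx).
  by rewrite (borel_e21 Bx) !mulr0.
have fE x : x \in B1 -> (e11 (f x) = e11 x) * (e12 (f x) = nu * e12 x) * (e22 (f x) =
  e22 x) * (e21 (f x) = 0).
  by move=> /det B1x; rewrite !(sl2E B1x).
have f_inj : {in B1 &, injective f}.
  move=> x y B1x B1y E; have e (a : {'GL_2[F]} -> F) : a (f x) = a (f y) by rewrite E.
  apply: SL2_eqP.
  - by have := e e11; rewrite !fE.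
  - by have := e e12; rewrite !fE // => /(mulfI nznu).
  - by rewrite !borel_e21 // (subsetP unib_sub).
  by have := e e22; rewrite !fE.
have f_class b x : x \in unip_class b -> f x \in unip_class (~~ b).
  rewrite !in_class => /and3P[B1x x12 /eqP sqx]; have Bx := subsetP unib_sub x B1x.
  rewrite !(fE x B1x) inE borelE (sl2_in (det x B1x)) !(fE x B1x) eqxx /=.
  rewrite mulf_neq0 // mulrCA square_mul_nu ?mulf_neq0 ?borel_e11_neq0 // sqx eqxx.
  by move: B1x; rewrite inE Bx => /= ->.
have le b : (#|unip_class b| <= #|unip_class (~~ b)|)%N.
  rewrite -(card_in_imset (f := f)); last first.
    by move=> x y; rewrite !in_class => /andP[B1x _] /andP[B1y _]; apply: f_inj.
  by apply/subset_leq_card/subsetP=> _ /imsetP[x Xx ->]; apply: f_class.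
by apply/eqP; rewrite eqn_leq (le true) (le false).
Qed.

Let unibE x : x \in B1 ->
  x = uni (e11 x * e12 x) \/ x = (uni (e11 x * e12 x)%R * negone F)%g.
Proof.
move=> B1x; have Bx := subsetP unib_sub x B1x.
have [x11 | x11] := unibP B1x; [left | right]; apply: SL2_eqP.
- by rewrite uniE.
- by rewrite uniE x11 mul1r.
- by rewrite uniE borel_e21.
- by rewrite uniE (borel_e22 Bx).2 x11 invr1.
- by rewrite SL2_mulE !uniE !negoneE x11 mulr0 addr0 mul1r.
- by rewrite SL2_mulE !uniE !negoneE x11 mulr0 add0r mulN1r mulrN1 opprK.
- by rewrite SL2_mulE !uniE !negoneE (borel_e21 Bx) mul0r mulr0 addr0.
by rewrite SL2_mulE !uniE !negoneE (borel_e22 Bx).2 x11 invrN1 mul0r add0r mul1r.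
Qed.

Let uni_tor (b s : F) : s != 0 -> (uni b ^ tor (s^-1)%R)%g = uni (b * s ^+ 2).
Proof.
move=> nzs; have nzV : s^-1 != 0 by rewrite invr_eq0.
have St : tor s^-1 \in S := sBS (subsetP torus_sub _ (tor_in nzV)).
apply: SL2_eqP; rewrite conjgE !SL2_mulE !(SL2_invE St) !uniE !(torE nzV) ?invrK.
- by field.
- by ring.
- by ring.
by field.
Qed.

Lemma unip_class_conj (b : F) (sq : bool) x : b != 0 ->
    (forall a, a != 0 -> is_square a = sq -> exists2 s, s != 0 & a = b * s ^+ 2) ->
    x \in unip_class sq ->
  exists2 y, y \in S & x = (uni b ^ y)%g \/ x = (uni b ^ y * negone F)%g.
Proof.
move=> nzb cl; rewrite in_class => /and3P[B1x x12 /eqP sqx].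
have nz : e11 x * e12 x != 0.
  by rewrite mulf_neq0 // borel_e11_neq0 // (subsetP unib_sub).
have [s nzs E] := cl _ nz sqx; exists (tor s^-1).
  by apply/sBS/(subsetP torus_sub)/tor_in; rewrite invr_eq0.
by rewrite uni_tor // -E; apply: unibE.
Qed.

Let uni_class (b : F) sq : b != 0 -> is_square b = sq -> uni b \in unip_class sq.
Proof.
move=> nzb sqb; rewrite in_class !uniE nzb mul1r sqb eqxx inE uni_in uniE.
by rewrite in_set2 eqxx.
Qed.

Let is_square1 : is_square 1. Proof. by rewrite -(expr1n _ 2) is_squareX. Qed.

Lemma uni1_class : uni 1 \in unip_class true.
Proof. by apply: uni_class; rewrite ?oner_neq0 ?is_square1. Qed.

Lemma uninu_class : uni nu \in unip_class false.
Proof.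
by apply: uni_class => //; rewrite -[nu]mulr1 square_mul_nu ?oner_neq0 ?is_square1.
Qed.

Lemma uni1V_class : (uni 1%R)^-1%g \in if odd n then unip_class false else unip_class true.
Proof.
have -> : ((uni 1%R)^-1)%g = uni (-1) :> {'GL_2[F]}.
  by apply: SL2_eqP; rewrite !(SL2_invE (sBS (uni_in 1))) !uniE ?oppr0.
by case: ifP => o; apply: uni_class; rewrite ?oppr_eq0 ?oner_neq0 // neg1_square o.
Qed.

(** * Jacobi sums of the torus characters *)

Definition tor_char w a : algC := if a == 0 then 0 else cyc_lin t0 w (tor a).

Definition jacobi w : algC := \sum_a tor_char w a * tor_char w (1 - a).

Lemma jacobi_aut (mu : {rmorphism algC -> algC}) w : mu (jacobi w) = jacobi (mu w).
Proof.
have tor_aut a : mu (tor_char w a) = tor_char (mu w) a.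
  by rewrite /tor_char; case: ifP; rewrite ?rmorph0 ?cyc_lin_aut.
rewrite /jacobi; move: (tor_char w) (tor_char (mu w)) tor_aut => L L' LE.
by rewrite rmorph_sum; apply: eq_bigr => a _; rewrite rmorphM !LE.
Qed.

Lemma jacobi_mul w : w ^+ n = 1 -> w ^+ 2 != 1 -> jacobi w * jacobi w^-1 = (2 * n).+1%:R.
Proof.
move=> wn nw2; rewrite -Dq.
have LM u a b : u ^+ n = 1 -> tor_char u (a * b) = tor_char u a * tor_char u b.
  move=> un; rewrite /tor_char mulf_eq0; have [-> | nza] := eqVneq a 0;
    first by rewrite /= mul0r.
  have [-> | nzb] := eqVneq b 0; first by rewrite /= mulr0.
  by rewrite torM ?inE // (cyc_linM (root_t0 un)) ?T_t0 ?tor_in.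
have sumL u : u ^+ n = 1 -> u != 1 -> \sum_a tor_char u a = 0.
  move=> un nu1; have Lg : tor_char u g = u.
    rewrite /tor_char (negPf nzg) -(tor_e11 Tt0).
    by have := cyc_linX 1 (root_t0 un); rewrite expg1 expr1.
  set s := \sum_a _; have Es : u * s = s.
    rewrite mulr_sumr [RHS](reindex_inj (mulfI nzg)) /=.
    by apply: eq_bigr => a _; rewrite LM // Lg.
  apply/eqP; move/eqP: Es; rewrite -subr_eq0 -[X in _ - X]mul1r -mulrBl.
  by rewrite mulf_eq0 subr_eq0 (negPf nu1).
have wVn : w^-1 ^+ n = 1 by rewrite exprVn wn invr1.
have nw1 : w != 1 by apply: contraNneq nw2 => ->; rewrite expr1n.
have nzw : w != 0.
  by apply: contra_eq_neq wn => ->; rewrite expr0n eqn0Ngt n_gt0 eq_sym oner_neq0.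
apply: jacobi_sum_mul.
- by rewrite /tor_char eqxx.
- by rewrite /tor_char oner_eq0 tor1 (cyc_lin1 (root_t0 wn)).
- by move=> a b; apply: LM.
- by rewrite /tor_char eqxx.
- by move=> a nza; rewrite /tor_char (negPf nza) -cyc_lin_mul mulfV ?cyc_lin_one.
- exact: sumL.
have w2n : (w ^+ 2) ^+ n = 1 by rewrite exprAC wn expr1n.
rewrite -[RHS](sumL _ w2n nw2); apply: eq_bigr => a _.
by rewrite /tor_char; case: ifP; rewrite ?expr0n // expr2 -cyc_lin_mul.
Qed.

Variable zeta : nat -> algC.
Hypothesis zeta_prim : forall k, (0 < k)%N -> k.-primitive_root (zeta k).

Lemma SL2_wedderburn_cyclic :
  (forall s, s ^+ 2 = (-1) ^+ n * (2 * n).+1%:R ->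
     (exists mu : {rmorphism algC -> algC}, mu s != s) ->
   wedderburn_family (S / 'Z(S))%G (@fam_gen n zeta unit s) (@fam_deg n unit))
  /\ (forall r : rat, ratr r ^+ 2 = (-1) ^+ n * (2 * n).+1%:R :> algC ->
   wedderburn_family (S / 'Z(S))%G (@fam_gen n zeta bool 0) (@fam_deg n bool)).
Proof.
have [v Sv [vv C_v]] := nsplit_weyl_exists nu_nsq.
have [zn prim_n] := C_prim_root_exists n_gt0.
have [zm prim_m] := C_prim_root_exists (ltn0Sn n).
have card_T : #|T| = (2 * n)%N by rewrite card_torus Dq.
have lamf_mul w w' x : lamf (w * w') x = lamf w x * lamf w' x by apply: cyc_lin_mul.
have lamf_aut (mu : {rmorphism algC -> algC}) w x : mu (lamf w x) = lamf (mu w) x.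
  exact: cyc_lin_aut.
have lamf_one x : lamf 1 x = 1 by apply: cyc_lin_one.
have thf1 w : w ^+ m = 1 -> cyc_lin c0 w 1%g = 1.
  by move=> wm; rewrite (cyc_lin1 (root_c0 wm)).
have C_conj c y : c \in C -> c \notin Z -> y \in S -> (c ^ y)%g \in C ->
    (c ^ y)%g = c \/ (c ^ y)%g = c^-1%g.
  by move=> Cc _ Sy; apply: (nsplit_conj nz2 nu_nsq Cc Sy).
have C_conj_B c y : c \in C -> y \in S -> (c ^ y)%g \in B -> c \in Z.
  by move=> Cc Sy; apply: (nsplit_borel nz2 nu_nsq Cc Sy).
have C_cent c y : c \in C -> c \notin Z -> y \in S -> (c ^ y)%g = c -> y \in C.
  by move=> Cc nZc Sy; apply: (nsplit_cent Cc nZc Sy).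
have X1J x : x \in unip_class true ->
    exists2 y, y \in S & x = (uni 1%R ^ y)%g \/ x = (uni 1%R ^ y * negone F)%g.
  apply: unip_class_conj; first exact: oner_neq0.
  move=> a nza /imsetP[s _ Da]; exists s; last by rewrite mul1r.
  by apply: contraNneq nza => s0; rewrite Da s0 expr0n.
have X2J x : x \in unip_class false ->
    exists2 y, y \in S & x = (uni nu ^ y)%g \/ x = (uni nu ^ y * negone F)%g.
  by apply: unip_class_conj => // a nza /negbT; apply: nonsquare_class.
exact: (wedderburn_cases n_gt0 (borel_sub F) (nsplit_sub nu) (center_SL2 F)
  (negone_neq1 nz2) (negone_sqr F) Z_unib unib_sub Z_nsplit torus_sub
  card_T card_borel2 card_nsplit2 card_SL2_2
  lamfM lamf1 lamf_mul lamf_aut lamf_one lamf_B1 lamf_gen lamf_orth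
  thfM thf1 (@cyc_lin_mul _ c0) (@cyc_lin_aut _ c0) (@cyc_lin_one _ c0) thf_Z thf_gen
    thf_orth
  (weyl_in F) weyl_notin (weyl_sqr F) (@weyl_conj_torus F)
  borel_conj_torus torus_conj_borel unib_conj_borel weyl_borel_weyl (@bruhat F)
  (nsplit_abelian nu) Sv vv C_v C_conj C_cent nsplit_involution C_conj_B
  prim_n prim_m jacobi_mul jacobi_aut torus_unib
  unib_cover unib_disjoint unip_class_card uni1_class uninu_class X1J X2J uni1V_class
  zeta_prim).
Qed.

End SL2Structure.

Lemma SL2_wedderburn (F : finFieldType) (n : nat) (zeta : nat -> algC) :
    2%:R != 0 :> F -> #|F| = (2 * n).+1 ->
    (forall k, (0 < k)%N -> k.-primitive_root (zeta k)) ->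
  (forall s, s ^+ 2 = (-1) ^+ n * (2 * n).+1%:R ->
     (exists mu : {rmorphism algC -> algC}, mu s != s) ->
   wedderburn_family (PSL2 F) (@fam_gen n zeta unit s) (@fam_deg n unit))
  /\ (forall r : rat, ratr r ^+ 2 = (-1) ^+ n * (2 * n).+1%:R :> algC ->
   wedderburn_family (PSL2 F) (@fam_gen n zeta bool 0) (@fam_deg n bool)).
Proof.
move=> nz2 Dq zeta_prim; have [nu nu_nsq] := nonsquare_exists nz2.
have /cyclicP[t0 T_gen] := torus_cyclic F.
have /cyclicP[c0 C_gen] := nsplit_cyclic nz2 nu_nsq.
by apply: (SL2_wedderburn_cyclic nz2 nu_nsq Dq (t0 := t0) (c0 := c0)) => //;
  apply: group_inj.
Qed.

(** * Assembling the isomorphism *)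

Section Coefficients.

Variables (A : algType rat) (phi : {rmorphism A -> algC}) (z : algC).
Hypothesis phi_inj : injective phi.
Hypothesis phi_Qadj : forall a, phi a \in Qadj_pred z.
Hypothesis phi_surj : forall x, x \in Qadj_pred z -> exists a, phi a = x.
Hypothesis phiZ : forall r a, phi (r *: a) = ratr r * phi a.

Variable k : nat.
Implicit Types M N : mx_alg k A.

Definition mx_emb M : 'M[algC]_k := map_mx phi M.

Lemma mx_embD M N : mx_emb (M + N) = mx_emb M + mx_emb N.
Proof. exact: map_mxD. Qed.

Lemma mx_embM M N : mx_emb (M * N) = mx_emb M *m mx_emb N.
Proof. exact: map_mxM. Qed.

Lemma mx_emb1 : mx_emb 1 = 1%:M.
Proof. exact: map_mx1. Qed.

Lemma mx_embZ r M : mx_emb (r *: M) = ratr r *: mx_emb M.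
Proof. by apply/matrixP=> i j; rewrite !mxE phiZ. Qed.

Lemma mx_emb_inj M N : mx_emb M = mx_emb N -> M = N.
Proof.
move=> /matrixP E; apply/matrixP=> i j; have := E i j.
by rewrite !mxE; apply: phi_inj.
Qed.

Lemma mx_emb_Qadj M i j : mx_emb M i j \in Qadj_pred z.
Proof. by rewrite mxE. Qed.

Lemma mx_emb_surj (M : 'M[algC]_k) : (forall i j, M i j \in Qadj_pred z) ->
  exists N, mx_emb N = M.
Proof.
move=> Mz; have /fin_all_exists[N NE] (ij : 'I_k * 'I_k) :
    exists a, phi a = M ij.1 ij.2 by apply: phi_surj.
exists (\matrix_(i, j) N (i, j) : 'M[A]_k).
by apply/matrixP=> i j; rewrite !mxE NE.
Qed.

End Coefficients.

Lemma Qadj_pred0 x : x \in Qadj_pred 0 -> exists r, ratr r = x.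
Proof.
move=> /asboolP/(_ Crat) K0; suff /CratP[r ->] : x \in Crat by exists r.
by apply: K0; [split=> [|a b Ka Kb|a b Ka Kb];
  rewrite ?rpred1 ?rpredB ?rpred_div | apply: rpred0].
Qed.

Section QadjEmbedding.

Variable z : algC.

Definition Qadj_emb : {rmorphism Qadj z -> algC} := val.

Lemma Qadj_emb_inj : injective Qadj_emb. Proof. exact: val_inj. Qed.

Lemma Qadj_emb_Qadj a : Qadj_emb a \in Qadj_pred z. Proof. exact: valP. Qed.

Lemma Qadj_emb_surj x : x \in Qadj_pred z -> exists a, Qadj_emb a = x.
Proof. by move=> Kx; exists (QAdj Kx). Qed.

Lemma Qadj_embZ r a : Qadj_emb (r *: a) = ratr r * Qadj_emb a.
Proof. by []. Qed.

End QadjEmbedding.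

Definition rat_emb : {rmorphism rat^o -> algC} := @ratr algC.

Lemma rat_emb_inj : injective rat_emb. Proof. exact: fmorph_inj. Qed.

Lemma rat_emb_Qadj a : rat_emb a \in Qadj_pred 0. Proof. exact: Qadj_ratr. Qed.

Lemma rat_emb_surj x : x \in Qadj_pred 0 -> exists a, rat_emb a = x.
Proof. exact: Qadj_pred0. Qed.

Lemma rat_embZ r (a : rat^o) : rat_emb (r *: a) = ratr r * rat_emb a.
Proof. exact: rmorphM. Qed.

Section Assembly.

Variables (n : nat) (zeta : nat -> algC) (H : finType) (hz : algC).
Variables (gT : finGroupType) (G : {group gT}).
Hypothesis wG : wedderburn_family G (@fam_gen n zeta H hz) (@fam_deg n H).

Variables (X : Type) (addX mulX : X -> X -> X) (oneX : X) (scaleX : rat -> X -> X).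
Variable JX : H -> X -> 'M[algC]_(half_deg n).
Hypothesis JX_Qadj : forall h x i j, JX h x i j \in Qadj_pred hz.
Hypothesis JX_inj : forall x y, (forall h, JX h x = JX h y) -> x = y.
Hypothesis JX_surj : forall M : H -> 'M[algC]_(half_deg n),
  (forall h i j, M h i j \in Qadj_pred hz) -> exists x, forall h, JX h x = M h.
Hypothesis JX_add : forall h x y, JX h (addX x y) = JX h x + JX h y.
Hypothesis JX_mul : forall h x y, JX h (mulX x y) = JX h x *m JX h y.
Hypothesis JX_one : forall h, JX h oneX = 1%:M.
Hypothesis JX_scale : forall h r x, JX h (scaleX r x) = ratr r *: JX h x.

Local Notation D k d := (\oplus_(c in divisors_gt2 k)
  mx_alg d (Qadj (zeta (val c) + (zeta (val c))^-1))).
Local Notation prod := (rat^o * X * D n.+1 (2 * n) * mx_alg (2 * n).+1 rat^o * D n (2 *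
  n).+2)%type.

(** The part X at the half characters is seen only through the maps [JX h]: it is one matrix algebra
    when they are conjugate and a product of two otherwise. *)
Let comp (i : unit + H + ({c | c \in divisors_gt2 n.+1} + (unit + {c | c \in
  divisors_gt2 n})))
    (b : prod) : 'M[algC]_(fam_deg i) :=
  match i return 'M[algC]_(fam_deg i) with
  | inl (inl _) => (ratr b.1.1.1.1)%:M
  | inl (inr h) => JX h b.1.1.1.2
  | inr (inl c) => mx_emb (Qadj_emb _) (b.1.1.2 c)
  | inr (inr (inl _)) => mx_emb rat_emb b.1.2
  | inr (inr (inr c)) => mx_emb (Qadj_emb _) (b.2 c)
  end.

Definition assembly_add (x y : prod) : prod :=
  (x.1.1.1.1 + y.1.1.1.1, addX x.1.1.1.2 y.1.1.1.2, x.1.1.2 + y.1.1.2,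
   x.1.2 + y.1.2, x.2 + y.2).

Definition assembly_mul (x y : prod) : prod :=
  (x.1.1.1.1 * y.1.1.1.1, mulX x.1.1.1.2 y.1.1.1.2, x.1.1.2 * y.1.1.2,
   x.1.2 * y.1.2, x.2 * y.2).

Definition assembly_scale (r : rat) (x : prod) : prod :=
  (r *: x.1.1.1.1, scaleX r x.1.1.1.2, r *: x.1.1.2, r *: x.1.2, r *: x.2).

Lemma group_alg_assembly : exists f : group_alg rat [subg G] -> prod,
  [/\ bijective f, forall a b, f (a + b) = assembly_add (f a) (f b),
      forall a b, f (a * b) = assembly_mul (f a) (f b), f 1 = (1, oneX, 1, 1, 1)
    & forall r a, f (r *: a) = assembly_scale r (f a)].
Proof.
apply: (group_alg_iso wG (J := comp)).
- move=> [[[] | h] | [c | [[] | c]]] b i j /=.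
  + by rewrite mxE; case: (i == j); rewrite ?mulr0n ?rpred0 ?mulr1n ?Qadj_ratr.
  + exact: JX_Qadj.
  + exact: (mx_emb_Qadj (@Qadj_emb_Qadj _)).
  + exact: (mx_emb_Qadj rat_emb_Qadj).
  exact: (mx_emb_Qadj (@Qadj_emb_Qadj _)).
- move=> [[[[a x] d1] M] d2] [[[[a' x'] d1'] M'] d2'] E.
  congr (_, _, _, _, _).
  + have /matrixP/(_ 0 0) := E (inl (inl tt)); rewrite !mxE !mulr1n.
    exact: fmorph_inj.
  + by apply: JX_inj => h; apply: (E (inl (inr h))).
  + by apply/ffunP=> c; apply: (mx_emb_inj (@Qadj_emb_inj _)); apply: (E (inr (inl c))).
  + by apply: (mx_emb_inj rat_emb_inj); apply: (E (inr (inr (inl tt)))).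
  by apply/ffunP=> c; apply: (mx_emb_inj (@Qadj_emb_inj _)); apply: (E (inr (inr (inr c)))).
- move=> M Mz.
  have [a Da] := Qadj_pred0 (Mz (inl (inl tt)) 0 0).
  have [x Dx] := JX_surj (fun h => Mz (inl (inr h))).
  have /fin_all_exists[d1 Dd1] c := mx_emb_surj (@Qadj_emb_surj _) (Mz (inr (inl c))).
  have [N DN] := mx_emb_surj rat_emb_surj (Mz (inr (inr (inl tt)))).
  have /fin_all_exists[d2 Dd2] c := mx_emb_surj (@Qadj_emb_surj _) (Mz (inr (inr (inr c)))).
  exists (a, x, finfun d1, N, finfun d2); case=> [[[] | h] | [c | [[] | c]]] /=.
  + by apply/matrixP=> i j; rewrite Da !ord1 mxE mulr1n.
  + exact: Dx.
  + by rewrite ffunE; apply: Dd1.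
  + exact: DN.
  by rewrite ffunE; apply: Dd2.
- move=> [[[] | h] | [c | [[] | c]]] x y /=.
  + by rewrite rmorphD raddfD.
  + exact: JX_add.
  + by rewrite ffunE mx_embD.
  + exact: mx_embD.
  by rewrite ffunE mx_embD.
- move=> [[[] | h] | [c | [[] | c]]] x y /=.
  + by rewrite -scalar_mxM; congr (_%:M); apply: rmorphM.
  + exact: JX_mul.
  + by rewrite ffunE mx_embM.
  + exact: mx_embM.
  by rewrite ffunE mx_embM.
- move=> [[[] | h] | [c | [[] | c]]] /=.
  + by rewrite rmorph1.
  + exact: JX_one.
  + by rewrite ffunE mx_emb1.
  + exact: mx_emb1.
  by rewrite ffunE mx_emb1.
move=> [[[] | h] | [c | [[] | c]]] r x /=.
+ by rewrite scale_scalar_mx; congr (_%:M); apply: rmorphM.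
+ exact: JX_scale.
+ by rewrite ffunE (mx_embZ (@Qadj_embZ _)).
+ exact: (mx_embZ rat_embZ).
by rewrite ffunE (mx_embZ (@Qadj_embZ _)).
Qed.

End Assembly.

Local Notation summands k d zeta := (\oplus_(c in divisors_gt2 k)
  mx_alg d (Qadj (zeta (val c) + (zeta (val c))^-1))).

(** The target is only a [pzRingType], the ring structure that direct sums over possibly empty
    families carry. *)
Lemma lrmorphism_exists (R : pzSemiRingType) (A : lSemiAlgType R) (B : pzRingType)
    (s : R -> B -> B) (f : A -> B) :
    bijective f -> {morph f : x y / x + y} -> {morph f : x y / x * y} -> f 1 = 1 ->
    scalable_for s f ->
  exists g : {lrmorphism A -> B | s}, bijective g.
Proof.
move=> bij_f fD fM f1 fZ; have f_nmod : nmod_morphism f.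
  by split=> //; apply: (addrI (f 0)); rewrite addr0 -fD addr0.
have f_monoid : monoid_morphism f by [].
pose g : {lrmorphism A -> B | s} := HB.pack f (GRing.isNmodMorphism.Build _ _ f f_nmod)
  (GRing.isMonoidMorphism.Build _ _ f f_monoid) (GRing.isScalable.Build _ _ _ _ f fZ).
by exists g.
Qed.

Section Instances.

Variables (n : nat) (zeta : nat -> algC) (gT : finGroupType) (G : {group gT}).

Local Notation total X := (rat^o * X * summands n.+1 (2 * n) zeta
    * mx_alg (2 * n).+1 rat^o * summands n (2 * n).+2 zeta)%type.

Lemma group_alg_irrational (s : algC) :
    wedderburn_family G (@fam_gen n zeta unit s) (@fam_deg n unit) ->
  group_alg rat [subg G] ~=alg total (mx_alg (half_deg n) (Qadj s)).
Proof.
move=> wG; pose X := mx_alg (half_deg n) (Qadj s).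
have [|||||||f [bij_f fD fM f1 fZ]] := @group_alg_assembly n zeta unit s gT G wG X
  (fun x y => x + y) (fun x y => x * y) 1 (fun r x => r *: x)
  (fun _ => @mx_emb _ (Qadj_emb s) _).
- by move=> _ x i j; apply: (mx_emb_Qadj (@Qadj_emb_Qadj s)).
- by move=> x y E; apply: (mx_emb_inj (@Qadj_emb_inj s)); apply: E tt.
- move=> M Mz; have [x Dx] := mx_emb_surj (@Qadj_emb_surj s) (Mz tt).
  by exists x; case.
- by move=> _ x y; apply: mx_embD.
- by move=> _ x y; apply: mx_embM.
- by move=> _; apply: mx_emb1.
- by move=> _ r x; apply: (mx_embZ (@Qadj_embZ s)).
exact: (lrmorphism_exists (B := total X) bij_f fD fM f1 fZ).
Qed.

Lemma group_alg_rational :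
    wedderburn_family G (@fam_gen n zeta bool 0) (@fam_deg n bool) ->
  group_alg rat [subg G] ~=alg
    total (mx_alg (half_deg n) rat^o * mx_alg (half_deg n) rat^o)%type.
Proof.
move=> wG; pose X := (mx_alg (half_deg n) rat^o * mx_alg (half_deg n) rat^o)%type.
have [|||||||f [bij_f fD fM f1 fZ]] := @group_alg_assembly n zeta bool 0 gT G wG X
  (fun x y => (x.1 + y.1, x.2 + y.2)) (fun x y => (x.1 * y.1, x.2 * y.2)) (1, 1)
  (fun r x => (r *: x.1, r *: x.2))
  (fun b x => mx_emb rat_emb (if b then x.1 else x.2)).
- by move=> b x i j; apply: (mx_emb_Qadj rat_emb_Qadj).
- move=> [x x'] [y y'] E; congr (_, _); apply: (mx_emb_inj rat_emb_inj).
    exact: E true.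
  exact: E false.
- move=> M Mz; have /fin_all_exists[x Dx] b := mx_emb_surj rat_emb_surj (Mz b).
  by exists (x true, x false); case; rewrite /= Dx.
- by case=> x y /=; apply: mx_embD.
- by case=> x y /=; apply: mx_embM.
- by case=> /=; apply: mx_emb1.
- by case=> r x /=; apply: (mx_embZ rat_embZ).
exact: (lrmorphism_exists (B := total X) bij_f fD fM f1 fZ).
Qed.

End Instances.

(** * Arithmetic of q and of its square roots *)

Lemma odd_card_two_neq0 (F : finFieldType) : odd #|F| -> 2%:R != 0 :> F.
Proof.
move=> oF; apply/eqP=> F2; have /eqP : (1 : F) *+ #|F| = 0.
  by rewrite -FinRing.zmodXgE -cardsT expg_cardG ?in_setT.
by rewrite -[#|F|]odd_double_half oF -mul2n mulrnDr mulrnA F2 mul0rn addr0 oner_eq0.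
Qed.

(** A number fixed by all automorphisms is rational, and its square cannot be negative. *)
Lemma sqrtC_neg_moved (k : nat) : (0 < k)%N ->
  exists mu : {rmorphism algC -> algC}, mu (sqrtC (- k%:R)) != sqrtC (- k%:R).
Proof.
move=> k_gt0; apply: contrapT => fixed; set s := sqrtC _ in fixed.
have /CratP[r Dr] : s \in Crat.
  by apply: Crat_fixed => mu; apply/eqP/negPn/negP=> ns; apply: fixed; exists mu.
have : 0 <= s ^+ 2 by rewrite Dr -rmorphXn ler0q sqr_ge0.
by rewrite sqrtCK oppr_ge0 lern0 eqn0Ngt k_gt0.
Qed.

(** If fixed by all automorphisms, the root is a rational algebraic integer, hence an integer. *)
Lemma sqrtC_nonsquare_moved (k : nat) : ~ (exists j : nat, k = (j ^ 2)%N) ->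
  exists mu : {rmorphism algC -> algC}, mu (sqrtC k%:R) != sqrtC k%:R.
Proof.
move=> nsq; apply: contrapT => fixed; set s := sqrtC _ in fixed.
have s_rat : s \in Crat.
  by apply: Crat_fixed => mu; apply/eqP/negPn/negP=> ns; apply: fixed; exists mu.
have s_Aint : s \in Aint.
  apply: (@root_monic_Aint ('X^2 - k%:R%:P)).
  - by rewrite rootE !hornerE sqrtCK subrr.
  - by rewrite monicXnsubC.
  apply/polyOverP=> i; rewrite coefB coefXn coefC.
  by apply: rpredB; [|case: eqP => _]; rewrite ?rpred_nat ?rpred0.
have s_ge0 : 0 <= s by rewrite sqrtC_ge0 ler0n.
have /natrP[j Dj] : s \in Num.nat by rewrite natrEint Cint_rat_Aint.
apply: nsq; exists j; apply/eqP; rewrite -(eqr_nat algC) natrX -Dj.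
by rewrite sqrtCK.
Qed.

Theorem theorem2 (p k q : nat) (p_prime : prime p) (p_odd : odd p)
    (k_gt0 : (0 < k)%N) (q_def : q = (p ^ k)%N)
    (F : finFieldType) (F_card : #|F| = q)
    (zeta : nat -> algC)
    (zeta_prim : forall d : nat, (0 < d)%N -> d.-primitive_root (zeta d)) :
  let A := divisors_gt2 ((q + 1) %/ 2) in
  let B := divisors_gt2 ((q - 1) %/ 2) in
  ((q %% 4 = 3)%N ->
     group_alg rat [subg PSL2 F] ~=alg
       rat^o
       * mx_alg ((q - 1) %/ 2) (Qadj (sqrtC (- q%:R)))
       * (\oplus_(d in A) mx_alg (q - 1) (Qadj (zeta (val d) + (zeta (val d))^-1)))
       * mx_alg q rat^o
       * (\oplus_(d in B) mx_alg (q + 1) (Qadj (zeta (val d) + (zeta (val d))^-1))))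
  /\
  ((q %% 4 = 1)%N ->
     (~ (exists m : nat, q = (m ^ 2)%N) ->
        group_alg rat [subg PSL2 F] ~=alg
          rat^o
          * mx_alg ((q + 1) %/ 2) (Qadj (sqrtC q%:R))
          * (\oplus_(d in A) mx_alg (q - 1) (Qadj (zeta (val d) + (zeta (val d))^-1)))
          * mx_alg q rat^o
          * (\oplus_(d in B) mx_alg (q + 1) (Qadj (zeta (val d) + (zeta (val d))^-1))))
     /\
     ((exists m : nat, q = (m ^ 2)%N) ->
        group_alg rat [subg PSL2 F] ~=alg
          rat^o
          * (mx_alg ((q + 1) %/ 2) rat^o * mx_alg ((q + 1) %/ 2) rat^o)
          * (\oplus_(d in A) mx_alg (q - 1) (Qadj (zeta (val d) + (zeta (val d))^-1)))
          * mx_alg q rat^o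
          * (\oplus_(d in B) mx_alg (q + 1) (Qadj (zeta (val d) + (zeta (val d))^-1))))).
Proof.
have q_odd : odd q by rewrite q_def oddX p_odd orbT.
have nz2 : 2%:R != 0 :> F by rewrite odd_card_two_neq0 // F_card.
pose n := q./2; have Dq : q = (2 * n).+1 by rewrite -[LHS]odd_double_half q_odd mul2n.
have [irrational rational] := SL2_wedderburn nz2 (etrans F_card Dq) zeta_prim.
move: n Dq irrational rational => n Dq irrational rational.
rewrite {}Dq /= {q q_def F_card q_odd}.
have -> : (((2 * n).+1 + 1) %/ 2 = n.+1)%N by lia.
have -> : (((2 * n).+1 - 1) %/ 2 = n)%N by lia.
have -> : ((2 * n).+1 - 1 = 2 * n)%N by lia.
have -> : ((2 * n).+1 + 1 = (2 * n).+2)%N by lia.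
(* q = 2 n + 1 is 3 modulo 4 exactly when n is odd; the half characters then have degree n, and the
   square of their difference is -q. *)
have sgn : (-1) ^+ n = (if odd n then -1 else 1) :> algC.
  by rewrite -signr_odd; case: (odd n).
split=> [q3 | q1].
  have o : odd n by lia.
  rewrite sgn o in irrational; have Dd : half_deg n = n by rewrite /half_deg o.
  have wG := irrational (sqrtC (- (2 * n).+1%:R)) _ (sqrtC_neg_moved (ltn0Sn _)).
  have := group_alg_irrational (wG _); rewrite Dd; apply.
  by rewrite sqrtCK mulN1r.
have e : odd n = false by lia.
have Dd : half_deg n = n.+1 by rewrite /half_deg e.
rewrite sgn e in irrational rational; split=> [nsq | [j Dj]].
  have wG := irrational (sqrtC (2 * n).+1%:R) _ (sqrtC_nonsquare_moved nsq).
  have := group_alg_irrational (wG _); rewrite Dd; apply.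
  by rewrite sqrtCK mul1r.
have := group_alg_rational (rational j%:R _); rewrite Dd; apply.
by rewrite ratr_nat mul1r Dj natrX.
Qed.
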